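(* Let $K$ be a field and let $\mathcal F$ be the graded $K$-vector space with basis the set of all finite spaces, equipped with the sum product $.$, the join product $\succ$, and the coproduct $$\Delta(\overline{\mathcal T})=\sum_{O\in\mathcal T}\overline{\mathcal T_{\mid [n]\setminus O}}\otimes\overline{\mathcal T_{\mid O}}$$ for $\mathcal T$ a topology on $[n]$. Then: 1. $(\mathcal F,.,\Delta)$ is a commutative Hopf algebra. 2. $(\mathcal F,\succ,\Delta)$ is an infinitesimal bialgebra. 3. $\mathcal F$ (with its Hopf algebra structure $(.,\Delta)$) is the $B_\infty$-enveloping algebra of a $B_\infty$-algebra; more precisely it is a commutative cofree Hopf algebra. 4. $\mathcal F$ can be equipped with the structure of a shuffle bialgebra or of an unshuffle bialgebra.
   Context: Gradings. All structures live in $Vect^+$, the category of graded vector spaces $V=\bigoplus_{n\ge0}V_n$ with $V_0=K$ (morphisms: degree $0$ linear maps that are the identity on $K$); $\epsilon$ is the projection to $V_0=K$. $Vect$ is the category of graded vector spaces with $V_0=0$. Hopf algebras/bialgebras are graded connected. $T(V)=\bigoplus_{n\ge0}V^{\otimes n}$ for $V\in Vect$, with grading induced by that of $V$; the deconcatenation coproduct is $v_1\cdots v_n\mapsto\sum_{i=0}^n v_1\cdots v_i\otimes v_{i+1}\cdots v_n$. Finite spaces. A finite space is a homeomorphism class $\overline{\mathcal T}$ of topologies on finite sets, represented by topologies $\mathcal T$ on $[n]=\{1,\dots,n\}$; its degree in $\mathcal F$ is $n$, and the empty space is $1$. Write $O(+n)=\{k+n\mid k\in O\}$. For $\mathcal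 T$ on $[n]$ and $\mathcal T'$ on $[n']$: $\mathcal T.\mathcal T'$ is the topology on $[n+n']$ with open sets $O\sqcup O'(+n)$ ($O\in\mathcal T,O'\in\mathcal T'$); $\mathcal T\succ\mathcal T'$ is the topology on $[n+n']$ with open sets $O\sqcup[n'](+n)$ ($O\in\mathcal T$) and $O'(+n)$ ($O'\in\mathcal T'$). These induce bilinear products $.$ and $\succ$ on $\mathcal F$ with common unit $1$. For $Y\subseteq[n]$, $\mathcal T_{\mid Y}=\{O\cap Y\mid O\in\mathcal T\}$ is the induced topology. $\Delta(1)=1\otimes1$ and $\Delta$ is extended linearly. Infinitesimal bialgebra: a unital associative algebra $(A,\cdot)$ and counital coassociative coalgebra $(A,\Delta)$ in $Vect^+$ such that, with $\Delta(x)=x_1\otimes x_2$, $\Delta(x\cdot y)=x\cdot y_1\otimes y_2+x_1\otimes x_2\cdot y-x\otimes y$. $B_\infty$-algebra: a $B_\infty$-algebra structure on $V\in Vect$ is a Hopf algebra structure on $T(V)$ whose coproduct is deconcatenation, i.e. an associative unital product on $T(V)$ which is a coalgebra map. The $B_\infty$-enveloping algebra of $V$ is the resulting Hopf algebra $T(V)$; a Hopf algebra ''is'' a $B_\infty$-enveloping algebra if it is isomorphic to such a one. Cofree means: cofree as a (connected) coassociative coalgebra in $Vect^+$, i.e. isomorphic as a coalgebra to some $T(V)$ with deconcatenation. Shuffle bialgebra: a commutative Hopf algebra in $Vect^+$ with product $\star$ and coproduct $\Delta$ such that $\star=\prec+\succ$ on $\mathrm{Ker}\,\epsilon$ with $x\prec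 y=y\succ x$ and $(x\prec y)\prec z=x\prec(y\prec z+y\succ z)$ ($\prec,\succ$ here are half-products, unrelated to the join), with $x\prec1=x$, $1\prec x=0$ for $x\in \mathrm{Ker}\,\epsilon$, and, writing $\Delta(x)=x\otimes1+1\otimes x+x'\otimes x''$, for $x,y\in \mathrm{Ker}\,\epsilon$, $$\Delta(x\prec y)=x\prec y\otimes1+1\otimes x\prec y+x\otimes y+x\prec y'\otimes y''+x'\prec y\otimes x''+x'\otimes x''\star y+x'\prec y'\otimes x''\star y''.$$ Unshuffle bialgebra: a bialgebra $(B,\cdot,\delta)$ in $Vect^+$ with $\delta$ coassociative cocommutative, equipped with maps $\delta_\prec,\delta_\succ:\mathrm{Ker}\,\epsilon\to B\otimes B$ such that $\delta=\delta_\prec+\delta_\succ$ on $\mathrm{Ker}\,\epsilon$, $\delta_\prec=\tau\circ\delta_\succ$ ($\tau$ the switch), $(\delta_\prec\otimes Id)\circ\delta_\prec=(Id\otimes\delta)\circ\delta_\prec$, $(\epsilon\otimes Id)\circ\delta_\prec=0$, $(Id\otimes\epsilon)\circ\delta_\prec=Id$, and, with $\delta_\prec(x)=x_1^\prec\otimes x_2^\prec$, $\delta(y)=y_1\otimes y_2$, $\delta_\prec(x\cdot y)=x_1^\prec\cdot y_1\otimes x_2^\prec\cdot y_2$ for $x,y\in \mathrm{Ker}\,\epsilon$. *)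

(* Defs.v *)
From HB Require Import structures.
From mathcomp Require Import all_boot all_order all_algebra.
From mathcomp Require Import generic_quotient finmap.
From mathcomp Require Import monalg.

Set Implicit Arguments.
Unset Strict Implicit.
Unset Printing Implicit Defensive.

Import GRing.Theory.
Local Open Scope ring_scope.

Reserved Notation "u \ox v" (at level 40, left associativity).

(* A graded K-vector space is given by a homogeneous basis X with its degree
   function: the space is {malg K[X]}, the finitely supported functions X -> K,
   and << x >> is the basis vector x.  Over a field every graded vector space
   has this form.  Accordingly {malg K[X]} (x) {malg K[Y]} is {malg K[X * Y]},
   where << (x, y) >> is << x >> (x) << y >>. *)

(* Objects of Vect (V_0 = 0). *)
Record vect := Vect {
  vect_basis :> choiceType;
  vect_deg : vect_basis -> nat;
  vect_deg_gt0 : forall x, (0 < vect_deg x)%N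
}.

(* Objects of Vect^+: the unique basis vector b1 of degree 0 identifies the
   degree 0 component with K; it is the unit of every algebra in Vect^+. *)
Record vectp := Vectp {
  vectp_basis :> choiceType;
  deg : vectp_basis -> nat;
  b1 : vectp_basis;
  deg_eq0 : forall x, deg x = 0%N <-> x = b1
}.

Arguments b1 {v}.

Section LinearExtension.
Variables (K : fieldType) (X : choiceType) (W : lmodType K) (f : X -> W).

Definition lext (u : {malg K[X]}) : W := \sum_(x <- msupp u) u@_x *: f x.

Lemma lextEw (d : {fset X}) (u : {malg K[X]}) :
  (msupp u `<=` d)%fset -> lext u = \sum_(x <- d) u@_x *: f x.
Proof.
move=> sud; rewrite /lext; apply: big_fset_incl => // x _ xNu.
by rewrite mcoeff_outdom // scale0r.
Qed.

Lemma lext_is_linear : linear lext.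
Proof.
move=> a u v; pose d := (msupp u `|` msupp v)%fset.
have su : (msupp u `<=` d)%fset by exact: fsubsetUl.
have sv : (msupp v `<=` d)%fset by exact: fsubsetUr.
have sw : (msupp (a *: u + v) `<=` d)%fset.
  apply: fsubset_trans (msuppD_le _ _) _; apply: fsetSU; exact: msuppZ_le.
rewrite (lextEw su) (lextEw sv) (lextEw sw) scaler_sumr -big_split /=.
by apply: eq_bigr => x _; rewrite mcoeffD mcoeffZ scalerDl scalerA.
Qed.

HB.instance Definition _ :=
  GRing.isLinear.Build K {malg K[X]} W *:%R lext lext_is_linear.

Lemma lextU x : lext << x >> = f x.
Proof.
rewrite (@lextEw [fset x]%fset) ?msuppU_le // big_seq_fset1.
by rewrite mcoeffUU scale1r.
Qed.

End LinearExtension.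

(* Degree 0 maps; it suffices to test a linear map on the basis. *)
Definition homogeneous (K : fieldType) (X Y : choiceType)
    (dX : X -> nat) (dY : Y -> nat) (f : {malg K[X]} -> {malg K[Y]}) :=
  forall x y, y \in msupp (f << x >>) -> dY y = dX x.

Section Tensors.
Variable K : fieldType.
Implicit Types X Y Z : choiceType.

Definition tdeg X Y (dX : X -> nat) (dY : Y -> nat) (p : X * Y) : nat :=
  (dX p.1 + dY p.2)%N.

Definition tens X Y (u : {malg K[X]}) (v : {malg K[Y]}) :
    {malg K[(X * Y)%type]} :=
  \sum_(x <- msupp u) \sum_(y <- msupp v) << u@_x * v@_y *g (x, y) >>.

Notation "u \ox v" := (tens u v).

Lemma tensUU X Y (x : X) (y : Y) :
  << x >> \ox << y >> = << (x, y) >> :> {malg K[(X * Y)%type]}.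
Proof.
rewrite /tens !(msuppU, oner_eq0) !big_seq_fset1.
by rewrite !mcoeffUU mulr1.
Qed.

(* f (x) g, for linear maps f and g. *)
Definition tmap X Y X' Y' (f : {malg K[X]} -> {malg K[X']})
    (g : {malg K[Y]} -> {malg K[Y']}) :
    {malg K[(X * Y)%type]} -> {malg K[(X' * Y')%type]} :=
  lext (fun p => f << p.1 >> \ox g << p.2 >>).

(* (x (x) y) (x) z |-> x (x) (y (x) z) *)
Definition tassoc X Y Z :
    {malg K[(X * Y * Z)%type]} -> {malg K[(X * (Y * Z))%type]} :=
  lext (fun p => << (p.1.1, (p.1.2, p.2)) >>).

Definition tswap X Y : {malg K[(X * Y)%type]} -> {malg K[(Y * X)%type]} :=
  lext (fun p => << (p.2, p.1) >>).

(* (x (x) x') (x) (y (x) y') |-> (x (x) y) (x) (x' (x) y') *)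
Definition tmid X X' Y Y' :
    {malg K[((X * X') * (Y * Y'))%type]} ->
    {malg K[((X * Y) * (X' * Y'))%type]} :=
  lext (fun p => << ((p.1.1, p.2.1), (p.1.2, p.2.2)) >>).

(* f (x) Id and Id (x) f for a linear form f, with K (x) A and A (x) K
   identified with A. *)
Definition lcontr X Y (f : {malg K[X]} -> K) :
    {malg K[(X * Y)%type]} -> {malg K[Y]} :=
  lext (fun p => f << p.1 >> *: << p.2 >>).

Definition rcontr X Y (f : {malg K[Y]} -> K) :
    {malg K[(X * Y)%type]} -> {malg K[X]} :=
  lext (fun p => f << p.2 >> *: << p.1 >>).

End Tensors.

Notation "u \ox v" := (tens u v) : ring_scope.

Section Structures.
Variables (K : fieldType) (B : vectp).

Local Notation A := {malg K[B]}.
Local Notation AA := {malg K[(B * B)%type]}.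
Local Notation degAA := (tdeg (@deg B) (@deg B)).

Definition unit1 : A := << b1 >>.

(* epsilon: b1 is the only basis vector of degree 0. *)
Definition counit (u : A) : K := u@_b1.

Definition in_Ker (u : A) : Prop := counit u = 0.

Record is_algebra (m : {linear AA -> A}) : Prop := IsAlgebra {
  mul_homogeneous : homogeneous degAA (@deg B) m;
  mul_assoc : forall x y z : A, m (m (x \ox y) \ox z) = m (x \ox m (y \ox z));
  mul_unit_l : forall x : A, m (unit1 \ox x) = x;
  mul_unit_r : forall x : A, m (x \ox unit1) = x
}.

Record is_coalgebra (D : {linear A -> AA}) : Prop := IsCoalgebra {
  comul_homogeneous : homogeneous (@deg B) degAA D;
  comul_unit : D unit1 = unit1 \ox unit1;
  comul_coassoc : forall x : A, tassoc (tmap D id (D x)) = tmap id D (D x);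
  comul_counit_l : forall x : A, lcontr counit (D x) = x;
  comul_counit_r : forall x : A, rcontr counit (D x) = x
}.

(* The product (u (x) u') (v (x) v') = u v (x) u' v'  of A (x) A. *)
Definition mul2 (m : {linear AA -> A}) (s t : AA) : AA :=
  tmap m m (tmid (s \ox t)).

Record is_bialgebra (m : {linear AA -> A}) (D : {linear A -> AA}) : Prop :=
  IsBialgebra {
  bialg_algebra : is_algebra m;
  bialg_coalgebra : is_coalgebra D;
  bialg_comul_mul : forall x y : A, D (m (x \ox y)) = mul2 m (D x) (D y);
  bialg_counit_mul : forall x y : A,
    counit (m (x \ox y)) = counit x * counit y
}.

Definition is_antipode (m : {linear AA -> A}) (D : {linear A -> AA})
    (S : {linear A -> A}) : Prop :=
  [/\ homogeneous (@deg B) (@deg B) S,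
      (forall x : A, m (tmap S id (D x)) = counit x *: unit1)
    & (forall x : A, m (tmap id S (D x)) = counit x *: unit1)].

Definition is_hopf (m : {linear AA -> A}) (D : {linear A -> AA}) : Prop :=
  is_bialgebra m D /\ exists S : {linear A -> A}, is_antipode m D S.

Definition is_commutative (m : {linear AA -> A}) : Prop :=
  forall x y : A, m (x \ox y) = m (y \ox x).

Definition is_cocommutative (D : {linear A -> AA}) : Prop :=
  forall x : A, tswap (D x) = D x.

Definition is_commutative_hopf (m : {linear AA -> A}) (D : {linear A -> AA}) :
    Prop :=
  is_hopf m D /\ is_commutative m.

(* Delta(x y) = x y_1 (x) y_2 + x_1 (x) x_2 y - x (x) y *)
Record is_infinitesimal (m : {linear AA -> A}) (D : {linear A -> AA}) : Prop :=
  IsInfinitesimal {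
  inf_algebra : is_algebra m;
  inf_coalgebra : is_coalgebra D;
  inf_comul_mul : forall x y : A,
    D (m (x \ox y)) = tmap (fun y1 => m (x \ox y1)) id (D y)
                      + tmap id (fun x2 => m (x2 \ox y)) (D x)
                      - x \ox y
}.

(* x' (x) x'' *)
Definition redcomul (D : {linear A -> AA}) (x : A) : AA :=
  D x - x \ox unit1 - unit1 \ox x.

(* The half-products are total bilinear maps; nothing is required of their
   value on 1 (x) 1, which is never used, beyond its degree. *)
Record is_shuffle_bialgebra (star prec succ : {linear AA -> A})
    (D : {linear A -> AA}) : Prop := IsShuffleBialgebra {
  sh_hopf : is_commutative_hopf star D;
  sh_prec_homogeneous : homogeneous degAA (@deg B) prec;
  sh_succ_homogeneous : homogeneous degAA (@deg B) succ;
  sh_star : forall x y : A, in_Ker x -> in_Ker y ->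
    star (x \ox y) = prec (x \ox y) + succ (x \ox y);
  sh_prec_succ : forall x y : A, in_Ker x -> in_Ker y ->
    prec (x \ox y) = succ (y \ox x);
  sh_prec_assoc : forall x y z : A, in_Ker x -> in_Ker y -> in_Ker z ->
    prec (prec (x \ox y) \ox z)
    = prec (x \ox (prec (y \ox z) + succ (y \ox z)));
  sh_prec_unit_r : forall x : A, in_Ker x -> prec (x \ox unit1) = x;
  sh_prec_unit_l : forall x : A, in_Ker x -> prec (unit1 \ox x) = 0;
  sh_comul_prec : forall x y : A, in_Ker x -> in_Ker y ->
    D (prec (x \ox y))
    = prec (x \ox y) \ox unit1 + unit1 \ox prec (x \ox y) + x \ox y
      + tmap (fun y' => prec (x \ox y')) id (redcomul D y)
      + tmap (fun x' => prec (x' \ox y)) id (redcomul D x)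
      + tmap id (fun x'' => star (x'' \ox y)) (redcomul D x)
      + tmap prec star (tmid (redcomul D x \ox redcomul D y))
}.

(* The half-coproducts are only specified on the kernel of the counit.  In
   [ush_coassoc] this is enough: by [ush_counit_l] the left components of
   dprec x lie in that kernel. *)
Record is_unshuffle_bialgebra (m : {linear AA -> A})
    (d dprec dsucc : {linear A -> AA}) : Prop := IsUnshuffleBialgebra {
  ush_bialgebra : is_bialgebra m d;
  ush_cocommutative : is_cocommutative d;
  ush_dprec_homogeneous : homogeneous (@deg B) degAA dprec;
  ush_dsucc_homogeneous : homogeneous (@deg B) degAA dsucc;
  ush_d : forall x : A, in_Ker x -> d x = dprec x + dsucc x;
  ush_dprec_dsucc : forall x : A, in_Ker x -> dprec x = tswap (dsucc x);
  ush_coassoc : forall x : A, in_Ker x ->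
    tassoc (tmap dprec id (dprec x)) = tmap id d (dprec x);
  ush_counit_l : forall x : A, in_Ker x -> lcontr counit (dprec x) = 0;
  ush_counit_r : forall x : A, in_Ker x -> rcontr counit (dprec x) = x;
  ush_dprec_mul : forall x y : A, in_Ker x -> in_Ker y ->
    dprec (m (x \ox y)) = mul2 m (dprec x) (d y)
}.

End Structures.

Section Isomorphisms.
Variables (K : fieldType) (B C : vectp).

Record is_coalgebra_iso
    (DB : {linear {malg K[B]} -> {malg K[(B * B)%type]}})
    (DC : {linear {malg K[C]} -> {malg K[(C * C)%type]}})
    (phi : {linear {malg K[B]} -> {malg K[C]}}) : Prop := IsCoalgebraIso {
  iso_bij : bijective phi;
  iso_homogeneous : homogeneous (@deg B) (@deg C) phi;
  iso_unit : phi (unit1 K B) = unit1 K C;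
  iso_counit : forall x, counit (phi x) = counit x;
  iso_comul : forall x, DC (phi x) = tmap phi phi (DB x)
}.

Definition is_hopf_iso
    (mB : {linear {malg K[(B * B)%type]} -> {malg K[B]}})
    (DB : {linear {malg K[B]} -> {malg K[(B * B)%type]}})
    (mC : {linear {malg K[(C * C)%type]} -> {malg K[C]}})
    (DC : {linear {malg K[C]} -> {malg K[(C * C)%type]}})
    (phi : {linear {malg K[B]} -> {malg K[C]}}) : Prop :=
  is_coalgebra_iso DB DC phi /\
  forall x y, phi (mB (x \ox y)) = mC (phi x \ox phi y).

End Isomorphisms.

(* T(V) has as homogeneous basis the words in the homogeneous basis of V: the
   word v_1 ... v_n is the tensor << v_1 >> (x) ... (x) << v_n >>. *)

Section TensorCoalgebra.
Variable V : vect.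

Definition word_deg (w : seq V) : nat := (\sum_(v <- w) vect_deg v)%N.

Lemma word_deg_eq0 w : word_deg w = 0%N <-> w = [::].
Proof.
split=> [|->]; last by rewrite /word_deg big_nil.
case: w => [//|v w]; rewrite /word_deg big_cons => /eqP.
by rewrite addn_eq0 eqn0Ngt vect_deg_gt0.
Qed.

Definition tensorp : vectp := Vectp word_deg_eq0.

Variable K : fieldType.

Definition deconc_word (w : seq V) : {malg K[(tensorp * tensorp)%type]} :=
  \sum_(i < (size w).+1) << (take i w : tensorp, drop i w : tensorp) >>.

Definition deconc :
    {linear {malg K[tensorp]} -> {malg K[(tensorp * tensorp)%type]}} :=
  lext deconc_word.

(* m is a B_infty-algebra structure on V. *)
Definition is_binfty
    (m : {linear {malg K[(tensorp * tensorp)%type]} -> {malg K[tensorp]}}) :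
    Prop :=
  is_hopf m deconc.

End TensorCoalgebra.

Arguments deconc V K : clear implicits.

Section Binfty.
Variables (K : fieldType) (B : vectp).

Definition is_binfty_enveloping
    (m : {linear {malg K[(B * B)%type]} -> {malg K[B]}})
    (D : {linear {malg K[B]} -> {malg K[(B * B)%type]}}) : Prop :=
  exists (V : vect)
    (mV : {linear {malg K[(tensorp V * tensorp V)%type]} ->
                  {malg K[tensorp V]}}),
    is_binfty mV /\
    exists phi : {linear {malg K[B]} -> {malg K[tensorp V]}},
      is_hopf_iso m D mV (deconc V K) phi.

Definition is_cofree
    (D : {linear {malg K[B]} -> {malg K[(B * B)%type]}}) : Prop :=
  exists (V : vect) (phi : {linear {malg K[B]} -> {malg K[tensorp V]}}),
    is_coalgebra_iso D (deconc V K) phi.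

End Binfty.

Section Topologies.
Variable S : finType.

(* The sets are finite, so binary unions and intersections suffice. *)
Definition is_topology (T : {set {set S}}) : bool :=
  [&& set0 \in T, setT \in T,
      [forall A in T, forall B in T, A :|: B \in T]
    & [forall A in T, forall B in T, A :&: B \in T]].

Lemma is_topologyP (T : {set {set S}}) :
  reflect [/\ set0 \in T, setT \in T,
              {in T &, forall A B, A :|: B \in T}
            & {in T &, forall A B, A :&: B \in T}]
          (is_topology T).
Proof.
apply: (iffP and4P) => -[T0 T1 TU TI]; split=> //.
- by move=> A B AT BT; move/forall_inP: TU => /(_ _ AT) /forall_inP; apply.
- by move=> A B AT BT; move/forall_inP: TI => /(_ _ AT) /forall_inP; apply.
- by apply/forall_inP=> A AT; apply/forall_inP=> B BT; apply: TU.
- by apply/forall_inP=> A AT; apply/forall_inP=> B BT; apply: TI.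
Qed.

Record topology : predArgType := Topology {
  opens :> {set {set S}};
  _ : is_topology opens
}.

HB.instance Definition _ := [isSub for opens].
HB.instance Definition _ := [Finite of topology by <:].

Lemma topologyP (T : topology) : is_topology T.
Proof. exact: valP T. Qed.

End Topologies.

Definition homeomorphism (S S' : finType) (T : topology S) (T' : topology S')
    (f : S -> S') : Prop :=
  bijective f /\ forall O : {set S}, (f @: O \in opens T') = (O \in opens T).

Definition homeomorphic (S S' : finType) (T : topology S) (T' : topology S') :
    bool :=
  [exists f : {ffun S -> S'},
    [&& injectiveb f, f @: setT == setT
      & [forall O : {set S}, (f @: O \in opens T') == (O \in opens T)]]].

Lemma homeomorphicP (S S' : finType) (T : topology S) (T' : topology S') :
  reflect (exists f, homeomorphism T T' f) (homeomorphic T T').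
Proof.
apply: (iffP existsP) => [[f /and3P[/injectiveP f_inj /eqP fT /forallP fO]]|].
  exists f; split=> [|O]; last exact/eqP.
  by apply: inj_card_bij => //; rewrite -cardsT -fT card_imset // cardsT.
case=> f [f_bij fO]; exists (finfun f); apply/and3P.
have ef : finfun f =1 f by move=> x; rewrite ffunE.
split.
- by apply/injectiveP => x y; rewrite !ef; apply: (bij_inj f_bij).
- apply/eqP/setP => y; rewrite inE; case: f_bij => g _ gK.
  by apply/imsetP; exists (g y); rewrite ?ef ?gK ?inE.
- by apply/forallP => O; rewrite (eq_imset _ ef) fO.
Qed.

Lemma homeomorphic_refl (S : finType) (T : topology S) : homeomorphic T T.
Proof.
apply/homeomorphicP; exists id; split; first exact: (Bijective (g := id)).
by move=> O; rewrite imset_id.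
Qed.

Lemma homeomorphic_sym (S S' : finType) (T : topology S) (T' : topology S') :
  homeomorphic T T' -> homeomorphic T' T.
Proof.
case/homeomorphicP=> f [[g fK gK] fO]; apply/homeomorphicP; exists g.
split=> [|O]; first by exists f.
rewrite -fO -imset_comp (eq_imset (g := id)) ?imset_id //.
Qed.

Lemma homeomorphic_trans (S S' S'' : finType) (T : topology S)
    (T' : topology S') (T'' : topology S'') :
  homeomorphic T T' -> homeomorphic T' T'' -> homeomorphic T T''.
Proof.
case/homeomorphicP=> f [f_bij fO] /homeomorphicP[g [g_bij gO]].
apply/homeomorphicP; exists (g \o f); split; first exact: bij_comp.
by move=> O; rewrite imset_comp gO fO.
Qed.

(* Topologies on some [n]; the points 1, ..., n are the elements of 'I_n. *)
Definition fin_topology := {n : nat & topology 'I_n}.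

Definition eq_space : rel fin_topology :=
  fun X Y => homeomorphic (tagged X) (tagged Y).

Lemma eq_space_refl : reflexive eq_space.
Proof. by move=> X; apply: homeomorphic_refl. Qed.

Lemma eq_space_sym : symmetric eq_space.
Proof. by move=> X Y; apply/idP/idP; apply: homeomorphic_sym. Qed.

Lemma eq_space_trans : transitive eq_space.
Proof. by move=> Y X Z; apply: homeomorphic_trans. Qed.

Canonical eq_space_equiv :=
  EquivRel eq_space eq_space_refl eq_space_sym eq_space_trans.

Definition fspace := {eq_quot eq_space}%qT.

HB.instance Definition _ := Choice.on fspace.
HB.instance Definition _ := EqQuotient.on fspace.

Definition fclass n (T : topology 'I_n) : fspace :=
  \pi_fspace%qT (Tagged (fun n => topology 'I_n) T).

Lemma fclassP n n' (T : topology 'I_n) (T' : topology 'I_n') :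
  reflect (fclass T = fclass T') (homeomorphic T T').
Proof. by apply: (iffP idP) => [h|/eqmodP//]; apply/eqmodP. Qed.

Lemma homeomorphism_preim (S S' : finType) (T : topology S) (T' : topology S')
    (f : S -> S') :
  homeomorphism T T' f <->
  bijective f /\ forall O : {set S'}, (f @^-1: O \in opens T) = (O \in opens T').
Proof.
split=> -[f_bij fO]; split=> // O.
- have e : f @: (f @^-1: O) = O.
    apply/setP=> y; case: f_bij => g fK gK.
    apply/imsetP/idP => [[x]|yO]; first by rewrite inE => xO ->.
    by exists (g y); rewrite ?inE gK.
  by rewrite -[in RHS]e fO.
- have e : f @^-1: (f @: O) = O.
    apply/setP=> x; rewrite inE mem_imset //; exact: bij_inj.
  by rewrite -[in RHS]e fO.
Qed.

(* The point k of [n'] becomes the point k + n of [n + n'], i.e. rshift n k. *)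
Section SumJoin.
Variables (n n' : nat) (T : topology 'I_n) (T' : topology 'I_n').
Implicit Type U : {set 'I_(n + n')}.

Definition cup_shift (O : {set 'I_n}) (O' : {set 'I_n'}) : {set 'I_(n + n')} :=
  (@lshift n n' @: O) :|: (@rshift n n' @: O').

Definition sum_opens : {set {set 'I_(n + n')}} :=
  [set cup_shift O O' | O in opens T, O' in opens T'].

Definition join_opens : {set {set 'I_(n + n')}} :=
  [set cup_shift O setT | O in opens T] :|:
  [set @rshift n n' @: O' | O' : {set 'I_n'} in opens T'].

Let lpre U := @lshift n n' @^-1: U.
Let rpre U := @rshift n n' @^-1: U.

Let lpre_cup O O' : lpre (cup_shift O O') = O.
Proof.
apply/setP=> i; rewrite !inE mem_imset; last exact: lshift_inj.
by case: imsetP => [[j _ /eqP]|]; rewrite ?eq_shift // orbF.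
Qed.

Let rpre_cup O O' : rpre (cup_shift O O') = O'.
Proof.
apply/setP=> i; rewrite !inE [X in _ || X]mem_imset; last exact: rshift_inj.
by case: imsetP => [[j _ /eqP]|]; rewrite ?eq_shift.
Qed.

Let cup_pre U : cup_shift (lpre U) (rpre U) = U.
Proof.
apply/setP=> i; case: (split_ordP i) => j ->.
  by have /setP/(_ j) := lpre_cup (lpre U) (rpre U); rewrite !inE.
by have /setP/(_ j) := rpre_cup (lpre U) (rpre U); rewrite !inE.
Qed.

Lemma in_sum_opens U :
  (U \in sum_opens) = (lpre U \in opens T) && (rpre U \in opens T').
Proof.
apply/imset2P/andP => [[O O' OT OT' ->]|[lT rT']].
  by rewrite lpre_cup rpre_cup.
by exists (lpre U) (rpre U); rewrite ?cup_pre.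
Qed.

Lemma in_join_opens U :
  (U \in join_opens) = (lpre U \in opens T) && (rpre U == setT)
                    || (lpre U == set0) && (rpre U \in opens T').
Proof.
have cup0 (O' : {set 'I_n'}) : @rshift n n' @: O' = cup_shift set0 O'.
  by rewrite /cup_shift imset0 set0U.
rewrite inE; congr (_ || _).
  apply/imsetP/andP => [[O OT ->]|[lT /eqP rT]].
    by rewrite lpre_cup rpre_cup.
  by exists (lpre U) => //; rewrite -[LHS]cup_pre rT.
apply/imsetP/andP => [[O' OT' ->]|[/eqP l0 rT]].
  by rewrite cup0 lpre_cup rpre_cup.
by exists (rpre U) => //; rewrite -[LHS]cup_pre l0 cup0.
Qed.

Lemma sum_is_topology : is_topology sum_opens.
Proof.
have /is_topologyP[T0 T1 TU TI] := topologyP T.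
have /is_topologyP[T'0 T'1 T'U T'I] := topologyP T'.
apply/is_topologyP; split; rewrite ?in_sum_opens /lpre /rpre.
- by rewrite !preimset0 T0.
- by rewrite !preimsetT T1.
- move=> A B; rewrite !in_sum_opens => /andP[? ?] /andP[? ?].
  by rewrite /lpre /rpre !preimsetU TU ?T'U.
- move=> A B; rewrite !in_sum_opens => /andP[? ?] /andP[? ?].
  by rewrite /lpre /rpre !preimsetI TI ?T'I.
Qed.

Lemma join_is_topology : is_topology join_opens.
Proof.
have /is_topologyP[T0 T1 TU TI] := topologyP T.
have /is_topologyP[T'0 T'1 T'U T'I] := topologyP T'.
apply/is_topologyP; split; rewrite ?in_join_opens /lpre /rpre.
- by rewrite !preimset0 T'0 eqxx orbT.
- by rewrite !preimsetT T1 eqxx.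
- move=> A B; rewrite !in_join_opens /lpre /rpre !preimsetU.
  case/orP=> /andP[a1 a2] /orP[] /andP[b1 b2].
  + by rewrite TU //= (eqP a2) setTU eqxx.
  + by rewrite (eqP b1) (eqP a2) setU0 setTU a1 eqxx.
  + by rewrite (eqP a1) (eqP b2) set0U setUT b1 eqxx.
  + by rewrite T'U // (eqP a1) (eqP b1) setU0 eqxx orbT.
- move=> A B; rewrite !in_join_opens /lpre /rpre !preimsetI.
  case/orP=> /andP[a1 a2] /orP[] /andP[b1 b2].
  + by rewrite TI //= (eqP a2) (eqP b2) setIT eqxx.
  + by rewrite (eqP b1) (eqP a2) setI0 setTI b2 eqxx orbT.
  + by rewrite (eqP a1) (eqP b2) set0I setIT a2 eqxx orbT.
  + by rewrite T'I // (eqP a1) set0I eqxx orbT.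
Qed.

Definition top_sum := Topology sum_is_topology.
Definition top_join := Topology join_is_topology.

End SumJoin.

(* The topology induced on Y, transported to [#|Y|] along the enumeration
   enum_val of Y; for S = [n] this is the increasing one. *)
Section Restriction.
Variables (S : finType) (T : topology S) (Y : {set S}).

Definition restr_opens : {set {set 'I_#|Y|}} :=
  [set [set i : 'I_#|Y| | enum_val i \in O :&: Y] | O : {set S} in opens T].

Lemma restr_opensP U :
  reflect (exists2 O, O \in opens T & U = (@enum_val _ (mem Y)) @^-1: O)
          (U \in restr_opens).
Proof.
have e O : [set i : 'I_#|Y| | enum_val i \in O :&: Y]
           = (@enum_val _ (mem Y)) @^-1: O.
  by apply/setP=> i; rewrite !inE enum_valP andbT.
apply: (iffP imsetP) => -[O OT ->]; exists O => //; by rewrite e.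
Qed.

Lemma restr_is_topology : is_topology restr_opens.
Proof.
have /is_topologyP[T0 T1 TU TI] := topologyP T.
apply/is_topologyP; split.
- by apply/restr_opensP; exists set0; rewrite ?preimset0.
- by apply/restr_opensP; exists setT; rewrite ?preimsetT.
- move=> _ _ /restr_opensP[A ? ->] /restr_opensP[B ? ->].
  by apply/restr_opensP; exists (A :|: B); rewrite ?preimsetU ?TU.
- move=> _ _ /restr_opensP[A ? ->] /restr_opensP[B ? ->].
  by apply/restr_opensP; exists (A :&: B); rewrite ?preimsetI ?TI.
Qed.

Definition top_restr := Topology restr_is_topology.

End Restriction.

Definition sum_fun n n' m m' (f : 'I_n -> 'I_m) (f' : 'I_n' -> 'I_m')
    (i : 'I_(n + n')) : 'I_(m + m') :=
  match split i with inl j => lshift m' (f j) | inr j => rshift m (f' j) end.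

Section Compatibility.
Variables (n n' m m' : nat) (f : 'I_n -> 'I_m) (f' : 'I_n' -> 'I_m').

Lemma sum_fun_l j : sum_fun f f' (lshift n' j) = lshift m' (f j).
Proof. by rewrite /sum_fun (unsplitK (inl j)). Qed.

Lemma sum_fun_r j : sum_fun f f' (rshift n j) = rshift m (f' j).
Proof. by rewrite /sum_fun (unsplitK (inr j)). Qed.

Lemma sum_fun_lpre (U : {set 'I_(m + m')}) :
  @lshift n n' @^-1: (sum_fun f f' @^-1: U) = f @^-1: (@lshift m m' @^-1: U).
Proof. by apply/setP=> j; rewrite !inE sum_fun_l. Qed.

Lemma sum_fun_rpre (U : {set 'I_(m + m')}) :
  @rshift n n' @^-1: (sum_fun f f' @^-1: U) = f' @^-1: (@rshift m m' @^-1: U).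
Proof. by apply/setP=> j; rewrite !inE sum_fun_r. Qed.

End Compatibility.

Lemma sum_fun_bij n n' m m' (f : 'I_n -> 'I_m) (f' : 'I_n' -> 'I_m') :
  bijective f -> bijective f' -> bijective (sum_fun f f').
Proof.
move=> [g fK gK] [g' f'K g'K]; exists (sum_fun g g') => i;
  by case: (split_ordP i) => j ->; rewrite ?(sum_fun_l, sum_fun_r) ?fK ?f'K
     ?gK ?g'K.
Qed.

Section ClassCompatibility.
Variables (n n' m m' : nat) (T : topology 'I_n) (T' : topology 'I_n').
Variables (R : topology 'I_m) (R' : topology 'I_m').
Hypotheses (TR : homeomorphic T R) (TR' : homeomorphic T' R').

Lemma homeomorphic_sum : homeomorphic (top_sum T T') (top_sum R R').
Proof.
have [f /homeomorphism_preim[f_bij fO]] := homeomorphicP _ _ TR.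
have [f' /homeomorphism_preim[f'_bij f'O]] := homeomorphicP _ _ TR'.
apply/homeomorphicP; exists (sum_fun f f'); apply/homeomorphism_preim.
split=> [|U]; first exact: sum_fun_bij.
by rewrite !in_sum_opens sum_fun_lpre sum_fun_rpre fO f'O.
Qed.

Lemma homeomorphic_join : homeomorphic (top_join T T') (top_join R R').
Proof.
have [f /homeomorphism_preim[f_bij fO]] := homeomorphicP _ _ TR.
have [f' /homeomorphism_preim[f'_bij f'O]] := homeomorphicP _ _ TR'.
apply/homeomorphicP; exists (sum_fun f f'); apply/homeomorphism_preim.
split=> [|U]; first exact: sum_fun_bij.
have eT k k' (g : 'I_k -> 'I_k') (A : {set 'I_k'}) : bijective g ->
    ((g @^-1: A == setT) = (A == setT)) * ((g @^-1: A == set0) = (A == set0)).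
  case=> h hK gK; split; apply/eqP/eqP => [e|->];
    rewrite ?preimsetT ?preimset0 //; apply/setP=> y;
    by have /setP/(_ (h y)) := e; rewrite !inE gK.
by rewrite !in_join_opens sum_fun_lpre sum_fun_rpre fO f'O !(eT _ _ f _ f_bij, eT _ _ f' _ f'_bij).
Qed.

End ClassCompatibility.

Lemma homeomorphic_restr (S S' : finType) (T : topology S) (T' : topology S')
    (f : S -> S') (Y : {set S}) :
  homeomorphism T T' f ->
  homeomorphic (top_restr T Y) (top_restr T' (f @: Y)).
Proof.
move=> hf; have [f_bij fpre] := (homeomorphism_preim T T' f).1 hf.
have f_inj := bij_inj f_bij.
have fY (i : 'I_#|Y|) : f (enum_val i) \in f @: Y.
  by apply: imset_f; apply: enum_valP.
pose h (i : 'I_#|Y|) : 'I_#|f @: Y| := enum_rank_in (fY i) (f (enum_val i)).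
have hE i : enum_val (h i) = f (enum_val i) by rewrite enum_rankK_in.
have h_inj : injective h.
  move=> i j /(congr1 enum_val); rewrite !hE => /f_inj; exact: enum_val_inj.
have h_bij : bijective h.
  by apply: inj_card_bij => //; rewrite !card_ord card_imset.
apply/homeomorphicP; exists h; apply/homeomorphism_preim; split=> // U.
apply/restr_opensP/restr_opensP => -[O OT eU].
  exists (f @: O); first by rewrite hf.2.
  apply/setP=> j; case: h_bij => k hK kK.
  rewrite -(kK j) !inE hE mem_imset //.
  by have /setP/(_ (k j)) := eU; rewrite !inE.
exists (f @^-1: O); first by rewrite fpre.
by apply/setP=> i; rewrite eU !inE hE.
Qed.

Definition fspace_deg (X : fspace) : nat := tag (repr X).

Definition fspace_top (X : fspace) : topology 'I_(fspace_deg X) :=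
  tagged (repr X).

Lemma fspace_topK X : fclass (fspace_top X) = X.
Proof.
rewrite /fclass /fspace_top /fspace_deg -[RHS]reprK.
by case: (repr X).
Qed.

Lemma fspace_topP n (T : topology 'I_n) :
  homeomorphic (fspace_top (fclass T)) T.
Proof. by apply/fclassP; rewrite fspace_topK. Qed.

Lemma fspace_deg_fclass n (T : topology 'I_n) : fspace_deg (fclass T) = n.
Proof.
have [f [f_bij _]] := homeomorphicP _ _ (fspace_topP T).
by have := bij_eq_card f_bij; rewrite !card_ord.
Qed.

Lemma empty_is_topology : is_topology [set set0 : {set 'I_0}].
Proof.
have e (A : {set 'I_0}) : A = set0 by apply/setP=> -[].
by apply/is_topologyP; split=> [||A B _ _|A B _ _]; rewrite inE; apply/eqP/e.
Qed.

Definition fspace1 : fspace := fclass (Topology empty_is_topology).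

Lemma fspace_deg_eq0 X : fspace_deg X = 0%N <-> X = fspace1.
Proof.
split=> [|->]; last exact: fspace_deg_fclass.
move=> X0; rewrite -[LHS]fspace_topK; move: X0 (fspace_top X).
move: (fspace_deg X) => n n0 T; subst n; congr fclass; apply: val_inj => /=.
have e (A : {set 'I_0}) : A = set0 by apply/setP=> -[].
have /is_topologyP[T0 _ _ _] := topologyP T.
by apply/setP=> A; rewrite (e A) T0 inE eqxx.
Qed.

Definition finsp : vectp := Vectp fspace_deg_eq0.

(* The operations below use the canonical representatives; fspace_sumE,
   fspace_joinE and coprodE show that any representatives give the same
   result. *)
Definition fspace_sum (X Y : fspace) : fspace :=
  fclass (top_sum (fspace_top X) (fspace_top Y)).

Definition fspace_join (X Y : fspace) : fspace :=
  fclass (top_join (fspace_top X) (fspace_top Y)).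

Section FiniteSpaces.
Variable K : fieldType.

Local Notation F := {malg K[finsp]}.
Local Notation FF := {malg K[(finsp * finsp)%type]}.

Definition sum_prod : {linear FF -> F} :=
  lext (fun p => << fspace_sum p.1 p.2 >>).

Definition join_prod : {linear FF -> F} :=
  lext (fun p => << fspace_join p.1 p.2 >>).

Definition top_coprod n (T : topology 'I_n) : FF :=
  \sum_(O in opens T)
    << (fclass (top_restr T (~: O)) : finsp,
        fclass (top_restr T O) : finsp) >>.

Definition coprod : {linear F -> FF} :=
  lext (fun X => top_coprod (fspace_top X)).

End FiniteSpaces.

Lemma fspace_sumE n n' (T : topology 'I_n) (T' : topology 'I_n') :
  fspace_sum (fclass T) (fclass T') = fclass (top_sum T T').
Proof. by apply/fclassP; apply: homeomorphic_sum; apply: fspace_topP. Qed.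

Lemma fspace_joinE n n' (T : topology 'I_n) (T' : topology 'I_n') :
  fspace_join (fclass T) (fclass T') = fclass (top_join T T').
Proof. by apply/fclassP; apply: homeomorphic_join; apply: fspace_topP. Qed.

Lemma coprodE (K : fieldType) n (T : topology 'I_n) :
  coprod K << (fclass T : finsp) >> = top_coprod K T.
Proof.
rewrite /coprod /= lextU /top_coprod.
have [f hf] := homeomorphicP _ _ (fspace_topP T).
have f_inj := bij_inj hf.1.
rewrite [RHS](reindex (fun O : {set _} => f @: O)) /=; last first.
  case: hf.1 => g fK gK; exists (fun O : {set _} => g @: O) => O _;
  by rewrite -imset_comp (eq_imset (g := id)) ?imset_id.
apply: eq_big => O; first by rewrite hf.2.
move=> OT; congr (<< (_, _) >>); apply/fclassP; last exact: homeomorphic_restr.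
have -> : ~: (f @: O) = f @: (~: O).
  apply/setP=> y; case: hf.1 => g fK gK.
  by rewrite -(gK y) inE !mem_imset // inE.
exact: homeomorphic_restr.
Qed.

(* Main.v *)
(* A topology on a finite set amounts to its specialization preorder: the join of
   two spaces puts one below the other, the sum leaves them incomparable, and the
   coproduct sums over the up-sets.  A bialgebra in Vect^+ has an antipode, since
   the alternating sum of the convolution powers of Id - 1.eps is locally finite;
   this gives the first statement.  The second one holds because an up-set of
   the join of X below Y either is contained in Y or contains Y, and only Y does
   both.

   Every finite space is a join of indecomposable ones in a unique way: two upper
   parts of join decompositions of the same space are comparable for inclusion.
   Hence the join makes F the free algebra T(V) on the indecomposable spaces, and
   T(V) with concatenation and unshuffling is an unshuffle bialgebra.

   In an infinitesimal bialgebra the antipode S for the convolution satisfies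
   Delta(S x) = S x (x) 1 + 1 (x) S x - eps(x) 1 (x) 1, so that -S v is primitive
   for every generator v, and it differs from v by decomposable elements.  Joins
   of these primitive elements are deconcatenated by Delta; the resulting map from
   T(V) to F is unipotent for the length of words, hence an isomorphism of
   coalgebras (the theorem of Loday and Ronco).  Transporting along it the sum
   product to T(V) and the shuffle products to F gives the two other claims. *)

(* The letters of T(V), the indecomposable spaces, generate for the join but are not primitive: two
   incomparable points already have four up-sets. So two isomorphisms from T(V) are used: [of_word],
   which turns concatenation into the join by construction, and [primword], which turns
   deconcatenation into [coprod]. The unshuffle structure keeps the join and travels along the
   first; the shuffle structure keeps [coprod] and travels along the second. Both inversions
   involved, of the identity for convolution and of the change of generators, are geometric series
   made finite by the grading, so no integer has to be inverted and the field is arbitrary. The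
   other obstacle is that finite spaces are quotient classes. It is met by placing all spaces of an
   identity inside one ambient topology as [cl J A]: an equation between classes then yields a
   decomposition of the set [A], and coassociativity or compatibility becomes a reindexing of sums
   over sets. On the linear side identities are tested on basis vectors, the tactic [lin] proving
   linearity; on words they come from recursion rules for prefixing a letter. *)
From HB Require Import structures.
Require Import Defs.
From mathcomp Require Import all_boot all_order all_algebra.
From mathcomp Require Import generic_quotient finmap monalg.

Set Implicit Arguments.
Unset Strict Implicit.
Unset Printing Implicit Defensive.

Import GRing.Theory.
Local Open Scope ring_scope.

(** * Linear maps and tensors *)

Section Linear.
Variable K : fieldType.
Implicit Types (X Y Z : choiceType) (U V W : lmodType K).

Lemma malgU_scale X (c : K) (x : X) : << c *g x >> = c *: << x >>.
Proof. by apply/malgP => y; rewrite mcoeffZ !mcoeffU mulrnAr mulr1. Qed.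

(* A record rather than a plain definition, so that [done] does not try to
   decide linearity by conversion. *)
Record islin U V (f : U -> V) : Prop := IsLin { islinP : linear f }.

Section Bundle.
Variables (U V : lmodType K) (f : U -> V).
Hypothesis fl : islin f.

(** Library lemmas on sums and scalings need a bundled map; packing [f] with its proof makes them
    available for the lambda terms met below. *)
Let F : {linear U -> V} := HB.pack f (GRing.isLinear.Build K _ _ _ f (islinP fl)).

Lemma lin_sum I (r : seq I) (P : pred I) (G : I -> U) :
  f (\sum_(i <- r | P i) G i) = \sum_(i <- r | P i) f (G i).
Proof. exact: (linear_sum F). Qed.

Lemma lin_Z c u : f (c *: u) = c *: f u.
Proof. exact: (linearZ_LR F). Qed.

Lemma lin_D u v : f (u + v) = f u + f v.
Proof. exact: (linearD F). Qed.

Lemma lin_B u v : f (u - v) = f u - f v.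
Proof. exact: (linearB F). Qed.

End Bundle.

Lemma eq_linear X W (f g : {malg K[X]} -> W) : islin f -> islin g ->
  (forall x, f << x >> = g << x >>) -> f =1 g.
Proof.
move=> fl gl fg u; rewrite (monalgE u) !lin_sum //.
by apply: eq_bigr => x _; rewrite malgU_scale !lin_Z // fg.
Qed.

Lemma lin_id U : islin (@id U).
Proof. by split. Qed.

Lemma lin_fun U V (f : {linear U -> V}) : islin f.
Proof. by split; exact: linearP. Qed.

Lemma lin_comp U V W (g : V -> W) (f : U -> V) :
  islin g -> islin f -> islin (fun x => g (f x)).
Proof. by move=> gl fl; split=> a u v; rewrite (islinP fl) (islinP gl). Qed.

Lemma lin_add U V (f g : U -> V) :
  islin f -> islin g -> islin (fun x => f x + g x).
Proof.
by move=> fl gl; split=> a u v; rewrite (islinP fl) (islinP gl) scalerDr addrACA.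
Qed.

Lemma lin_opp U V (f : U -> V) : islin f -> islin (fun x => - f x).
Proof. by move=> fl; split=> a u v; rewrite (islinP fl) opprD scalerN. Qed.

Lemma lin_zero U V : islin (fun _ : U => 0 : V).
Proof. by split=> a u v; rewrite scaler0 addr0. Qed.

Lemma lin_scale U V (c : K) (f : U -> V) :
  islin f -> islin (fun x => c *: f x).
Proof.
by move=> fl; split=> a u v; rewrite (islinP fl) scalerDr !scalerA mulrC.
Qed.

Lemma lin_big U V I (r : seq I) (P : pred I) (f : I -> U -> V) :
  (forall i, islin (f i)) -> islin (fun x => \sum_(i <- r | P i) f i x).
Proof.
move=> fl; split=> a u v; rewrite scaler_sumr -big_split.
by apply: eq_bigr => i _; rewrite (islinP (fl i)).
Qed.

(** [islin] speaks of module-valued maps, so the scalar [counit] is made to scale a fixed vector.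
    Scalar identities below are proved the same way: multiply by [unit1], compare linear maps, then
    read the coefficient at [b1]. *)
Lemma lin_counit (B : vectp) V (v : V) U (f : U -> {malg K[B]}) :
  islin f -> islin (fun x => counit (f x) *: v).
Proof.
move=> fl; split=> a x y; rewrite /counit (islinP fl) mcoeffD mcoeffZ.
by rewrite scalerDl scalerA.
Qed.

Lemma tensEw X Y (d : {fset X}) (e : {fset Y}) (u : {malg K[X]})
    (v : {malg K[Y]}) : (msupp u `<=` d)%fset -> (msupp v `<=` e)%fset ->
  u \ox v = \sum_(x <- d) \sum_(y <- e) << u@_x * v@_y *g (x, y) >>.
Proof.
move=> ud ve; rewrite /tens.
rewrite (big_fset_incl _ ud) /=; last first.
  move=> x _ /mcoeff_outdom ux; apply: big1 => y _.
  by rewrite ux mul0r monalgU0.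
apply: eq_bigr => x _; apply: big_fset_incl => // y _ /mcoeff_outdom vy.
by rewrite vy mulr0 monalgU0.
Qed.

Lemma mcoeff_tens X Y (u : {malg K[X]}) (v : {malg K[Y]}) x y :
  (u \ox v)@_(x, y) = u@_x * v@_y.
Proof.
(* Adding [x] and [y] to the supports allows the term at [(x, y)] to be split off even when its
   coefficient vanishes. *)
rewrite (@tensEw _ _ (x |` msupp u)%fset (y |` msupp v)%fset) ?fsubsetUr //.
rewrite raddf_sum (big_fsetD1 x) ?fset1U1 //= [X in _ + X]big1_seq ?addr0.
  rewrite raddf_sum (big_fsetD1 y) ?fset1U1 //= [X in _ + X]big1_seq ?addr0.
    by rewrite mcoeffUU.
  move=> z; rewrite in_fsetD1 => /and3P[_ zy _]; rewrite mcoeffU xpair_eqE.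
  by rewrite (negbTE zy) andbF.
move=> z; rewrite in_fsetD1 => /and3P[_ zx _]; rewrite raddf_sum big1 // => t _.
by rewrite /= mcoeffU xpair_eqE (negbTE zx).
Qed.

Lemma tens_is_linear X Y (u : {malg K[X]}) : linear (@tens K X Y u).
Proof.
move=> a v w; apply/malgP => -[x y].
rewrite mcoeffD mcoeffZ !mcoeff_tens mcoeffD mcoeffZ mulrDr; congr (_ + _).
by rewrite mulrCA.
Qed.

HB.instance Definition _ X Y (u : {malg K[X]}) :=
  GRing.isLinear.Build K {malg K[Y]} {malg K[(X * Y)%type]} *:%R (tens u)
    (tens_is_linear u).

Lemma lin_tensl X Y U (f : U -> {malg K[X]}) (v : {malg K[Y]}) :
  islin f -> islin (fun u => f u \ox v).
Proof.
move=> fl; split=> a u w; apply/malgP => -[x y].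
by rewrite mcoeffD mcoeffZ !mcoeff_tens (islinP fl) mcoeffD mcoeffZ mulrDl mulrA.
Qed.

Lemma lin_tensr X Y U (f : U -> {malg K[Y]}) (u : {malg K[X]}) :
  islin f -> islin (fun v => u \ox f v).
Proof. by move=> fl; split=> a v w; rewrite (islinP fl) linearP. Qed.

Lemma tens0l X Y (v : {malg K[Y]}) : (0 : {malg K[X]}) \ox v = 0.
Proof. by apply/malgP => -[x y]; rewrite mcoeff_tens !mcoeff0 mul0r. Qed.

Lemma tensDl X Y (u u' : {malg K[X]}) (v : {malg K[Y]}) :
  (u + u') \ox v = u \ox v + u' \ox v.
Proof.
by apply/malgP => -[x y]; rewrite mcoeffD !mcoeff_tens mcoeffD mulrDl.
Qed.

Lemma tensDr X Y (u : {malg K[X]}) (v v' : {malg K[Y]}) :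
  u \ox (v + v') = u \ox v + u \ox v'.
Proof. exact: linearD. Qed.

Lemma tens0r X Y (u : {malg K[X]}) : u \ox (0 : {malg K[Y]}) = 0.
Proof. exact: linear0. Qed.

Lemma tensNl X Y (u : {malg K[X]}) (v : {malg K[Y]}) :
  (- u) \ox v = - (u \ox v).
Proof.
by apply/malgP => -[x y]; rewrite mcoeffN !mcoeff_tens mcoeffN mulNr.
Qed.

Lemma tensZl X Y (c : K) (u : {malg K[X]}) (v : {malg K[Y]}) :
  (c *: u) \ox v = c *: (u \ox v).
Proof.
by apply/malgP => -[x y]; rewrite mcoeffZ !mcoeff_tens mcoeffZ mulrA.
Qed.

Lemma tensZr X Y (c : K) (u : {malg K[X]}) (v : {malg K[Y]}) :
  u \ox (c *: v) = c *: (u \ox v).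
Proof. exact: linearZ. Qed.

(** [tmap f g] is extended from basis pairs, hence linear for arbitrary [f] and [g]; only its value
    on general pure tensors ([tmapE]) requires them to be linear. *)
HB.instance Definition _ X Y X' Y' (f : {malg K[X]} -> {malg K[X']})
    (g : {malg K[Y]} -> {malg K[Y']}) :=
  GRing.Linear.copy (tmap f g) (lext _).
HB.instance Definition _ X Y Z := GRing.Linear.copy (@tassoc K X Y Z) (lext _).
HB.instance Definition _ X Y := GRing.Linear.copy (@tswap K X Y) (lext _).
HB.instance Definition _ X X' Y Y' :=
  GRing.Linear.copy (@tmid K X X' Y Y') (lext _).
HB.instance Definition _ X Y (f : {malg K[X]} -> K) :=
  GRing.Linear.copy (@lcontr K X Y f) (lext _).
HB.instance Definition _ X Y (f : {malg K[Y]} -> K) :=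
  GRing.Linear.copy (@rcontr K X Y f) (lext _).

End Linear.

(** Syntax-directed: the head of the body selects the closure lemma, and the second-order pattern
    [?g (@?f x)] peels the outermost map off a composite. *)
Ltac lin := cbv beta; lazymatch goal with
  | |- islin (fun x => x) => exact: lin_id
  | |- islin (fun x => 0) => exact: lin_zero
  | |- islin (fun x => Algebra.add _ _) => apply lin_add; lin
  | |- islin (fun x => Algebra.opp _) => apply lin_opp; lin
  | |- islin (fun x => GRing.scale (counit _) _) =>
      first [apply lin_counit | apply lin_scale]; lin
  | |- islin (fun x => GRing.scale _ _) => apply lin_scale; lin
  | |- islin (fun x => tens _ _) => first [apply lin_tensl | apply lin_tensr]; lin
  | |- islin (fun x => ?g (@?f x)) => apply (lin_comp (g := g)); lin
  | |- islin (?g \o ?f) => apply (lin_comp (g := g)); lin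
  | |- islin ?f => first [assumption | exact: lin_fun]
  end.

Section Tensor.
Variable K : fieldType.
Implicit Types (X Y Z : choiceType) (U V W : lmodType K).

Lemma eq_tens X Y W (f g : {malg K[(X * Y)%type]} -> W) :
  islin f -> islin g -> (forall u v, f (u \ox v) = g (u \ox v)) -> f =1 g.
Proof.
by move=> fl gl fg; apply: eq_linear => // -[x y]; rewrite -tensUU fg.
Qed.

Lemma eq_bilinear X Y W (f g : {malg K[X]} -> {malg K[Y]} -> W) :
  (forall v, islin (fun u => f u v)) -> (forall u, islin (f u)) ->
  (forall v, islin (fun u => g u v)) -> (forall u, islin (g u)) ->
  (forall x y, f << x >> << y >> = g << x >> << y >>) ->
  forall u v, f u v = g u v.
Proof.
move=> fl fr gl gr fg u v.
apply: (eq_linear (fl v) (gl v)) => x.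
exact: (eq_linear (fr _) (gr _)).
Qed.

Lemma tmapUU X Y X' Y' (f : {malg K[X]} -> {malg K[X']})
    (g : {malg K[Y]} -> {malg K[Y']}) x y :
  tmap f g << (x, y) >> = f << x >> \ox g << y >>.
Proof. exact: lextU. Qed.

Lemma tmapE X Y X' Y' (f : {malg K[X]} -> {malg K[X']})
    (g : {malg K[Y]} -> {malg K[Y']}) : islin f -> islin g ->
  forall u v, tmap f g (u \ox v) = f u \ox g v.
Proof.
move=> fl gl; apply: eq_bilinear => [v|u|v|u|x y]; try by lin.
by rewrite tensUU tmapUU.
Qed.

Lemma eq_tmap X Y X' Y' (f f' : {malg K[X]} -> {malg K[X']})
    (g g' : {malg K[Y]} -> {malg K[Y']}) t :
  f =1 f' -> g =1 g' -> tmap f g t = tmap f' g' t.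
Proof.
move=> ff' gg'; move: t; apply: eq_linear; try by lin.
by move=> -[x y]; rewrite !tmapUU ff' gg'.
Qed.

Lemma tmap_comp X Y X' Y' X'' Y''
    (f : {malg K[X']} -> {malg K[X'']}) (g : {malg K[Y']} -> {malg K[Y'']})
    (f' : {malg K[X]} -> {malg K[X']}) (g' : {malg K[Y]} -> {malg K[Y']}) t :
  islin f -> islin g ->
  tmap f g (tmap f' g' t) = tmap (f \o f') (g \o g') t.
Proof.
move=> fl gl; move: t; apply: eq_linear; try by lin.
by move=> -[x y]; rewrite !tmapUU tmapE.
Qed.

Lemma tmap_id X Y (t : {malg K[(X * Y)%type]}) : tmap id id t = t.
Proof.
by move: t; apply: eq_linear; try lin; move=> -[x y]; rewrite tmapUU tensUU.
Qed.

Lemma tassocE X Y Z (u : {malg K[X]}) (v : {malg K[Y]}) (w : {malg K[Z]}) :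
  tassoc ((u \ox v) \ox w) = u \ox (v \ox w).
Proof.
move: w; apply: eq_linear => [||z]; try by lin.
move: v; apply: eq_linear => [||y]; try by lin.
move: u; apply: eq_linear => [||x]; try by lin.
by rewrite !tensUU /tassoc lextU.
Qed.

Lemma tassoc_nat X Y Z X' Y' Z' (f : {malg K[X]} -> {malg K[X']})
    (g : {malg K[Y]} -> {malg K[Y']}) (h : {malg K[Z]} -> {malg K[Z']}) t :
  tassoc (tmap (tmap f g) h t) = tmap f (tmap g h) (tassoc t).
Proof.
move: t; apply: eq_linear; try by lin.
move=> -[[x y] z]; rewrite tmapUU -!tensUU !tassocE !tensUU.
by rewrite tmapUU !tassocE !tmapUU.
Qed.

Lemma tmidE X X' Y Y' (u : {malg K[X]}) (u' : {malg K[X']}) (v : {malg K[Y]})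
    (v' : {malg K[Y']}) :
  tmid ((u \ox u') \ox (v \ox v')) = (u \ox v) \ox (u' \ox v').
Proof.
move: u; apply: eq_linear => [||x]; try by lin.
move: u'; apply: eq_linear => [||x']; try by lin.
move: v; apply: eq_linear => [||y]; try by lin.
move: v'; apply: eq_linear => [||y']; try by lin.
by rewrite !tensUU /tmid lextU.
Qed.

Lemma tmid_nat X1 X2 Y1 Y2 X1' X2' Y1' Y2'
    (f1 : {malg K[X1]} -> {malg K[X1']}) (f2 : {malg K[X2]} -> {malg K[X2']})
    (g1 : {malg K[Y1]} -> {malg K[Y1']}) (g2 : {malg K[Y2]} -> {malg K[Y2']})
    s t :
  tmid (tmap f1 f2 s \ox tmap g1 g2 t)
  = tmap (tmap f1 g1) (tmap f2 g2) (tmid (s \ox t)).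
Proof.
move: s; apply: eq_linear => [||[x x']]; try by lin.
move: t; apply: eq_linear => [||[y y']]; try by lin.
by rewrite !tmapUU -!tensUU !tmidE !tensUU !tmapUU.
Qed.

Lemma tswapE X Y (u : {malg K[X]}) (v : {malg K[Y]}) :
  tswap (u \ox v) = v \ox u.
Proof.
move: u; apply: eq_linear => [||x]; try by lin.
move: v; apply: eq_linear => [||y]; try by lin.
by rewrite !tensUU /tswap lextU.
Qed.

Lemma tswap_nat X Y X' Y' (f : {malg K[X]} -> {malg K[X']})
    (g : {malg K[Y]} -> {malg K[Y']}) t :
  tswap (tmap f g t) = tmap g f (tswap t).
Proof.
move: t; apply: eq_linear => [||[x y]]; try by lin.
by rewrite tmapUU -tensUU !tswapE tensUU tmapUU.
Qed.

Lemma lcontrE (B : vectp) Y (u : {malg K[B]}) (v : {malg K[Y]}) :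
  lcontr (@counit K B) (u \ox v) = counit u *: v.
Proof.
move: u; apply: eq_linear => [||x]; try by lin.
move: v; apply: eq_linear => [||y]; try by lin.
by rewrite tensUU /lcontr lextU.
Qed.

Lemma rcontrE (B : vectp) Y (u : {malg K[Y]}) (v : {malg K[B]}) :
  rcontr (@counit K B) (u \ox v) = counit v *: u.
Proof.
move: u; apply: eq_linear => [||x]; try by lin.
move: v; apply: eq_linear => [||y]; try by lin.
by rewrite tensUU /rcontr lextU.
Qed.

Lemma tmapD X Y X' Y' (f : {malg K[X]} -> {malg K[X']})
    (g : {malg K[Y]} -> {malg K[Y']}) s t :
  tmap f g (s + t) = tmap f g s + tmap f g t.
Proof. exact: linearD. Qed.

Lemma tmap_addl X Y X' Y' (f f' : {malg K[X]} -> {malg K[X']})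
    (g : {malg K[Y]} -> {malg K[Y']}) t :
  tmap (fun u => f u + f' u) g t = tmap f g t + tmap f' g t.
Proof.
move: t; apply: eq_linear => [||[x y]]; try by lin.
by rewrite !tmapUU tensDl.
Qed.

Lemma tmap_addr X Y X' Y' (f : {malg K[X]} -> {malg K[X']})
    (g g' : {malg K[Y]} -> {malg K[Y']}) t :
  tmap f (fun u => g u + g' u) t = tmap f g t + tmap f g' t.
Proof.
move: t; apply: eq_linear => [||[x y]]; try by lin.
by rewrite !tmapUU tensDr.
Qed.

Lemma tassocD X Y Z (s t : {malg K[(X * Y * Z)%type]}) :
  tassoc (s + t) = tassoc s + tassoc t.
Proof. exact: linearD. Qed.

Lemma tswapD X Y (s t : {malg K[(X * Y)%type]}) :
  tswap (s + t) = tswap s + tswap t.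
Proof. exact: linearD. Qed.

Lemma lcontrD (B : vectp) Y (s t : {malg K[(B * Y)%type]}) :
  lcontr (@counit K B) (s + t) = lcontr (@counit K B) s + lcontr (@counit K B) t.
Proof. exact: linearD. Qed.

Lemma lcontrB (B : vectp) Y (s t : {malg K[(B * Y)%type]}) :
  lcontr (@counit K B) (s - t) = lcontr (@counit K B) s - lcontr (@counit K B) t.
Proof. exact: linearB. Qed.

Lemma rcontrD (B : vectp) Y (s t : {malg K[(Y * B)%type]}) :
  rcontr (@counit K B) (s + t) = rcontr (@counit K B) s + rcontr (@counit K B) t.
Proof. exact: linearD. Qed.

Lemma tmap_sum X Y X' Y' (f : {malg K[X]} -> {malg K[X']})
    (g : {malg K[Y]} -> {malg K[Y']}) I (r : seq I) (P : pred I) F :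
  tmap f g (\sum_(i <- r | P i) F i) = \sum_(i <- r | P i) tmap f g (F i).
Proof. exact: linear_sum. Qed.

Lemma tassoc_sum X Y Z I (r : seq I) (P : pred I)
    (F : I -> {malg K[(X * Y * Z)%type]}) :
  tassoc (\sum_(i <- r | P i) F i) = \sum_(i <- r | P i) tassoc (F i).
Proof. exact: linear_sum. Qed.

Lemma lcontr_sum (B : vectp) Y I (r : seq I) (P : pred I)
    (F : I -> {malg K[(B * Y)%type]}) :
  lcontr (@counit K B) (\sum_(i <- r | P i) F i)
  = \sum_(i <- r | P i) lcontr (@counit K B) (F i).
Proof. exact: linear_sum. Qed.

Lemma rcontr_sum (B : vectp) Y I (r : seq I) (P : pred I)
    (F : I -> {malg K[(Y * B)%type]}) :
  rcontr (@counit K B) (\sum_(i <- r | P i) F i)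
  = \sum_(i <- r | P i) rcontr (@counit K B) (F i).
Proof. exact: linear_sum. Qed.

Lemma tens_suml X Y I (r : seq I) (P : pred I) (F : I -> {malg K[X]})
    (v : {malg K[Y]}) :
  (\sum_(i <- r | P i) F i) \ox v = \sum_(i <- r | P i) F i \ox v.
Proof. by rewrite (lin_sum (f := fun u => u \ox v)) //; lin. Qed.

Lemma tens_sumr X Y I (r : seq I) (P : pred I) (F : I -> {malg K[Y]})
    (u : {malg K[X]}) :
  u \ox (\sum_(i <- r | P i) F i) = \sum_(i <- r | P i) u \ox F i.
Proof. exact: linear_sum. Qed.

Lemma lcontr_nat (B C : vectp) Y Z (f : {malg K[B]} -> {malg K[C]})
    (g : {malg K[Y]} -> {malg K[Z]}) t :
  (forall x, counit (f x) = counit x) -> islin g ->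
  lcontr (@counit K C) (tmap f g t) = g (lcontr (@counit K B) t).
Proof.
move=> fe gl; move: t; apply: eq_linear => [||[x y]]; try by lin.
by rewrite tmapUU lcontrE fe -tensUU lcontrE (lin_Z gl).
Qed.

Lemma rcontr_nat (B C : vectp) Y Z (f : {malg K[B]} -> {malg K[C]})
    (g : {malg K[Y]} -> {malg K[Z]}) t :
  (forall x, counit (f x) = counit x) -> islin g ->
  rcontr (@counit K C) (tmap g f t) = g (rcontr (@counit K B) t).
Proof.
move=> fe gl; move: t; apply: eq_linear => [||[x y]]; try by lin.
by rewrite tmapUU rcontrE fe -tensUU rcontrE (lin_Z gl).
Qed.

End Tensor.

(** * Supports and homogeneity *)

Section Homogeneous.
Variable K : fieldType.

Definition supported (X : choiceType) (P : X -> Prop) (u : {malg K[X]}) :=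
  forall x, x \in msupp u -> P x.

Section OneSpace.
Variables (X : choiceType) (P : X -> Prop).
Implicit Types u v : {malg K[X]}.

Lemma supp0 : supported P (0 : {malg K[X]}).
Proof. by move=> x; rewrite msupp0. Qed.

Lemma suppD u v : supported P u -> supported P v -> supported P (u + v).
Proof.
move=> hu hv x /(fsubsetP (msuppD_le u v)); rewrite in_fsetU.
by case/orP => [/hu|/hv].
Qed.

Lemma suppN u : supported P u -> supported P (- u).
Proof. by move=> hu x; rewrite msuppN => /hu. Qed.

Lemma supp_sum I (r : seq I) (Q : pred I) (F : I -> {malg K[X]}) :
  (forall i, Q i -> supported P (F i)) ->
  supported P (\sum_(i <- r | Q i) F i).
Proof. by move=> h; elim/big_ind: _ => //; [exact: supp0 | exact: suppD]. Qed.

Lemma suppU x : P x -> supported P (<< x >> : {malg K[X]}).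
Proof.
move=> Px y; rewrite -mcoeff_neq0 mcoeffU.
by case: (x =P y) => [<-//|_]; rewrite eqxx.
Qed.

Lemma eq_linear_supp (W : lmodType K) (f g : {malg K[X]} -> W) u :
  islin f -> islin g -> supported P u ->
  (forall x, P x -> f << x >> = g << x >>) -> f u = g u.
Proof.
move=> fl gl hu fg; rewrite (monalgE u) !lin_sum // big_seq [RHS]big_seq.
by apply: eq_bigr => x /hu Px; rewrite malgU_scale !lin_Z // fg.
Qed.

Lemma supp_lin (Y : choiceType) (Q : Y -> Prop)
    (f : {malg K[X]} -> {malg K[Y]}) u :
  islin f -> (forall x, P x -> supported Q (f << x >>)) ->
  supported P u -> supported Q (f u).
Proof.
move=> fl fPQ hu; rewrite (monalgE u) lin_sum // big_seq => y.
elim/big_ind: _ y => [y|v w hv hw y|x /hu Px y]; first by rewrite msupp0.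
  by move/(fsubsetP (msuppD_le v w)); rewrite in_fsetU => /orP[/hv|/hw].
rewrite malgU_scale (lin_Z fl) => /(fsubsetP (msuppZ_le _ _)); exact: fPQ.
Qed.

End OneSpace.

Lemma supp_tens (X Y : choiceType) (P : X -> Prop) (Q : Y -> Prop)
    (u : {malg K[X]}) (v : {malg K[Y]}) :
  supported P u -> supported Q v ->
  supported (fun p : X * Y => P p.1 /\ Q p.2) (u \ox v).
Proof.
move=> hu hv [x y]; rewrite -mcoeff_neq0 mcoeff_tens mulf_eq0 negb_or.
by rewrite !mcoeff_neq0 => /andP[/hu + /hv].
Qed.

Definition hom_in (X : choiceType) (d : X -> nat) n :=
  supported (fun x => d x = n).

Lemma hom_inU (X : choiceType) (d : X -> nat) x :
  hom_in d (d x) (<< x >> : {malg K[X]}).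
Proof. exact: suppU. Qed.

Lemma hom_in_lin (X Y : choiceType) (dX : X -> nat) (dY : Y -> nat)
    (f : {malg K[X]} -> {malg K[Y]}) n u :
  islin f -> homogeneous dX dY f -> hom_in dX n u -> hom_in dY n (f u).
Proof. by move=> fl fh; apply: supp_lin => // x <-; apply: fh. Qed.

Lemma hom_in_tens (X Y : choiceType) (dX : X -> nat) (dY : Y -> nat) n p
    (u : {malg K[X]}) (v : {malg K[Y]}) :
  hom_in dX n u -> hom_in dY p v -> hom_in (tdeg dX dY) (n + p) (u \ox v).
Proof.
by move=> hu hv z /(supp_tens hu hv)[]; rewrite /tdeg => -> ->.
Qed.

Lemma hom_tmap (X Y X' Y' : choiceType) (dX : X -> nat) (dY : Y -> nat)
    (dX' : X' -> nat) (dY' : Y' -> nat)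
    (f : {malg K[X]} -> {malg K[X']}) (g : {malg K[Y]} -> {malg K[Y']}) :
  homogeneous dX dX' f -> homogeneous dY dY' g ->
  homogeneous (tdeg dX dY) (tdeg dX' dY') (tmap f g).
Proof.
move=> fh gh [x y]; rewrite -/(hom_in _ _ _) tmapUU.
by apply: hom_in_tens; [apply: fh | apply: gh].
Qed.

Lemma hom_comp (X Y Z : choiceType) (dX : X -> nat) (dY : Y -> nat)
    (dZ : Z -> nat) (g : {malg K[Y]} -> {malg K[Z]})
    (f : {malg K[X]} -> {malg K[Y]}) :
  islin g -> homogeneous dY dZ g -> homogeneous dX dY f ->
  homogeneous dX dZ (g \o f).
Proof. by move=> gl gh fh x; apply: (hom_in_lin gl gh); apply: fh. Qed.

Lemma hom_id (X : choiceType) (d : X -> nat) :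
  homogeneous d d (@id {malg K[X]}).
Proof. exact: hom_inU. Qed.

Variable B : vectp.

Lemma deg_b1 : deg (b1 : B) = 0%N.
Proof. exact/deg_eq0. Qed.

Lemma counitU (x : B) : counit (<< x >> : {malg K[B]}) = (x == b1)%:R.
Proof. by rewrite /counit mcoeffU. Qed.

Lemma counit1 : counit (unit1 K B) = 1.
Proof. by rewrite counitU eqxx. Qed.

Lemma hom_in_counit n (u : {malg K[B]}) :
  hom_in (@deg B) n u -> (0 < n)%N -> counit u = 0.
Proof.
move=> hu n0; apply: mcoeff_outdom; apply/negP => /hu; rewrite deg_b1 => e.
by rewrite -e in n0.
Qed.

Lemma hom_in_gt0 n (u : {malg K[B]}) :
  hom_in (@deg B) n u -> (0 < n)%N -> supported (fun x => x <> b1) u.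
Proof. by move=> hu n0 x /hu xn xb; move: n0; rewrite -xn xb deg_b1. Qed.

Lemma in_Ker_supp (u : {malg K[B]}) :
  in_Ker u -> supported (fun x => x <> b1) u.
Proof.
by rewrite /in_Ker /counit => u0 x xu xb; move: xu; rewrite xb -mcoeff_neq0 u0 eqxx.
Qed.

Lemma in_KerU (x : B) : x <> b1 -> in_Ker (<< x >> : {malg K[B]}).
Proof. by move=> xb; rewrite /in_Ker counitU; case: eqP. Qed.

Lemma deg_gt0 (x : B) : x <> b1 -> (0 < deg x)%N.
Proof. by move=> xb; rewrite lt0n; apply/eqP => /deg_eq0. Qed.

Lemma eq_linear_ker (W : lmodType K) (f g : {malg K[B]} -> W) u :
  islin f -> islin g -> in_Ker u ->
  (forall x, x <> b1 -> f << x >> = g << x >>) -> f u = g u.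
Proof. by move=> fl gl /in_Ker_supp; apply: eq_linear_supp. Qed.

End Homogeneous.

(** By connectedness the counit only sees degree 0, a line spanned by the unit. Preserving degree
    and unit is therefore enough. *)
Lemma homogeneous_counit (K : fieldType) (B C : vectp)
    (f : {malg K[B]} -> {malg K[C]}) :
  islin f -> homogeneous (@deg B) (@deg C) f -> f (unit1 K B) = unit1 K C ->
  forall x, counit (f x) = counit x.
Proof.
move=> fl fh f1 x.
have e : counit (f x) *: unit1 K C = counit x *: unit1 K C.
  move: x; apply: eq_linear => [||x]; try by lin.
  case: (x =P b1) => [->|xb]; first by rewrite -/(unit1 K B) f1 !counit1.
  rewrite counitU; move/eqP: (xb) => /negbTE ->.
  by rewrite (@hom_in_counit _ _ (deg x)) ?deg_gt0 //; apply: fh.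
have /(congr1 (@counit K C)) := e; rewrite /counit !mcoeffZ /unit1.
by rewrite mcoeffU eqxx !mulr1.
Qed.

(** Same principle: a product of basis vectors has degree 0 only if both factors are [b1]. The
    counit axiom of a bialgebra thus follows from the grading. *)
Lemma algebra_counit_mul (K : fieldType) (B : vectp)
    (m : {linear {malg K[(B * B)%type]} -> {malg K[B]}}) :
  is_algebra m -> forall x y, counit (m (x \ox y)) = counit x * counit y.
Proof.
move=> mA x y.
have e : counit (m (x \ox y)) *: unit1 K B
         = counit x *: (counit y *: unit1 K B).
  move: x y; apply: eq_bilinear => [y|x|y|x|x y]; try by lin.
  case: (x =P b1) => [->|xb]; first by rewrite mul_unit_l // counit1 scale1r.
  rewrite [in RHS]counitU; move/eqP: (xb) => /negbTE ->; rewrite scale0r.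
  rewrite (@hom_in_counit _ _ (deg x + deg y)) ?scale0r ?addn_gt0 ?(deg_gt0 xb) //.
  apply: hom_in_lin (mul_homogeneous mA) _; first by lin.
  by apply: hom_in_tens; apply: hom_inU.
have /(congr1 (@counit K B)) := e; rewrite /counit !mcoeffZ /unit1.
by rewrite mcoeffU eqxx !mulr1.
Qed.

(** The inverse is the Neumann series of powers of [id - f]; the hypothesis kills the powers beyond
    the degree, so [(d x).+1] terms suffice on [x]. *)
Lemma unipotent_inv (K : fieldType) (X : choiceType) (d : X -> nat)
    (f : {linear {malg K[X]} -> {malg K[X]}}) :
  homogeneous d d f ->
  (forall x k, (d x < k)%N -> iter k (fun u => u - f u) << x >> = 0) ->
  exists g : {linear {malg K[X]} -> {malg K[X]}},
    [/\ homogeneous d d g, cancel f g & cancel g f].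
Proof.
move=> fh; set N := fun u => u - f u => Nnil.
have Nl k : islin (iter k N).
  elim: k => [|k IHk] /=; first exact: lin_id.
  by apply: (lin_comp (g := N)) IHk; rewrite /N; lin.
have Nh k : homogeneous d d (iter k N).
  elim: k => [|k IHk] /=; first exact: hom_id.
  apply: (hom_comp (g := N)) IHk; first by rewrite /N; lin.
  by move=> x; apply: suppD; [apply: hom_inU | apply: suppN; apply: fh].
pose g : {linear {malg K[X]} -> {malg K[X]}} :=
  lext (fun x => \sum_(k < (d x).+1) iter k N << x >>).
(* The truncation depends on the degree alone, so [g] is one finite sum on each homogeneous
   component and can be evaluated at [f << x >>]. *)
have gE n u : hom_in d n u -> g u = \sum_(k < n.+1) iter k N u.
  move=> hu; apply: (eq_linear_supp (g := fun u => \sum_(k < n.+1) iter k N u) _ _ hu).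
  - by lin.
  - exact: lin_big.
  - by move=> x <-; rewrite [LHS]lextU.
(* Since [f] is [id - N], both composites of [f] and [g] telescope to the identity minus a vanishing
   power of [N]. *)
have tele n u : \sum_(k < n) (iter k N u - iter k.+1 N u) = u - iter n N u.
  elim: n => [|n IHn]; first by rewrite big_ord0 subrr.
  by rewrite big_ord_recr IHn /= addrA subrK.
exists g; split.
- move=> x; rewrite -/(supported _ _) [g _]lextU; apply: supp_sum => k _.
  exact: Nh.
- apply: eq_linear => [||x]; try by lin.
  rewrite (gE (d x)); last by apply: fh.
  transitivity (<< x >> - iter (d x).+1 N << x >>); last by rewrite Nnil ?subr0.
  by rewrite -tele; apply: eq_bigr => k _;
    rewrite iterSr -(lin_B (Nl k)) /N opprB addrCA subrr addr0.
- apply: eq_linear => [||x]; try by lin.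
  rewrite (gE (d x)); last exact: hom_inU.
  transitivity (<< x >> - iter (d x).+1 N << x >>); last by rewrite Nnil ?subr0.
  rewrite linear_sum -tele.
  by apply: eq_bigr => k _; rewrite /= {3}/N opprB addrCA subrr addr0.
Qed.

(** * Convolution and antipodes *)

Section Convolution.
Variables (K : fieldType) (B : vectp).
Local Notation A := {malg K[B]}.
Local Notation AA := {malg K[(B * B)%type]}.
Variables (m : {linear AA -> A}) (D : {linear A -> AA}).
Hypotheses (mA : is_algebra m) (DA : is_coalgebra D).

(** The second map takes values in a left module rather than in the algebra: besides the usual
    convolution ([act] equal to [m]), A (x) A with A acting on its left factor is needed for
    [D \o S]. *)
Definition conv (Z : choiceType) (act : {malg K[(B * Z)%type]} -> {malg K[Z]})
    (f : A -> A) (g : A -> {malg K[Z]}) (x : A) : {malg K[Z]} :=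
  act (tmap f g (D x)).

Definition cunit (x : A) : A := counit x *: unit1 K B.

Lemma lin_cunit : islin cunit.
Proof. by rewrite /cunit; lin. Qed.

Section Module.
Variables (Z : choiceType)
  (act : {linear {malg K[(B * Z)%type]} -> {malg K[Z]}}).
Hypotheses
  (actA : forall x y z, act (m (x \ox y) \ox z) = act (x \ox act (y \ox z)))
  (act1 : forall z, act (unit1 K B \ox z) = z).

Lemma lin_conv f g : islin (conv act f g).
Proof. by rewrite /conv; lin. Qed.

Lemma eq_conv f f' g g' : f =1 f' -> g =1 g' -> conv act f g =1 conv act f' g'.
Proof. by move=> ff gg x; rewrite /conv (eq_tmap (D x) ff gg). Qed.

Lemma conv_unitl g : islin g -> conv act cunit g =1 g.
Proof.
move=> gl x; rewrite /conv -[x in RHS](comul_counit_l DA).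
move: (D x); apply: eq_linear => [||[y z]]; try by lin.
by rewrite tmapUU /cunit tensZl linearZ /= act1 -tensUU lcontrE (lin_Z gl).
Qed.

Lemma conv_assoc f g h : islin f -> islin g -> islin h ->
  conv act (conv m f g) h =1 conv act f (conv act g h).
Proof.
move=> fl gl hl x; rewrite /conv.
have act_assoc t : act (tmap m id t) = act (tmap id act (tassoc t)).
  move: t; apply: eq_linear => [||[[y1 y2] z]]; try by lin.
  by rewrite tmapUU -!tensUU actA tassocE tmapE //; lin.
transitivity (act (tmap m id (tmap (tmap f g) h (tmap D id (D x))))).
  by rewrite !tmap_comp //; lin.
by rewrite act_assoc tassoc_nat (comul_coassoc DA) !tmap_comp //; lin.
Qed.

Lemma conv_q g : islin g -> forall x,
  conv act (fun y => cunit y - y) g x = g x - conv act id g x.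
Proof.
move=> gl x; rewrite -[in RHS](conv_unitl gl) /conv -linearB; apply: (congr1 act).
move: (D _); apply: eq_linear => [||[y z]]; try by lin.
by rewrite !tmapUU tensDl tensNl.
Qed.

End Module.

Lemma conv_unitr f : islin f -> conv m f cunit =1 f.
Proof.
move=> fl x; rewrite /conv -[x in RHS](comul_counit_r DA).
move: (D x); apply: eq_linear => [||[y z]]; try by lin.
rewrite tmapUU /cunit linearZ /= linearZ /= (mul_unit_r mA) -tensUU rcontrE.
by rewrite (lin_Z fl).
Qed.

Lemma conv_qr f : islin f -> forall x,
  conv m f (fun y => cunit y - y) x = f x - conv m f id x.
Proof.
move=> fl x; rewrite -[in RHS](conv_unitr fl) /conv -linearB; apply: (congr1 m).
move: (D _); apply: eq_linear => [||[y z]]; try by lin.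
by rewrite !tmapUU linearB.
Qed.

(* Powers of e - id for the convolution, where e is its unit: by Takeuchi's
   formula their sum is inverse to id.  It is locally finite because e - id
   vanishes in degree 0. *)
Let q x := cunit x - x.

Fixpoint qpow n : A -> A := if n is n'.+1 then conv m q (qpow n') else cunit.

Let lin_q : islin q.
Proof. by rewrite /q; apply: lin_add; [exact: lin_cunit | lin]. Qed.

Lemma lin_qpow n : islin (qpow n).
Proof. by case: n => [|n]; [exact: lin_cunit | exact: lin_conv]. Qed.

(** The powers are built by convolving on the left; the left inverse property needs the last factor
    on the right. *)
Lemma qpowSr n : qpow n.+1 =1 conv m (qpow n) q.
Proof.
elim: n => [|n IHn] x.
  by rewrite [LHS](conv_unitr lin_q) (conv_unitl (mul_unit_l mA)).
rewrite -[LHS]/(conv m q (qpow n.+1) x) (eq_conv _ (frefl q) IHn).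
rewrite -(conv_assoc (mul_assoc mA)) //; exact: lin_qpow.
Qed.

(** In each term of [D << x >>] the first factor is either [b1], which [q] kills, or of positive
    degree, which leaves less than [deg x] for the remaining power. *)
Lemma qpow_eq0 n x : (deg x < n)%N -> qpow n << x >> = 0.
Proof.
elim: n x => // n IHn x xn; rewrite -[LHS]/(m _) -[RHS](linear0 m); apply: (congr1 m).
apply: (eq_linear_supp (P := fun p => tdeg (@deg B) (@deg B) p = deg x)
  (f := tmap q (qpow n)) (g := fun=> 0)); try by lin.
  exact: (comul_homogeneous DA).
move=> [y z]; rewrite tmapUU /tdeg /= => yz.
case: (y =P b1) => [->|/eqP yb].
  by rewrite /q /cunit counit1 scale1r subrr tens0l.
rewrite IHn ?tens0r //; rewrite -yz ltnS in xn; apply: leq_trans xn.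
rewrite -add1n leq_add2r lt0n; apply: contra yb => /eqP/deg_eq0 ->.
exact: eqxx.
Qed.

Definition cinv : {linear A -> A} :=
  lext (fun x => \sum_(k < (deg x).+1) qpow k << x >>).

Lemma cinvE n x : (deg x < n)%N -> cinv << x >> = \sum_(k < n) qpow k << x >>.
Proof.
move=> xn; rewrite [LHS]lextU (big_ord_widen n (fun k => qpow k << x >>)) //.
rewrite [RHS](bigID (fun k : 'I_n => (k < (deg x).+1)%N)) /= [X in _ + X]big1.
  by rewrite addr0.
by move=> k; rewrite -leqNgt => /qpow_eq0.
Qed.

Lemma lin_cinv : islin cinv. Proof. exact: lin_fun. Qed.

Lemma tmap_sumr (f : A -> A) n (t : AA) :
  \sum_(k < n) tmap f (qpow k) t = tmap f (fun y => \sum_(k < n) qpow k y) t.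
Proof.
move: t; apply: eq_linear; try by lin.
  by apply: lin_big => k; lin.
by move=> [y z]; rewrite tmapUU linear_sum; apply: eq_bigr => k _; rewrite tmapUU.
Qed.

Lemma tmap_suml (f : A -> A) n (t : AA) :
  \sum_(k < n) tmap (qpow k) f t = tmap (fun y => \sum_(k < n) qpow k y) f t.
Proof.
move: t; apply: eq_linear; try by lin.
  by apply: lin_big => k; lin.
move=> [y z]; rewrite tmapUU (lin_sum (f := fun v => v \ox _)); last by lin.
by apply: eq_bigr => k _; rewrite tmapUU.
Qed.

Lemma cinv_r : conv m id cinv =1 cunit.
Proof.
apply: eq_linear => [||x]; [exact: lin_conv | exact: lin_cunit |].
have e : conv m q cinv << x >> = cinv << x >> - cunit << x >>.
  (* One term more than necessary: once [k = 0] is removed, [(deg x).+1] powers remain, enough to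
     give [cinv] on every right factor of [D << x >>]. *)
  rewrite (@cinvE (deg x).+2) // big_ord_recl /= addrAC subrr add0r.
  rewrite /conv -linear_sum tmap_sumr; apply: (congr1 m).
  apply: (eq_linear_supp (P := fun p => tdeg (@deg B) (@deg B) p = deg x)); try by lin.
    exact: (comul_homogeneous DA).
  move=> [y z]; rewrite /tdeg /= => yz; rewrite !tmapUU.
  by rewrite (@cinvE (deg x).+1) // ltnS -yz leq_addl.
(* [conv_q] also computes the left side as [cinv] minus the convolution of [id] with [cinv];
   comparing the two leaves the claim. *)
move: e; rewrite conv_q; [|exact: mul_unit_l|exact: lin_cinv].
by move/addrI/oppr_inj.
Qed.

Lemma cinv_l : conv m cinv id =1 cunit.
Proof.
apply: eq_linear => [||x]; [exact: lin_conv | exact: lin_cunit |].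
have e : conv m cinv q << x >> = cinv << x >> - cunit << x >>.
  rewrite (@cinvE (deg x).+2) // big_ord_recl -/(cunit _) addrAC subrr add0r.
  under eq_bigr => k _ do rewrite lift0 qpowSr.
  rewrite /conv -linear_sum tmap_suml; apply: (congr1 m).
  apply: (eq_linear_supp (P := fun p => tdeg (@deg B) (@deg B) p = deg x)); try by lin.
    exact: (comul_homogeneous DA).
  move=> [y z]; rewrite /tdeg /= => yz; rewrite !tmapUU.
  by rewrite (@cinvE (deg x).+1) // ltnS -yz leq_addr.
move: e; rewrite conv_qr; last exact: lin_cinv.
by move/addrI/oppr_inj.
Qed.

Lemma hom_conv f g : homogeneous (@deg B) (@deg B) f ->
  homogeneous (@deg B) (@deg B) g -> homogeneous (@deg B) (@deg B) (conv m f g).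
Proof.
move=> fh gh x; apply: hom_in_lin (mul_homogeneous mA) _; first by lin.
by apply: hom_in_lin (hom_tmap fh gh) _; [lin | apply: comul_homogeneous].
Qed.

Lemma hom_cunit : homogeneous (@deg B) (@deg B) cunit.
Proof.
move=> x; rewrite -/(hom_in _ _ _) /cunit counitU.
case: eqP => [->|_]; last by rewrite scale0r; apply: supp0.
by rewrite scale1r; apply: hom_inU.
Qed.

Lemma hom_qpow n : homogeneous (@deg B) (@deg B) (qpow n).
Proof.
elim: n => [|n IHn] /=; first exact: hom_cunit.
apply: hom_conv => // x; rewrite -/(hom_in _ _ _).
by apply: suppD; [apply: hom_cunit | apply: suppN; apply: hom_inU].
Qed.

Lemma hom_cinv : homogeneous (@deg B) (@deg B) cinv.
Proof.
move=> x; rewrite -/(hom_in _ _ _) [cinv _]lextU; apply: supp_sum => k _.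
exact: hom_qpow.
Qed.

Lemma cinv1 : cinv (unit1 K B) = unit1 K B.
Proof.
by rewrite (@cinvE 1) ?deg_b1 // big_ord1 /= /cunit counit1 scale1r.
Qed.

End Convolution.

(** * The antipode of an infinitesimal bialgebra *)

Section PrimitiveElements.
Variables (K : fieldType) (B : vectp).
Local Notation A := {malg K[B]}.
Local Notation AA := {malg K[(B * B)%type]}.
Variables (m : {linear AA -> A}) (D : {linear A -> AA}).
Hypothesis mD : is_infinitesimal m D.
Let mA := inf_algebra mD.
Let DA := inf_coalgebra mD.
Local Notation S := (cinv m D).
Local Notation one := (unit1 K B).

(** Multiplication on the first factor makes A (x) A the left module in which [D \o S] is convolved;
    only its values on pure tensors are used afterwards. *)
Let left_action : exists act : {linear {malg K[(B * (B * B))%type]} -> AA},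
  forall x y z, act (x \ox (y \ox z)) = m (x \ox y) \ox z.
Proof.
exists (lext (fun p => m << (p.1, p.2.1) >> \ox << p.2.2 >>)) => x y z.
move: x; apply: eq_linear => [||x]; try by lin.
move: y; apply: eq_linear => [||y]; try by lin.
move: z; apply: eq_linear => [||z]; try by lin.
by rewrite !tensUU [LHS]lextU.
Qed.

(* Apply D to x1 S(x2) = eps(x) 1, then cancel the left factor by convolving
   with S. *)
Lemma comul_cinv x :
  D (S x) = S x \ox one + one \ox S x - counit x *: (one \ox one).
Proof.
have [act actE] := left_action.
have actA y z (t : AA) : act (m (y \ox z) \ox t) = act (y \ox act (z \ox t)).
  move: t; apply: eq_tens => [||u v]; try by lin.
  by rewrite !actE (mul_assoc mA).
have act1 (t : AA) : act (one \ox t) = t.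
  move: t; apply: eq_tens => [||u v]; try by lin.
  by rewrite !actE (mul_unit_l mA).
(* The infinitesimal relation for an arbitrary tensor, its first term written through the action so
   that a convolution appears. *)
have comul_mul (t : AA) :
    D (m t) = act (tmap id D t) + tmap id m (tassoc (tmap D id t)) - t.
  move: t; apply: eq_tens => [||y z]; try by lin.
  rewrite (inf_comul_mul mD) !tmapE; try by lin.
  have -> : tmap (fun z1 => m (y \ox z1)) id (D z) = act (y \ox D z).
    by move: (D z); apply: eq_tens => [||u v]; try lin; rewrite tmapE ?actE //; lin.
  have -> // : tmap id (fun y2 => m (y2 \ox z)) (D y)
               = tmap id m (tassoc (D y \ox z)).
  move: (D y); apply: eq_tens => [||u v]; try by lin.
  by rewrite tassocE !tmapE //; lin.
pose G x := D (S x).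
pose G' x := S x \ox one + one \ox S x - counit x *: (one \ox one).
have Gl : islin G by rewrite /G; lin.
have G'l : islin G' by rewrite /G'; lin.
have convG : conv D act id G =1 conv D act id G'.
  move=> y.
  (* [D] applied to y1 S(y2) = eps(y) 1. The middle term y1 (x) y2 S(y3) collapses to y (x) 1 by
     coassociativity and the inverse property. *)
  have e1 : counit y *: (one \ox one)
            = conv D act id G y + y \ox one - tmap id S (D y).
    rewrite -(comul_unit DA) -linearZ -/(cunit y) -(cinv_r mA DA) /conv.
    rewrite comul_mul tmap_comp; try by lin.
    rewrite -/(conv D act id G y); apply: (congr1 (fun t => _ + t - _)).
    rewrite tmap_comp; try by lin.
    transitivity (tmap id m (tassoc (tmap (tmap id id) S (tmap D id (D y))))).
      rewrite tmap_comp; try by lin.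
      apply: (congr1 (fun t => tmap id m (tassoc t))).
      by apply: eq_tmap => // z; rewrite /= tmap_id.
    rewrite tassoc_nat.
    rewrite (comul_coassoc DA).
    rewrite (tmap_comp id D (D y)); try by lin.
    rewrite (tmap_comp _ _ (D y)); try by lin.
    rewrite (eq_tmap (f' := id) (g' := @cunit K B)) //; last exact: cinv_r.
    rewrite -[y in RHS](comul_counit_r DA).
    move: (D y); apply: eq_linear => [||[u v]]; try by lin.
    by rewrite tmapUU -tensUU rcontrE tensZl -tensZr.
  (* The proposed value [G'] solves the same equation: its first summand y1 S(y2) (x) 1 collapses to
     eps(y) 1 (x) 1. *)
  have e2 : conv D act id G' y
            = counit y *: (one \ox one) + tmap id S (D y) - y \ox one.
    rewrite -tensZl -/(cunit y) -(cinv_r mA DA) -[y in _ - y \ox _](comul_counit_r DA).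
    rewrite /conv; move: (D y); apply: eq_tens => [||u v]; try by lin.
    rewrite !tmapE; try by lin.
    rewrite rcontrE.
    have -> : u \ox G' v = u \ox (S v \ox one) + u \ox (one \ox S v)
                           - counit v *: (u \ox (one \ox one)).
      by rewrite -[counit v *: _]linearZ -linearD -linearB.
    move: (S v) => w; rewrite (lin_B (lin_fun act)) (lin_D (lin_fun act)).
    rewrite (lin_Z (lin_fun act)).
    by rewrite {1}actE {1}actE {1}actE (mul_unit_r mA) tensZl.
  by rewrite e2 e1 subrK addrK.
rewrite -/(G x) -/(G' x).
(* Convolving on the left with [S] undoes convolution with [id], so the equation has at most one
   solution. *)
have cancel H : islin H -> H x = conv D act S (conv D act id H) x.
  move=> Hl; rewrite -(conv_assoc DA actA) //; try by lin.
  by rewrite (eq_conv D act (cinv_l mA DA) (frefl H)) (conv_unitl DA act1).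
by rewrite (cancel _ Gl) (eq_conv D act (frefl S) convG) -(cancel _ G'l).
Qed.

End PrimitiveElements.

Lemma bialgebra_hopf (K : fieldType) (B : vectp)
    (m : {linear {malg K[(B * B)%type]} -> {malg K[B]}})
    (D : {linear {malg K[B]} -> {malg K[(B * B)%type]}}) :
  is_bialgebra m D -> is_hopf m D.
Proof.
move=> mD; split=> //.
have [mA DA _ _] := mD; exists (cinv m D); split; first exact: hom_cinv.
  exact: cinv_l.
exact: cinv_r.
Qed.

Section Mul2.
Variables (K : fieldType) (B : vectp).
Variable (m : {linear {malg K[(B * B)%type]} -> {malg K[B]}}).

Lemma lin_mul2l t : islin (fun s => mul2 m s t).
Proof. by rewrite /mul2; lin. Qed.

Lemma lin_mul2r s : islin (mul2 m s).
Proof. by rewrite /mul2; lin. Qed.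

Lemma mul2Dl s s' t : mul2 m (s + s') t = mul2 m s t + mul2 m s' t.
Proof. by rewrite (lin_D (lin_mul2l t)). Qed.

Lemma mul2Dr s t t' : mul2 m s (t + t') = mul2 m s t + mul2 m s t'.
Proof. by rewrite (lin_D (lin_mul2r s)). Qed.

Lemma mul2E u u' v v' :
  mul2 m (u \ox u') (v \ox v') = m (u \ox v) \ox m (u' \ox v').
Proof. by rewrite /mul2 tmidE tmapE //; lin. Qed.

Hypothesis mA : is_algebra m.

Lemma mul2_1l t : mul2 m (unit1 K B \ox unit1 K B) t = t.
Proof.
move: t; apply: eq_tens => [||u v]; try by [exact: lin_mul2r | lin].
by rewrite mul2E !(mul_unit_l mA).
Qed.

Lemma mul2_1r t : mul2 m t (unit1 K B \ox unit1 K B) = t.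
Proof.
move: t; apply: eq_tens => [||u v]; try by [exact: lin_mul2l | lin].
by rewrite mul2E !(mul_unit_r mA).
Qed.

End Mul2.

(** * Words *)

Section Words.
Variables (V : vect) (K : fieldType).
Local Notation T := (tensorp V).
Local Notation A := {malg K[T]}.
Local Notation AA := {malg K[(T * T)%type]}.
Local Notation one := (unit1 K T).
Implicit Types (a b c : V) (u v w : seq V) (x y z : A).

Definition word w : A := << (w : T) >>.

Definition lcons a : {linear A -> A} := lext (fun w => word (a :: w)).

Lemma lconsE a w : lcons a (word w) = word (a :: w).
Proof. exact: lextU. Qed.

Lemma word_deg_cons a w : word_deg (a :: w) = (vect_deg a + word_deg w)%N.
Proof. by rewrite /word_deg big_cons. Qed.

Lemma word_deg_cat u v : word_deg (u ++ v) = (word_deg u + word_deg v)%N.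
Proof. by rewrite /word_deg big_cat. Qed.

Lemma size_word_deg w : (size w <= word_deg w)%N.
Proof.
elim: w => [|a w IHw] //; rewrite word_deg_cons /= -add1n leq_add //.
exact: vect_deg_gt0.
Qed.

Lemma counit_lcons a x : counit (lcons a x) = 0.
Proof.
suff e : counit (lcons a x) *: one = 0.
  have /(congr1 (@counit K T)) := e.
  by rewrite /counit mcoeffZ mcoeff0 /unit1 mcoeffU eqxx mulr1.
move: x; apply: eq_linear => [||w]; try by lin.
by rewrite -/(word w) lconsE counitU scale0r.
Qed.

Lemma hom_lcons a n x : hom_in (@word_deg V) n x ->
  hom_in (@word_deg V) (vect_deg a + n) (lcons a x).
Proof.
apply: supp_lin; first by lin.
by move=> w <-; rewrite -/(word w) lconsE -word_deg_cons; apply: hom_inU.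
Qed.

Lemma deconc_nil : deconc V K one = one \ox one.
Proof.
by rewrite [LHS]lextU /deconc_word big_ord1 tensUU.
Qed.

(** The cut before the first letter stands apart; every other cut leaves that letter in the left
    factor. *)
Lemma deconc_lcons a x :
  deconc V K (lcons a x) = one \ox lcons a x + tmap (lcons a) id (deconc V K x).
Proof.
move: x; apply: eq_linear => [||w]; try by lin.
rewrite -/(word w) lconsE [LHS]lextU /deconc_word big_ord_recl /=.
rewrite tensUU; congr (_ + _).
rewrite [X in tmap _ _ X]lextU /deconc_word linear_sum.
by apply: eq_bigr => i _; rewrite /= tmapUU -/(word _) lconsE tensUU.
Qed.

Lemma hom_deconc : homogeneous (@deg T) (tdeg (@deg T) (@deg T)) (deconc V K).
Proof.
move=> w; rewrite -/(supported _ _) [deconc _ _ _]lextU /deconc_word.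
apply: supp_sum => i _; apply: suppU.
by rewrite /tdeg /= -word_deg_cat cat_take_drop.
Qed.

(** Induction on the first letter for linear maps: an operation on T(V) enters later proofs only
    through its value at 1 and its rule under [lcons]. *)
Lemma word_ind (W : lmodType K) (f g : A -> W) : islin f -> islin g ->
  f one = g one ->
  (forall a x, f x = g x -> f (lcons a x) = g (lcons a x)) ->
  f =1 g.
Proof.
move=> fl gl f1 fS; apply: eq_linear => // w.
by elim: w => [//|a w IHw]; rewrite -/(word _) -lconsE; apply: fS.
Qed.

Lemma deconc_is_coalgebra : is_coalgebra (deconc V K).
Proof.
(* Once [deconc] and [lcons] are replaced by variables, the recursion rules are all that is known of
   them and nothing gets unfolded. *)
move: hom_deconc deconc_nil deconc_lcons counit_lcons word_ind.
move: (deconc V K) lcons => D L Dh Dn DL L0 ind.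
split=> //.
- apply: ind => [|||a x IHx]; try by lin.
    by rewrite Dn !tmapE ?Dn ?tassocE //; lin.
  rewrite DL !tmapD tassocD !tmapE; try by lin.
  rewrite Dn tassocE (tmap_comp (L a) id (D x)); try by lin.
  rewrite DL tensDr -addrA; apply: (congr1 (+%R _)).
  have -> : tmap (D \o L a) id (D x)
    = tmap (fun y => one \ox L a y) id (D x)
      + tmap (tmap (L a) id) id (tmap D id (D x)).
    rewrite tmap_comp; try by lin.
    move: (D x); apply: eq_tens => [||y z]; try by lin.
    by rewrite !tmapE /= ?DL ?tensDl //; lin.
  rewrite tassocD; apply: f_equal2.
    move: (D x); apply: eq_tens => [||y z]; try by lin.
    by rewrite !tmapE /= ?tassocE //; lin.
  transitivity (tmap (L a) (tmap id id) (tassoc (tmap D id (D x)))).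
    exact: tassoc_nat.
  rewrite IHx (tmap_comp id D (D x)) ?(tmap_comp (L a) id (D x)); try by lin.
  by apply: eq_tmap => // y; rewrite /= tmap_id.
- apply: ind => [|||a x IHx]; try by lin.
    by rewrite Dn lcontrE counit1 scale1r.
  rewrite DL lcontrD lcontrE counit1 scale1r.
  rewrite -[RHS]addr0; apply: (congr1 (+%R _)).
  move: (D x); apply: eq_tens => [||y z]; try by lin.
  by rewrite tmapE ?lcontrE ?L0 ?scale0r //; lin.
- apply: ind => [|||a x IHx]; try by lin.
    by rewrite Dn rcontrE counit1 scale1r.
  rewrite DL rcontrD rcontrE L0 scale0r add0r.
  rewrite -[in RHS]IHx; move: (D x); apply: eq_tens => [||y z]; try by lin.
  by rewrite tmapE ?rcontrE ?linearZ //; lin.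
Qed.

Definition concat : {linear AA -> A} := lext (fun p => word (p.1 ++ p.2)).

Lemma concatE u v : concat (word u \ox word v) = word (u ++ v).
Proof. by rewrite tensUU [LHS]lextU. Qed.

Lemma concat1l x : concat (one \ox x) = x.
Proof. by move: x; apply: eq_linear => [||w]; try lin; rewrite [LHS]concatE. Qed.

Lemma concat_lcons a x y : concat (lcons a x \ox y) = lcons a (concat (x \ox y)).
Proof.
move: x y; apply: eq_bilinear => [y|x|y|x|u v]; try by lin.
by rewrite -/(word u) -/(word v); rewrite -> lconsE, !concatE, lconsE.
Qed.

Lemma concat_is_algebra : is_algebra concat.
Proof.
split.
- move=> [u v]; rewrite -/(supported _ _) [concat _]lextU; apply: suppU.
  by rewrite /tdeg /= word_deg_cat.
- move=> x y z; move: x; apply: eq_linear => [||u]; try by lin.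
  move: y z; apply: eq_bilinear => [z|y|z|y|v w]; try by lin.
  by rewrite -/(word u) -/(word v) -/(word w); rewrite -> !concatE; rewrite catA.
- exact: concat1l.
- move=> x; move: x; apply: eq_linear => [||w]; try by lin.
  by rewrite [LHS]concatE cats0.
Qed.

End Words.

(** * Shuffle recursions in abstract abelian groups *)

Section ShuffleRecursion.
Variables (V : Type) (W : zmodType) (s : W -> W -> W) (L : V -> W -> W) (e : W).
Hypotheses (sDl : forall x y z, s (x + y) z = s x z + s y z)
  (sDr : forall x y z, s x (y + z) = s x y + s x z)
  (LD : forall a x y, L a (x + y) = L a x + L a y)
  (s1l : forall x, s e x = x) (s1r : forall x, s x e = x)
  (sL : forall a b x y, s (L a x) (L b y) = L a (s x (L b y)) + L b (s (L a x) y)).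

Lemma recursive_shuffleC u v :
  s (foldr L e u) (foldr L e v) = s (foldr L e v) (foldr L e u).
Proof.
elim: u v => [|a u IHu] v /=; first by rewrite s1l s1r.
elim: v => [|b v IHv] /=; first by rewrite s1l s1r.
by rewrite !sL IHv (IHu (b :: v)) addrC.
Qed.

(** Both bracketings split according to which of the three words supplies the first letter; an
    induction on each word settles its share. *)
Lemma recursive_shuffleA u v w :
  s (s (foldr L e u) (foldr L e v)) (foldr L e w)
  = s (foldr L e u) (s (foldr L e v) (foldr L e w)).
Proof.
elim: u v w => [|a u IHu] v w /=; first by rewrite !s1l.
elim: v w => [|b v IHv] w /=; first by rewrite s1l s1r.
elim: w => [|c w IHw] /=; first by rewrite !s1r.
(* Three instances, one for each of the leading letters [a], [b] and [c] removed from its word. *)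
move: (IHu (b :: v) (c :: w)) (IHv (c :: w)) IHw => /=.
move: (foldr L e u) (foldr L e v) (foldr L e w) => x y z.
rewrite !sL !sDl !sDr !sL => -> -> hw.
by rewrite addrACA -(LD c) hw [RHS]addrACA -LD addrA.
Qed.

Variables (Z : zmodType) (D : W -> Z) (j : W -> Z) (E : V -> Z -> Z)
  (mu : Z -> Z -> Z).
Hypotheses (DD : forall x y, D (x + y) = D x + D y)
  (jD : forall x y, j (x + y) = j x + j y)
  (ED : forall a x y, E a (x + y) = E a x + E a y)
  (muDl : forall x y z, mu (x + y) z = mu x z + mu y z)
  (muDr : forall x y z, mu x (y + z) = mu x y + mu x z)
  (DL : forall a x, D (L a x) = j (L a x) + E a (D x))
  (mu1l : forall t, mu (D e) t = t) (mu1r : forall t, mu t (D e) = t)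
  (mujj : forall x y, mu (j x) (j y) = j (s x y))
  (muEj : forall a t y, mu (E a t) (j y) = E a (mu t (j y)))
  (mujE : forall a t x, mu (j x) (E a t) = E a (mu (j x) t))
  (muEE : forall a b t r,
     mu (E a t) (E b r) = E a (mu t (E b r)) + E b (mu (E a t) r)).

(** In the application [j x] is 1 (x) x, [E a] prefixes [a] to the left factor and [mu] is [mul2].
    The four rules for [mu] match the four products of the two summands in [DL]. *)
Lemma recursive_shuffle_comul u v :
  D (s (foldr L e u) (foldr L e v)) = mu (D (foldr L e u)) (D (foldr L e v)).
Proof.
elim: u v => [|a u IHu] v /=; first by rewrite s1l mu1l.
elim: v => [|b v IHv] /=; first by rewrite s1r mu1r.
move: (IHu (b :: v)) IHv => /=; move: (foldr L e u) (foldr L e v) => x y hu hv.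
rewrite sL DD (DL a (s _ _)) (DL b (s _ _)) hu hv !DL.
rewrite !(muDl, muDr) muEE muEj mujE mujj sL jD !ED addrACA.
rewrite -[RHS]addrA; congr (_ + _).
by rewrite addrACA [RHS]addrA; congr (_ + _); apply: addrC.
Qed.

End ShuffleRecursion.

(** * The shuffle bialgebra of words *)

Section Shuffle.
Variables (V : vect) (K : fieldType).
Local Notation T := (tensorp V).
Local Notation A := {malg K[T]}.
Local Notation AA := {malg K[(T * T)%type]}.
Local Notation one := (unit1 K T).
Local Notation word := (@word V K).
Local Notation lcons := (@lcons V K).
Implicit Types (a b c : V) (u v w : seq V) (x y z : A).

(** The recursion shortens one word or the other, so the inner [fix] handles the second word while
    [u] stays in place. *)
Fixpoint shuffle_word u : seq V -> A :=
  if u is a :: u' then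
    fix shv v : A :=
      if v is b :: v' then lcons a (shuffle_word u' v) + lcons b (shv v')
      else word u
  else word.

Definition shuffle : {linear AA -> A} := lext (fun p => shuffle_word p.1 p.2).

(** The half-shuffle whose first letter comes from the left word; the default 0 on an empty left
    word supplies the rule for 1 on the left. *)
Definition shprec : {linear AA -> A} :=
  lext (fun p => if (p.1 : seq V) is a :: u then lcons a (shuffle_word u p.2)
                 else 0).

Definition shsucc : {linear AA -> A} := lext (fun p => shprec << (p.2, p.1) >>).

Let shuffleE u v : shuffle (word u \ox word v) = shuffle_word u v.
Proof. by rewrite tensUU [LHS]lextU. Qed.

Lemma word_nil : word [::] = one. Proof. by []. Qed.

Lemma shuffle1l x : shuffle (one \ox x) = x.
Proof. by move: x; apply: eq_linear => [||w]; try lin; rewrite [LHS]shuffleE. Qed.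

Lemma shuffle1r x : shuffle (x \ox one) = x.
Proof.
move: x; apply: eq_linear => [||w]; try lin; rewrite [LHS]shuffleE.
by case: w.
Qed.

Lemma shuffle_lcons a b x y :
  shuffle (lcons a x \ox lcons b y)
  = lcons a (shuffle (x \ox lcons b y)) + lcons b (shuffle (lcons a x \ox y)).
Proof.
move: x y; apply: eq_bilinear => [y|x|y|x|u v]; try by lin.
by rewrite -/(word u) -/(word v); rewrite -> !lconsE, !shuffleE.
Qed.

Lemma shprec1 x : shprec (one \ox x) = 0.
Proof.
by move: x; apply: eq_linear => [||w]; try lin; rewrite tensUU [LHS]lextU.
Qed.

Lemma shprec_lcons a x y :
  shprec (lcons a x \ox y) = lcons a (shuffle (x \ox y)).
Proof.
move: x y; apply: eq_bilinear => [y|x|y|x|u v]; try by lin.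
by rewrite -/(word u) -/(word v) lconsE shuffleE tensUU [LHS]lextU.
Qed.

Lemma shsuccE x y : shsucc (x \ox y) = shprec (y \ox x).
Proof.
move: x y; apply: eq_bilinear => [y|x|y|x|u v]; try by lin.
by rewrite tensUU [LHS]lextU tensUU.
Qed.

Let wordE w : word w = foldr lcons one w.
Proof. by elim: w => //= a w <-; rewrite lconsE. Qed.

Lemma shuffleC x y : shuffle (x \ox y) = shuffle (y \ox x).
Proof.
move: x y; apply: eq_bilinear => [y|x|y|x|u v]; try by lin.
rewrite -/(word u) -/(word v) !wordE.
apply: (recursive_shuffleC (s := fun x y => shuffle (x \ox y))).
- exact: shuffle1l.
- exact: shuffle1r.
- exact: shuffle_lcons.
Qed.

Lemma shuffleA x y z :
  shuffle (shuffle (x \ox y) \ox z) = shuffle (x \ox shuffle (y \ox z)).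
Proof.
move: x; apply: eq_linear => [||u]; try by lin.
move: y z; apply: eq_bilinear => [y|x|y|x|v w]; try by lin.
rewrite -/(word u) -/(word v) -/(word w) !wordE.
apply: (recursive_shuffleA (s := fun x y => shuffle (x \ox y))).
- by move=> x y z; rewrite tensDl linearD.
- by move=> x y z; rewrite tensDr linearD.
- by move=> a x y; rewrite linearD.
- exact: shuffle1l.
- exact: shuffle1r.
- exact: shuffle_lcons.
Qed.

Lemma hom_shuffle_word u v :
  hom_in (@word_deg V) (word_deg u + word_deg v) (shuffle_word u v).
Proof.
elim: u v => [|a u IHu] v; first by rewrite /word_deg big_nil; apply: hom_inU.
elim: v => [|b v IHv].
  by rewrite [word_deg [::]]big_nil addn0; apply: hom_inU.
apply: suppD; first by rewrite word_deg_cons -addnA; apply: hom_lcons (IHu _).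
by rewrite [word_deg (b :: v)]word_deg_cons addnCA; apply: hom_lcons.
Qed.

Lemma shuffle_is_algebra : is_algebra shuffle.
Proof.
split; [|exact: shuffleA|exact: shuffle1l|exact: shuffle1r].
by move=> [u v]; rewrite -/(supported _ _) [shuffle _]lextU; apply: hom_shuffle_word.
Qed.

Lemma hom_shprec : homogeneous (tdeg (@deg T) (@deg T)) (@deg T) shprec.
Proof.
move=> [[|a u] v]; rewrite -/(supported _ _) [shprec _]lextU /=; first exact: supp0.
rewrite /tdeg /= word_deg_cons -addnA; apply: hom_lcons.
exact: hom_shuffle_word.
Qed.

Lemma hom_shsucc : homogeneous (tdeg (@deg T) (@deg T)) (@deg T) shsucc.
Proof.
move=> [u v]; rewrite -/(supported _ _) [shsucc _]lextU /=.
by rewrite /tdeg addnC; apply: hom_shprec.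
Qed.

Lemma shuffle_comul x y :
  deconc V K (shuffle (x \ox y))
  = mul2 shuffle (deconc V K x) (deconc V K y).
Proof.
move: x y; apply: eq_bilinear => [y|x|y|x|u v];
  try by [lin | rewrite /mul2; lin].
rewrite -/(word u) -/(word v) !wordE.
apply: (@recursive_shuffle_comul _ _ (fun x y => shuffle (x \ox y)) _ _
  shuffle1l shuffle1r shuffle_lcons _ _ (fun x => one \ox x)
  (fun a => tmap (lcons a) id) (mul2 shuffle)).
- by move=> x y; rewrite linearD.
- by move=> x y; rewrite tensDr.
- by move=> a s t; rewrite tmapD.
- exact: mul2Dl.
- exact: mul2Dr.
- exact: deconc_lcons.
- move=> t; rewrite -> deconc_nil; exact: (mul2_1l shuffle_is_algebra t).
- move=> t; rewrite -> deconc_nil; exact: (mul2_1r shuffle_is_algebra t).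
- by move=> x y; rewrite -> mul2E, shuffle1l.
- move=> a t y; move: t; apply: eq_tens => [||x z]; try by [rewrite /mul2; lin].
  rewrite tmapE; try by lin.
  by rewrite -> !mul2E, !shuffle1r; rewrite tmapE //; lin.
- move=> a t x; move: t; apply: eq_tens => [||y z]; try by [rewrite /mul2; lin].
  rewrite tmapE; try by lin.
  by rewrite -> !mul2E, !shuffle1l; rewrite tmapE //; lin.
- move=> a b t r; move: t; apply: eq_tens => [||x x']; try by [rewrite /mul2; lin].
  move: r; apply: eq_tens => [||y y']; try by [rewrite /mul2; lin].
  rewrite !tmapE; try by lin.
  rewrite -> !mul2E, shuffle_lcons, tensDl.
  by rewrite !tmapE //; lin.
Qed.

Lemma shuffle_is_bialgebra : is_bialgebra shuffle (deconc V K).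
Proof.
split; [exact: shuffle_is_algebra | exact: deconc_is_coalgebra | |].
  exact: shuffle_comul.
exact: algebra_counit_mul shuffle_is_algebra.
Qed.

End Shuffle.

Section ShuffleBialgebra.
Variables (V : vect) (K : fieldType).
Local Notation T := (tensorp V).
Local Notation A := {malg K[T]}.
Local Notation AA := {malg K[(T * T)%type]}.
Local Notation one := (unit1 K T).
Local Notation word := (@word V K).
Local Notation lcons := (@lcons V K).
Implicit Types (a b c : V) (u v w : seq V) (x y z : A).

Local Notation shuffle := (shuffle V K).
Local Notation shprec := (shprec V K).
Local Notation shsucc := (shsucc V K).

Lemma word_cons w : (w : T) <> b1 -> exists a u, word w = lcons a (word u).
Proof. by case: w => [//|a u] _; exists a, u; rewrite lconsE. Qed.

Lemma shprec1r x : in_Ker x -> shprec (x \ox one) = x.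
Proof.
move=> x0; apply: (eq_linear_ker (f := fun x => shprec (x \ox one)) _ _ x0);
  try by lin.
by move=> w /word_cons[a [u]]; rewrite -/(word w) => ->; rewrite shprec_lcons shuffle1r.
Qed.

Lemma shuffle_prec_succ x y : in_Ker x -> in_Ker y ->
  shuffle (x \ox y) = shprec (x \ox y) + shsucc (x \ox y).
Proof.
move=> x0 y0; rewrite -> shsuccE.
apply: (eq_linear_ker (f := fun x => shuffle (x \ox y))
  (g := fun x => shprec (x \ox y) + shprec (y \ox x)) _ _ x0); try by lin.
move=> u /word_cons[a [u']]; rewrite -/(word u) => ->; move: (word u') => {x x0}x.
apply: (eq_linear_ker (f := fun y => shuffle (_ \ox y))
  (g := fun y => shprec (_ \ox y) + shprec (y \ox _)) _ _ y0); try by lin.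
move=> v /word_cons[b [v']]; rewrite -/(word v) => ->; move: (word v') => {y y0}y.
rewrite -> (shprec_lcons a x), (shprec_lcons b y), shuffle_lcons.
by rewrite -> (shuffleC y).
Qed.

Lemma shprec_assoc x y z : in_Ker x -> in_Ker y -> in_Ker z ->
  shprec (shprec (x \ox y) \ox z)
  = shprec (x \ox (shprec (y \ox z) + shsucc (y \ox z))).
Proof.
move=> x0 y0 z0; rewrite <- (shuffle_prec_succ y0 z0).
apply: (eq_linear_ker (f := fun x => shprec (shprec (x \ox y) \ox z))
  (g := fun x => shprec (x \ox _)) _ _ x0); try by lin.
move=> u /word_cons[a [u']]; rewrite -/(word u) => ->; move: (word u') => {x x0}x.
by rewrite -> !shprec_lcons, shuffleA.
Qed.

Let P (s t : AA) : AA := tmap shprec shuffle (tmid (s \ox t)).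

Let PE x x' y y' :
  P (x \ox x') (y \ox y') = shprec (x \ox y) \ox shuffle (x' \ox y').
Proof. by rewrite /P tmidE tmapE //; lin. Qed.

(** The compact form of the compatibility: [P] applies [shprec] to left factors and [shuffle] to
    right ones. It follows from multiplicativity of the shuffle after removal of the leading letter
    of [x]. *)
Lemma shprec_comul x y :
  deconc V K (shprec (x \ox y))
  = one \ox shprec (x \ox y) + P (deconc V K x) (deconc V K y).
Proof.
rewrite /P; move: x; apply: eq_linear => [||w]; try by lin.
rewrite -/(word w); case: w => [|a w].
  rewrite word_nil shprec1 tens0r deconc_nil linear0 add0r; symmetry.
  move: (deconc V K y) => t; rewrite -/(P _ _); move: t.
  apply: (eq_tens (g := fun=> 0)) => [||u v]; try by rewrite /P; lin.
  by rewrite PE shprec1 tens0l.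
rewrite -lconsE; move: (word w) => x.
rewrite -> shprec_lcons, !deconc_lcons; apply: (congr1 (+%R _)).
rewrite shuffle_comul.
have Pl t r r' : P (r + r') t = P r t + P r' t.
  by rewrite /P tensDl !linearD.
rewrite -/(P _ _) Pl.
move: (deconc V K x) (deconc V K y) => s t.
have -> : P (one \ox lcons a x) t = 0.
  move: t; apply: (eq_tens (g := fun=> 0)) => [||u v]; try by rewrite /P; lin.
  by rewrite PE shprec1 tens0l.
rewrite add0r.
move: s; apply: eq_tens => [||x1 x2]; try by rewrite /P /mul2; lin.
move: t; apply: eq_tens => [||y1 y2]; try by rewrite /P /mul2; lin.
rewrite tmapE; try by lin.
symmetry; apply: etrans (PE _ _ _ _) _.
apply: etrans (esym (congr1 (tmap (lcons a) id) (mul2E _ _ _ _ _))).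
rewrite -> shprec_lcons.
by rewrite tmapE //; lin.
Qed.

(** Both coproducts in [shprec_comul] are expanded as z (x) 1 + 1 (x) z + z' (x) z''. Terms with 1
    on the left of [shprec] vanish; the others are those of the axiom. *)
Lemma shprec_redcomul x y : in_Ker x -> in_Ker y ->
  deconc V K (shprec (x \ox y))
  = shprec (x \ox y) \ox one + one \ox shprec (x \ox y) + x \ox y
    + tmap (fun y' => shprec (x \ox y')) id (redcomul (deconc V K) y)
    + tmap (fun x' => shprec (x' \ox y)) id (redcomul (deconc V K) x)
    + tmap id (fun x'' => shuffle (x'' \ox y)) (redcomul (deconc V K) x)
    + tmap shprec shuffle
        (tmid (redcomul (deconc V K) x \ox redcomul (deconc V K) y)).
Proof.
move=> x0 y0; rewrite -> shprec_comul.
have Pl t r r' : P (r + r') t = P r t + P r' t.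
  by rewrite /P tensDl !linearD.
have Pr t r r' : P t (r + r') = P t r + P t r'.
  by rewrite /P tensDr !linearD.
have P1 z t : P (one \ox z) t = 0.
  move: t; apply: (eq_tens (g := fun=> 0)) => [||u v]; try by rewrite /P; lin.
  by rewrite PE shprec1 tens0l.
have Pxr t : P (x \ox one) t = tmap (fun y' => shprec (x \ox y')) id t.
  move: t; apply: eq_tens => [||u v]; try by rewrite /P; lin.
  by rewrite PE shuffle1l tmapE //; lin.
have Prx t : P t (y \ox one) = tmap (fun x' => shprec (x' \ox y)) id t.
  move: t; apply: eq_tens => [||u v]; try by rewrite /P; lin.
  by rewrite PE shuffle1r tmapE //; lin.
(* The correction arises because [shprec] kills [one \ox one], so multiplying by 1 on the right
   removes the counit part. On the reduced coproduct of [x] it vanishes by [r0]. *)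
have Pr1 t : P t (one \ox y) = tmap id (fun x'' => shuffle (x'' \ox y)) t
    - one \ox shuffle (lcontr (@counit K T) t \ox y).
  have prec1 z : shprec (z \ox one) = z - counit z *: one.
    move: z; apply: eq_linear => [||w]; try by lin.
    case: ((w : T) =P b1) => [->|wb].
      by rewrite shprec1 counit1 scale1r subrr.
    rewrite shprec1r ?counitU; last exact: in_KerU.
    by case: eqP => //; rewrite scale0r subr0.
  move: t; apply: eq_tens => [||u v]; try by rewrite /P; lin.
  rewrite PE prec1 lcontrE tmapE; try by lin.
  by rewrite tensDl tensNl !tensZl !linearZ.
have r0 : lcontr (@counit K T) (redcomul (deconc V K) x) = 0.
  rewrite /redcomul !lcontrB (comul_counit_l (deconc_is_coalgebra V K)).
  by rewrite !lcontrE counit1 x0 scale0r subr0 scale1r subrr.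
have Dsplit z : deconc V K z = z \ox one + one \ox z + redcomul (deconc V K) z.
  by rewrite /redcomul -(addrA (deconc V K z)) -opprD [RHS]addrC subrK.
have z0 : one \ox shuffle ((0 : A) \ox y) = 0.
  by rewrite tens0l linear0 tens0r.
have l1 : islin (fun y' => shprec (x \ox y')) by lin.
have t1 : tmap (fun y' => shprec (x \ox y')) id (y \ox one)
          = shprec (x \ox y) \ox one by apply: (tmapE l1); lin.
have t2 : tmap (fun y' => shprec (x \ox y')) id (one \ox y) = x \ox y.
  by apply: etrans (tmapE l1 _ _ _) _; [lin | rewrite (shprec1r x0)].
have Prx1 := Pr1 (redcomul (deconc V K) x).
move: Prx1; rewrite -> r0, z0; rewrite subr0 => {r0 z0 Pr1} Pr1.
rewrite -> (Dsplit x), (Dsplit y).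
move: Pl Pr P1 Pxr Prx Pr1; rewrite -/(P _ _).
move: (redcomul _ x) (redcomul _ y) (P) => s t Q Ql Qr Q1 Qxr Qrx Qr1.
rewrite -> Ql, (Ql _ (x \ox one)), Q1; rewrite addr0.
rewrite -> !Qr, !Qxr, Qrx, Qr1.
rewrite -> t1, t2.
have reorder (W : zmodType) (b c d e f g h : W) :
    b + (c + d + e + (f + g + h)) = c + b + d + e + f + g + h.
  by rewrite !addrA [b + c]addrC.
exact: reorder.
Qed.

Lemma shuffle_is_shuffle_bialgebra :
  is_shuffle_bialgebra shuffle shprec shsucc (deconc V K).
Proof.
split.
- split.
apply: bialgebra_hopf.
exact: (shuffle_is_bialgebra V K).
  exact: shuffleC.
- exact: hom_shprec.
- exact: hom_shsucc.
- exact: shuffle_prec_succ.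
- by move=> x y _ _; rewrite shsuccE.
- exact: shprec_assoc.
- exact: shprec1r.
- by move=> x _; apply: shprec1.
- exact: shprec_redcomul.
Qed.

End ShuffleBialgebra.

(** * Operators that a coproduct distributes over its two factors *)

Section LetterOperators.
Variables (K : fieldType) (B : vectp).
Local Notation A := {malg K[B]}.
Local Notation AA := {malg K[(B * B)%type]}.
Variables (m : {linear AA -> A}) (D : {linear A -> AA}) (L : {linear A -> A}).
Hypotheses (DL : forall x, D (L x) = tmap L id (D x) + tmap id L (D x))
  (L0 : forall x, counit (L x) = 0)
  (mL : forall x y, m (L x \ox y) = L (m (x \ox y))).
Implicit Types t : AA.

Lemma tmap_idid (X Y Z : choiceType) (f : {malg K[X]} -> {malg K[Y]})
    (t : {malg K[(X * (Z * Z))%type]}) : tmap f (tmap id id) t = tmap f id t.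
Proof. by apply: eq_tmap => // r; rewrite tmap_id. Qed.

Lemma comul_letter_ll t :
  tmap D id (tmap L id t)
  = tmap (tmap L id) id (tmap D id t) + tmap (tmap id L) id (tmap D id t).
Proof.
apply: etrans (tmap_comp L id t (lin_fun D) (@lin_id K _)) _.
apply: etrans (eq_tmap t DL (frefl _)) _.
apply: etrans (tmap_addl _ _ _ _) _.
by apply: f_equal2; symmetry; apply: tmap_comp; lin.
Qed.

Lemma comul_letter_lr t :
  tmap D id (tmap id L t) = tmap id L (tmap D id t).
Proof.
apply: etrans (tmap_comp id L t (lin_fun D) (@lin_id K _)) _.
by symmetry; apply: tmap_comp; lin.
Qed.

Lemma comul_letter_rl t :
  tmap id D (tmap L id t) = tmap L id (tmap id D t).
Proof.
apply: etrans (tmap_comp L id t (@lin_id K _) (lin_fun D)) _.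
by symmetry; apply: tmap_comp; lin.
Qed.

Lemma comul_letter_rr t :
  tmap id D (tmap id L t)
  = tmap id (tmap L id) (tmap id D t) + tmap id (tmap id L) (tmap id D t).
Proof.
apply: etrans (tmap_comp id L t (@lin_id K _) (lin_fun D)) _.
apply: etrans (eq_tmap t (frefl _) DL) _.
apply: etrans (tmap_addr _ _ _ _) _.
by apply: f_equal2; symmetry; apply: tmap_comp; lin.
Qed.

(** Either iterated coproduct of [L x] is the sum over the three factors that may receive [L], so
    coassociativity passes from [x] to [L x]. *)
Lemma coassoc_letter x : tassoc (tmap D id (D x)) = tmap id D (D x) ->
  tassoc (tmap D id (D (L x))) = tmap id D (D (L x)).
Proof.
move=> IH; rewrite -> DL, !tmapD.
rewrite -> comul_letter_ll, comul_letter_lr, comul_letter_rl, comul_letter_rr.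
rewrite -> !tassocD, !tassoc_nat, IH, tmap_idid.
have -> : tassoc (tmap id L (tmap D id (D x)))
          = tmap id (tmap id L) (tmap id D (D x)).
  rewrite <- IH, <- tassoc_nat; apply: (congr1 (@tassoc _ _ _ _)).
  by apply: eq_tmap => // r; rewrite tmap_id.
exact: esym (addrA _ _ _).
Qed.

Lemma lcontr_letter t : lcontr (@counit K B) (tmap L id t) = 0.
Proof.
move: t; apply: (eq_tens (g := fun=> 0)) => [||u v]; try by lin.
by rewrite tmapE ?lcontrE ?L0 ?scale0r //; lin.
Qed.

Lemma rcontr_letter t : rcontr (@counit K B) (tmap id L t) = 0.
Proof.
move: t; apply: (eq_tens (g := fun=> 0)) => [||u v]; try by lin.
by rewrite tmapE ?rcontrE ?L0 ?scale0r //; lin.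
Qed.

Lemma lcontr_letter_r t :
  lcontr (@counit K B) (tmap id L t) = L (lcontr (@counit K B) t).
Proof.
move: t; apply: eq_tens => [||u v]; try by lin.
by rewrite tmapE ?lcontrE ?linearZ //; lin.
Qed.

Lemma rcontr_letter_l t :
  rcontr (@counit K B) (tmap L id t) = L (rcontr (@counit K B) t).
Proof.
move: t; apply: eq_tens => [||u v]; try by lin.
by rewrite tmapE ?rcontrE ?linearZ //; lin.
Qed.

Lemma mul2_letter_l s t : mul2 m (tmap L id s) t = tmap L id (mul2 m s t).
Proof.
move: s; apply: eq_tens => [||u u']; try by rewrite /mul2; lin.
move: t; apply: eq_tens => [||v v']; try by rewrite /mul2; lin.
rewrite tmapE; try by lin.
rewrite -> !mul2E, mL.
by rewrite tmapE //; lin.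
Qed.

Lemma mul2_letter_r s t : mul2 m (tmap id L s) t = tmap id L (mul2 m s t).
Proof.
move: s; apply: eq_tens => [||u u']; try by rewrite /mul2; lin.
move: t; apply: eq_tens => [||v v']; try by rewrite /mul2; lin.
rewrite tmapE; try by lin.
rewrite -> !mul2E, mL.
by rewrite tmapE //; lin.
Qed.

End LetterOperators.

(** * The unshuffle bialgebra of words *)

Section Unshuffle.
Variables (V : vect) (K : fieldType).
Local Notation T := (tensorp V).
Local Notation A := {malg K[T]}.
Local Notation AA := {malg K[(T * T)%type]}.
Local Notation one := (unit1 K T).
Local Notation word := (@word V K).
Local Notation lcons := (@lcons V K).
Local Notation concat := (concat V K).
Implicit Types (a b c : V) (u v w : seq V) (x y z : A).

Fixpoint unshuffle_word w : AA :=
  if w is a :: w' then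
    tmap (lcons a) id (unshuffle_word w') + tmap id (lcons a) (unshuffle_word w')
  else one \ox one.

Definition unshuffle : {linear A -> AA} := lext unshuffle_word.

(** The unshufflings whose left subword receives the first letter; [unsucc] takes the others. The
    empty word gets 0 as a default. *)
Definition unprec : {linear A -> AA} :=
  lext (fun w => if (w : seq V) is a :: w' then
                   tmap (lcons a) id (unshuffle_word w') else 0).

Definition unsucc : {linear A -> AA} :=
  lext (fun w => if (w : seq V) is a :: w' then
                   tmap id (lcons a) (unshuffle_word w') else 0).

Lemma unshuffle1 : unshuffle one = one \ox one. Proof. exact: lextU. Qed.

Lemma unshuffle_lcons a x : unshuffle (lcons a x)
  = tmap (lcons a) id (unshuffle x) + tmap id (lcons a) (unshuffle x).
Proof.
move: x; apply: eq_linear => [||w]; try by lin.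
by rewrite -/(word w) lconsE [LHS]lextU [unshuffle _]lextU.
Qed.

Lemma unprec_lcons a x : unprec (lcons a x) = tmap (lcons a) id (unshuffle x).
Proof.
move: x; apply: eq_linear => [||w]; try by lin.
by rewrite -/(word w) lconsE [LHS]lextU [unshuffle _]lextU.
Qed.

Lemma unsucc_lcons a x : unsucc (lcons a x) = tmap id (lcons a) (unshuffle x).
Proof.
move: x; apply: eq_linear => [||w]; try by lin.
by rewrite -/(word w) lconsE [LHS]lextU [unshuffle _]lextU.
Qed.

Lemma hom_lcons_l a n (t : AA) :
  hom_in (tdeg (@deg T) (@deg T)) n t ->
  hom_in (tdeg (@deg T) (@deg T)) (vect_deg a + n) (tmap (lcons a) id t).
Proof.
apply: supp_lin; first by lin.
move=> [u v] <-; rewrite tmapUU /tdeg addnA; apply: hom_in_tens; last exact: hom_inU.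
by rewrite -/(word u) lconsE -word_deg_cons; apply: hom_inU.
Qed.

Lemma hom_lcons_r a n (t : AA) :
  hom_in (tdeg (@deg T) (@deg T)) n t ->
  hom_in (tdeg (@deg T) (@deg T)) (vect_deg a + n) (tmap id (lcons a) t).
Proof.
apply: supp_lin; first by lin.
move=> [u v] <-; rewrite tmapUU /tdeg addnCA; apply: hom_in_tens; first exact: hom_inU.
by rewrite -/(word v) lconsE -word_deg_cons; apply: hom_inU.
Qed.

Lemma hom_unshuffle_word w :
  hom_in (tdeg (@deg T) (@deg T)) (word_deg w) (unshuffle_word w).
Proof.
elim: w => [|a w IHw].
  by rewrite /= tensUU; apply: suppU; rewrite /tdeg /= /word_deg big_nil.
by rewrite word_deg_cons; apply: suppD; [apply: hom_lcons_l | apply: hom_lcons_r].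
Qed.

Lemma hom_unshuffle : homogeneous (@deg T) (tdeg (@deg T) (@deg T)) unshuffle.
Proof.
by move=> w; rewrite -/(supported _ _) [unshuffle _]lextU; apply: hom_unshuffle_word.
Qed.

Lemma hom_unprec : homogeneous (@deg T) (tdeg (@deg T) (@deg T)) unprec.
Proof.
move=> w; rewrite -/(supported _ _) [unprec _]lextU.
case: w => [|a w]; first exact: supp0.
by rewrite /= word_deg_cons; apply: hom_lcons_l; apply: hom_unshuffle_word.
Qed.

Lemma hom_unsucc : homogeneous (@deg T) (tdeg (@deg T) (@deg T)) unsucc.
Proof.
move=> w; rewrite -/(supported _ _) [unsucc _]lextU.
case: w => [|a w]; first exact: supp0.
by rewrite /= word_deg_cons; apply: hom_lcons_r; apply: hom_unshuffle_word.
Qed.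

Lemma unshuffle_is_coalgebra : is_coalgebra unshuffle.
Proof.
split; first exact: hom_unshuffle.
- exact: unshuffle1.
- apply: word_ind => [|||a x IHx]; try by lin.
    by rewrite unshuffle1 !tmapE ?unshuffle1 ?tassocE //; lin.
  exact: (coassoc_letter (unshuffle_lcons a) IHx).
- apply: word_ind => [|||a x IHx]; try by lin.
    by rewrite unshuffle1 lcontrE counit1 scale1r.
  rewrite -> unshuffle_lcons, lcontrD, (lcontr_letter (counit_lcons a)).
  by rewrite -> lcontr_letter_r, IHx; rewrite add0r.
- apply: word_ind => [|||a x IHx]; try by lin.
    by rewrite unshuffle1 rcontrE counit1 scale1r.
  rewrite -> unshuffle_lcons, rcontrD, (rcontr_letter (counit_lcons a)).
  by rewrite -> rcontr_letter_l, IHx; rewrite addr0.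
Qed.

Lemma unshuffle_concat x y :
  unshuffle (concat (x \ox y)) = mul2 concat (unshuffle x) (unshuffle y).
Proof.
move: x; apply: word_ind => [|||a x IHx]; try by [lin | rewrite /mul2; lin].
  by rewrite concat1l unshuffle1 (mul2_1l (concat_is_algebra V K)).
rewrite -> concat_lcons, !unshuffle_lcons, IHx, mul2Dl.
rewrite -> (mul2_letter_l (concat_lcons a)), (mul2_letter_r (concat_lcons a)).
by [].
Qed.

Lemma unshuffle_is_bialgebra : is_bialgebra concat unshuffle.
Proof.
split; [exact: concat_is_algebra | exact: unshuffle_is_coalgebra | |].
  exact: unshuffle_concat.
exact: (algebra_counit_mul (concat_is_algebra V K)).
Qed.

Lemma unshuffle_cocommutative : is_cocommutative unshuffle.
Proof.
apply: word_ind => [|||a x IHx]; try by lin.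
  by rewrite unshuffle1 tswapE.
rewrite -> unshuffle_lcons, tswapD, !tswap_nat, IHx; exact: addrC.
Qed.

Lemma unshuffle_is_unshuffle_bialgebra :
  is_unshuffle_bialgebra concat unshuffle unprec unsucc.
Proof.
(* The kernel of the counit is spanned by nonempty words, so each axiom is tested on [lcons a x]. *)
have ker (W : lmodType K) (f g : A -> W) : islin f -> islin g ->
    (forall a x, f (lcons a x) = g (lcons a x)) ->
    forall x, in_Ker x -> f x = g x.
  move=> fl gl fg x x0; apply: (eq_linear_ker fl gl x0) => w /(@word_cons V K)[a [u]].
  by rewrite -/(word w) => ->.
split.
- exact: unshuffle_is_bialgebra.
- exact: unshuffle_cocommutative.
- exact: hom_unprec.
- exact: hom_unsucc.
- apply: ker => [||a x]; try by lin.
  by rewrite -> unshuffle_lcons, unprec_lcons, unsucc_lcons.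
- apply: ker => [||a x]; try by lin.
  by rewrite -> unprec_lcons, unsucc_lcons, tswap_nat, unshuffle_cocommutative.
- apply: ker => [||a x]; try by lin.
  (* On both sides the first letter ends in the leftmost of three factors; without it,
     coassociativity of [unshuffle] remains. *)
  rewrite -> unprec_lcons, comul_letter_rl.
  rewrite <- (comul_coassoc unshuffle_is_coalgebra).
  apply: etrans (tmap_idid _ _); rewrite <- tassoc_nat.
  apply: (congr1 (@tassoc _ _ _ _)).
  apply: etrans (tmap_comp _ _ _ (lin_fun unprec) (@lin_id K _)) _.
  apply: etrans (esym (tmap_comp _ _ _ (lin_fun (tmap (lcons a) id)) (@lin_id K _))).
  by apply: eq_tmap => // y; apply: unprec_lcons.
- apply: ker => [||a x]; try by lin.
  by rewrite -> unprec_lcons, (lcontr_letter (counit_lcons a)).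
- apply: ker => [||a x]; try by lin.
  by rewrite -> unprec_lcons, rcontr_letter_l, (comul_counit_r unshuffle_is_coalgebra).
- move=> x y x0 _; move: x x0.
  apply: (ker _ (fun x => unprec (concat (x \ox y)))
    (fun x => mul2 concat (unprec x) (unshuffle y))) => [||a x];
    try by [lin | rewrite /mul2; lin].
  rewrite -> concat_lcons, !unprec_lcons, unshuffle_concat.
  exact: (esym (mul2_letter_l (concat_lcons a) _ _)).
Qed.

End Unshuffle.

(** * Transport of structures along a graded isomorphism *)

Lemma tmap_square (K : fieldType) (X X' Y Y' Z Z' W W' : choiceType)
    (f : {malg K[Y]} -> {malg K[Z]}) (f' : {malg K[Y']} -> {malg K[Z']})
    (g : {malg K[X]} -> {malg K[Y]}) (g' : {malg K[X']} -> {malg K[Y']})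
    (h : {malg K[W]} -> {malg K[Z]}) (h' : {malg K[W']} -> {malg K[Z']})
    (k : {malg K[X]} -> {malg K[W]}) (k' : {malg K[X']} -> {malg K[W']}) t :
  islin f -> islin f' -> islin h -> islin h' ->
  (forall x, f (g x) = h (k x)) -> (forall x, f' (g' x) = h' (k' x)) ->
  tmap f f' (tmap g g' t) = tmap h h' (tmap k k' t).
Proof.
move=> fl fl' hl hl' fg fg'.
apply: etrans (tmap_comp g g' t fl fl') _.
apply: etrans (esym (tmap_comp k k' t hl hl')).
exact: eq_tmap.
Qed.

Section Transport.
Variables (K : fieldType) (B C : vectp).
Local Notation A := {malg K[B]}.
Local Notation AA := {malg K[(B * B)%type]}.
Local Notation A' := {malg K[C]}.
Local Notation AA' := {malg K[(C * C)%type]}.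
Variables (phi : {linear A -> A'}) (psi : {linear A' -> A}).
Hypotheses (phiK : cancel phi psi) (psiK : cancel psi phi).
Hypotheses (hom_phi : homogeneous (@deg B) (@deg C) phi)
           (hom_psi : homogeneous (@deg C) (@deg B) psi).
Hypothesis phi1 : phi (unit1 K B) = unit1 K C.

Lemma counit_phi x : counit (phi x) = counit x.
Proof. exact: (homogeneous_counit (lin_fun phi) hom_phi phi1). Qed.

(** Every element of [A'] is an image, and on images the intertwining relations apply; the variants
    below also follow the kernel of the counit. *)
Let surj (P : A' -> Prop) : (forall x, P (phi x)) -> forall x, P x.
Proof. by move=> h x; rewrite -(psiK x). Qed.

Let surj_ker (P : A' -> Prop) :
  (forall x, in_Ker x -> P (phi x)) -> forall x, in_Ker x -> P x.
Proof.
move=> h; apply: surj => x; rewrite /in_Ker counit_phi; exact: h.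
Qed.

Let surj_ker2 (P : A' -> A' -> Prop) :
  (forall x y, in_Ker x -> in_Ker y -> P (phi x) (phi y)) ->
  forall x y, in_Ker x -> in_Ker y -> P x y.
Proof.
move=> h x y x0; move: y; apply: surj_ker => y y0.
by move: x x0; apply: surj_ker => x x0; apply: h.
Qed.

Let surj_ker3 (P : A' -> A' -> A' -> Prop) :
  (forall x y z, in_Ker x -> in_Ker y -> in_Ker z -> P (phi x) (phi y) (phi z)) ->
  forall x y z, in_Ker x -> in_Ker y -> in_Ker z -> P x y z.
Proof.
move=> h x y z x0 y0; move: z; apply: surj_ker => z z0.
by move: x y x0 y0; apply: surj_ker2 => x y x0 y0; apply: h.
Qed.

Definition conj_mul (m : AA -> A) : {linear AA' -> A'} :=
  lext (fun p => phi (m (psi << p.1 >> \ox psi << p.2 >>))).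

Definition conj_comul (D : A -> AA) : {linear A' -> AA'} :=
  lext (fun c => tmap phi phi (D (psi << c >>))).

Lemma conj_mulE (m : {linear AA -> A}) x y :
  phi (m (x \ox y)) = conj_mul m (phi x \ox phi y).
Proof.
have e u v : conj_mul m (u \ox v) = phi (m (psi u \ox psi v)).
  move: u v; apply: eq_bilinear => [v|u|v|u|u v]; try by lin.
  by rewrite tensUU [LHS]lextU.
by rewrite e !phiK.
Qed.

Lemma conj_comulE (D : {linear A -> AA}) x :
  conj_comul D (phi x) = tmap phi phi (D x).
Proof.
have e u : conj_comul D u = tmap phi phi (D (psi u)).
  by move: u; apply: eq_linear => [||u]; try lin; rewrite [LHS]lextU.
by rewrite e phiK.
Qed.

Section Mul.
Variables (m : {linear AA -> A}) (m' : {linear AA' -> A'}).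
Hypothesis phiM : forall x y, phi (m (x \ox y)) = m' (phi x \ox phi y).

Lemma transport_hom_mul :
  homogeneous (tdeg (@deg B) (@deg B)) (@deg B) m ->
  homogeneous (tdeg (@deg C) (@deg C)) (@deg C) m'.
Proof.
move=> mh [x y]; rewrite -/(supported _ _) -tensUU -[<< x >>]psiK -[<< y >>]psiK.
rewrite -phiM; apply: hom_in_lin hom_phi _; first by lin.
apply: hom_in_lin mh _; first by lin.
by apply: hom_in_tens; apply: hom_psi.
Qed.

Lemma transport_algebra : is_algebra m -> is_algebra m'.
Proof.
move=> mA; split; first exact: transport_hom_mul (mul_homogeneous mA).
- apply: surj => x; apply: surj => y; apply: surj => z.
  by rewrite <- !phiM, (mul_assoc mA).
- by apply: surj => x; rewrite <- phi1, <- phiM, (mul_unit_l mA).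
- by apply: surj => x; rewrite <- phi1, <- phiM, (mul_unit_r mA).
Qed.

Lemma mul_tmap t : m' (tmap phi phi t) = phi (m t).
Proof.
move: t; apply: eq_tens => [||u v]; try by lin.
by rewrite tmapE ?phiM //; lin.
Qed.

Lemma transport_mul2 s t :
  mul2 m' (tmap phi phi s) (tmap phi phi t) = tmap phi phi (mul2 m s t).
Proof.
rewrite /mul2 tmid_nat.
by apply: tmap_square => [||||x|x]; try lin; exact: mul_tmap.
Qed.

End Mul.

Section Comul.
Variables (D : {linear A -> AA}) (D' : {linear A' -> AA'}).
Hypothesis phiD : forall x, D' (phi x) = tmap phi phi (D x).

Lemma transport_hom_comul :
  homogeneous (@deg B) (tdeg (@deg B) (@deg B)) D ->
  homogeneous (@deg C) (tdeg (@deg C) (@deg C)) D'.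
Proof.
move=> Dh x; rewrite -/(supported _ _) -[<< x >>]psiK phiD.
apply: hom_in_lin (hom_tmap hom_phi hom_phi) _; first by lin.
by apply: hom_in_lin Dh _; [lin | apply: hom_psi].
Qed.

(** [E] is an arbitrary intertwined map because the lemma serves the coproduct as well as the
    half-coproduct. *)
Lemma transport_comul_l (E : {linear A -> AA}) (E' : {linear A' -> AA'}) t :
  (forall x, E' (phi x) = tmap phi phi (E x)) ->
  tassoc (tmap E' id (tmap phi phi t))
  = tmap phi (tmap phi phi) (tassoc (tmap E id t)).
Proof.
move=> phiE; apply: etrans _ (tassoc_nat _ _ _ _).
apply: (congr1 (@tassoc _ _ _ _)).
by apply: tmap_square => [||||x|x]; try by [lin | exact: phiE].
Qed.

Lemma transport_comul_r t :
  tmap id D' (tmap phi phi t) = tmap phi (tmap phi phi) (tmap id D t).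
Proof. by apply: tmap_square => [||||x|x]; try by [lin | exact: phiD]. Qed.

Lemma transport_coalgebra : is_coalgebra D -> is_coalgebra D'.
Proof.
move=> DA; split; first exact: transport_hom_comul (comul_homogeneous DA).
- by rewrite -phi1 phiD (comul_unit DA) tmapE //; lin.
- apply: surj => x; rewrite -> phiD, (transport_comul_l _ phiD).
  by rewrite -> (comul_coassoc DA), transport_comul_r.
- apply: surj => x; rewrite -> phiD.
  apply: etrans (lcontr_nat _ counit_phi (lin_fun phi)) _.
  by rewrite (comul_counit_l DA).
- apply: surj => x; rewrite -> phiD.
  apply: etrans (rcontr_nat _ counit_phi (lin_fun phi)) _.
  by rewrite (comul_counit_r DA).
Qed.

Lemma transport_redcomul x :
  redcomul D' (phi x) = tmap phi phi (redcomul D x).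
Proof.
rewrite /redcomul phiD -phi1.
by rewrite !linearB /= !tmapE //; lin.
Qed.

End Comul.

Lemma transport_bialgebra (m : {linear AA -> A}) (D : {linear A -> AA})
    (m' : {linear AA' -> A'}) (D' : {linear A' -> AA'}) :
  (forall x y, phi (m (x \ox y)) = m' (phi x \ox phi y)) ->
  (forall x, D' (phi x) = tmap phi phi (D x)) ->
  is_bialgebra m D -> is_bialgebra m' D'.
Proof.
move=> phiM phiD [mA DA mD me]; have mA' := transport_algebra phiM mA.
split=> //; first exact: transport_coalgebra phiD DA.
  apply: surj => x; apply: surj => y.
  by rewrite -phiM !phiD mD (transport_mul2 phiM).
exact: algebra_counit_mul mA'.
Qed.

Lemma transport_shuffle_bialgebra (s p q : {linear AA -> A})
    (s' p' q' : {linear AA' -> A'}) (D : {linear A -> AA})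
    (D' : {linear A' -> AA'}) :
  (forall x y, phi (s (x \ox y)) = s' (phi x \ox phi y)) ->
  (forall x y, phi (p (x \ox y)) = p' (phi x \ox phi y)) ->
  (forall x y, phi (q (x \ox y)) = q' (phi x \ox phi y)) ->
  (forall x, D' (phi x) = tmap phi phi (D x)) ->
  is_shuffle_bialgebra s p q D -> is_shuffle_bialgebra s' p' q' D'.
Proof.
move=> phis phip phiq phiD [[[sD _] sC] hp hq spq pq pA p1r p1l pD].
split.
- split; first exact: bialgebra_hopf (transport_bialgebra phis phiD sD).
  by apply: surj => x; apply: surj => y; rewrite <- !phis, sC.
- exact: transport_hom_mul phip hp.
- exact: transport_hom_mul phiq hq.
- apply: surj_ker2 => x y x0 y0.
  by rewrite <- phis, <- phip, <- phiq, spq; rewrite ?linearD.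
- apply: surj_ker2 => x y x0 y0.
  by rewrite <- phip, <- phiq, pq.
- apply: surj_ker3 => x y z x0 y0 z0.
  rewrite <- !phip, <- phiq; rewrite -linearD; rewrite <- phip.
  by rewrite pA.
- by apply: surj_ker => x x0; rewrite <- phi1, <- phip, p1r.
- by apply: surj_ker => x x0; rewrite <- phi1, <- phip, p1l; rewrite ?linear0.
- apply: surj_ker2 => x y x0 y0.
  (* [e1] to [e7] carry the seven summands of the compatibility formula across, one at a time. *)
  have e1 : tmap phi phi (p (x \ox y) \ox unit1 K B)
            = p' (phi x \ox phi y) \ox unit1 K C.
    by rewrite tmapE ?phip ?phi1 //; lin.
  have e2 : tmap phi phi (unit1 K B \ox p (x \ox y))
            = unit1 K C \ox p' (phi x \ox phi y).
    by rewrite tmapE ?phip ?phi1 //; lin.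
  have e3 : tmap phi phi (x \ox y) = phi x \ox phi y by rewrite tmapE //; lin.
  have e4 : tmap phi phi (tmap (fun y' => p (x \ox y')) id (redcomul D y))
            = tmap (fun y' => p' (phi x \ox y')) id (redcomul D' (phi y)).
    rewrite (transport_redcomul phiD).
    by apply: tmap_square => [||||z|z]; try by [lin | exact: phip].
  have e5 : tmap phi phi (tmap (fun x' => p (x' \ox y)) id (redcomul D x))
            = tmap (fun x' => p' (x' \ox phi y)) id (redcomul D' (phi x)).
    rewrite (transport_redcomul phiD).
    by apply: tmap_square => [||||z|z]; try by [lin | exact: phip].
  have e6 : tmap phi phi (tmap id (fun x' => s (x' \ox y)) (redcomul D x))
            = tmap id (fun x' => s' (x' \ox phi y)) (redcomul D' (phi x)).
    rewrite (transport_redcomul phiD).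
    by apply: tmap_square => [||||z|z]; try by [lin | exact: phis].
  have e7 : tmap phi phi (tmap p s (tmid (redcomul D x \ox redcomul D y)))
      = tmap p' s' (tmid (redcomul D' (phi x) \ox redcomul D' (phi y))).
    rewrite !(transport_redcomul phiD) tmid_nat.
    apply: tmap_square => [||||z|z]; try lin; symmetry.
      exact: mul_tmap phip z.
    exact: mul_tmap phis z.
  by rewrite <- phip, phiD, (pD _ _ x0 y0), !tmapD, e1, e2, e3, e4, e5, e6, e7, phip.
Qed.

Lemma transport_unshuffle_bialgebra (m : {linear AA -> A})
    (m' : {linear AA' -> A'}) (d p q : {linear A -> AA})
    (d' p' q' : {linear A' -> AA'}) :
  (forall x y, phi (m (x \ox y)) = m' (phi x \ox phi y)) ->
  (forall x, d' (phi x) = tmap phi phi (d x)) ->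
  (forall x, p' (phi x) = tmap phi phi (p x)) ->
  (forall x, q' (phi x) = tmap phi phi (q x)) ->
  is_unshuffle_bialgebra m d p q -> is_unshuffle_bialgebra m' d' p' q'.
Proof.
move=> phiM phid phip phiq [mD dC hp hq dpq pq pA p0 p1 pM].
split.
- exact: transport_bialgebra phiM phid mD.
- by apply: surj => x; rewrite -> phid, tswap_nat, dC.
- exact: transport_hom_comul phip hp.
- exact: transport_hom_comul phiq hq.
- by apply: surj_ker => x x0; rewrite -> phid, phip, phiq, (dpq _ x0), tmapD.
- by apply: surj_ker => x x0; rewrite phip phiq tswap_nat pq.
- apply: surj_ker => x x0; rewrite -> phip, (transport_comul_l _ phip), (pA _ x0).
  by rewrite -> (transport_comul_r phid).
- apply: surj_ker => x x0; rewrite -> phip.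
  apply: etrans (lcontr_nat _ counit_phi (lin_fun phi)) _.
  by rewrite p0 // linear0.
- apply: surj_ker => x x0; rewrite -> phip.
  apply: etrans (rcontr_nat _ counit_phi (lin_fun phi)) _.
  by rewrite p1.
- apply: surj_ker2 => x y x0 y0.
  by rewrite <- phiM, phip, (pM _ _ x0 y0), phip, phid, (transport_mul2 phiM).
Qed.

End Transport.

(** * Reduced coproducts and the filtration by word length *)

Section Support.
Variable K : fieldType.

Lemma lin_mcoeff (U V : lmodType K) (X : choiceType) (x : X) (v : V)
    (f : U -> {malg K[X]}) : islin f -> islin (fun u => (f u)@_x *: v).
Proof.
move=> fl; split=> a u w.
by rewrite (islinP fl) mcoeffD mcoeffZ scalerDl scalerA.
Qed.

Lemma mcoeff_lcontr (B : vectp) (X : choiceType) (t : {malg K[(B * X)%type]}) x :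
  (lcontr (@counit K B) t)@_x = t@_(b1, x).
Proof.
have e : (lcontr (@counit K B) t)@_x *: unit1 K B = t@_(b1, x) *: unit1 K B.
  move: t; apply: eq_tens => [||u v]; try by apply: lin_mcoeff; lin.
  by rewrite lcontrE mcoeffZ mcoeff_tens.
have /(congr1 (@counit K B)) := e; rewrite /counit !mcoeffZ /unit1.
by rewrite mcoeffU eqxx !mulr1.
Qed.

Lemma mcoeff_rcontr (B : vectp) (X : choiceType) (t : {malg K[(X * B)%type]}) x :
  (rcontr (@counit K B) t)@_x = t@_(x, b1).
Proof.
have e : (rcontr (@counit K B) t)@_x *: unit1 K B = t@_(x, b1) *: unit1 K B.
  move: t; apply: eq_tens => [||u v]; try by apply: lin_mcoeff; lin.
  by rewrite rcontrE mcoeffZ mcoeff_tens mulrC.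
have /(congr1 (@counit K B)) := e; rewrite /counit !mcoeffZ /unit1.
by rewrite mcoeffU eqxx !mulr1.
Qed.

(** The reduced coproduct is killed by the counit on either factor, and these contractions read
    exactly the coefficients at pairs containing [b1]. *)
Lemma supp_redcomul (B : vectp)
    (D : {linear {malg K[B]} -> {malg K[(B * B)%type]}}) x :
  is_coalgebra D -> in_Ker x ->
  supported (fun p : B * B => p.1 <> b1 /\ p.2 <> b1) (redcomul D x).
Proof.
move=> DA x0.
have l0 : lcontr (@counit K B) (redcomul D x) = 0.
  rewrite /redcomul !lcontrB (comul_counit_l DA) !lcontrE counit1 x0.
  by rewrite scale0r subr0 scale1r subrr.
have r0 : rcontr (@counit K B) (redcomul D x) = 0.
  rewrite /redcomul !(lin_B (lin_fun (rcontr _))).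
  rewrite -[LHS]/(rcontr (@counit K B) (D x) - rcontr (@counit K B) (x \ox unit1 K B)
    - rcontr (@counit K B) (unit1 K B \ox x)).
  by rewrite (comul_counit_r DA) !rcontrE counit1 x0 scale0r subr0 scale1r subrr.
move=> [y z] yz; split=> /= e; move: yz; rewrite e -mcoeff_neq0.
  by rewrite -mcoeff_lcontr l0 mcoeff0 eqxx.
by rewrite -mcoeff_rcontr r0 mcoeff0 eqxx.
Qed.

Lemma supp_false (X : choiceType) (u : {malg K[X]}) :
  supported (fun _ => False) u -> u = 0.
Proof.
by move=> h; apply/malgP => x; rewrite mcoeff0; apply: mcoeff_outdom; apply/negP => /h.
Qed.

Lemma supp_sub (X : choiceType) (P Q : X -> Prop) (u : {malg K[X]}) :
  (forall x, P x -> Q x) -> supported P u -> supported Q u.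
Proof. by move=> PQ h x /h /PQ. Qed.

Variable V : vect.
Local Notation T := (tensorp V).

(** The length filtration of T(V): the change of generators below is the identity modulo longer
    words. *)
Definition longer n := fun w : T => (n <= size w)%N.

Lemma supp_concat p q (x y : {malg K[T]}) :
  supported (longer p) x -> supported (longer q) y ->
  supported (longer (p + q)) (concat V K (x \ox y)).
Proof.
move=> hx hy; apply: (supp_lin _ _ (supp_tens hx hy)); first by lin.
move=> [u v] [/= hu hv]; rewrite -tensUU [concat _ _ _]concatE.
by apply: suppU; rewrite /longer size_cat leq_add.
Qed.

Lemma longer_deg_gt0 n (x : {malg K[T]}) :
  hom_in (@deg T) n x -> (0 < n)%N -> supported (longer 1) x.
Proof.
move=> hx n0; apply: supp_sub (hom_in_gt0 hx n0) => w /eqP wb.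
by rewrite /longer lt0n size_eq0.
Qed.

End Support.

(** * The theorem of Loday and Ronco *)

Section LodayRonco.
Variables (K : fieldType) (B : vectp) (V : vect).
Local Notation A := {malg K[B]}.
Local Notation AA := {malg K[(B * B)%type]}.
Local Notation T := (tensorp V).
Local Notation TV := {malg K[T]}.
Local Notation concat := (concat V K).
Local Notation lcons := (@lcons V K).
Local Notation word := (@word V K).
Variables (m : {linear AA -> A}) (D : {linear A -> AA}).
Hypothesis mD : is_infinitesimal m D.
Let mA := inf_algebra mD.
Let DA := inf_coalgebra mD.
Variables (chi : {linear TV -> A}) (chi' : {linear A -> TV}).
Hypotheses (chiK : cancel chi chi') (chi'K : cancel chi' chi).
Hypotheses (hom_chi : homogeneous (@deg T) (@deg B) chi)
           (hom_chi' : homogeneous (@deg B) (@deg T) chi').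
Hypothesis chi1 : chi (unit1 K T) = unit1 K B.
Hypothesis chiM : forall x y, chi (concat (x \ox y)) = m (chi x \ox chi y).

Let letter (a : V) : A := chi (word [:: a]).

Definition prim (a : V) : A := - cinv m D (letter a).

Let letter_ker a : in_Ker (letter a).
Proof.
rewrite /in_Ker (homogeneous_counit (lin_fun chi) hom_chi chi1).
exact: in_KerU.
Qed.

Lemma comul_prim a : D (prim a) = prim a \ox unit1 K B + unit1 K B \ox prim a.
Proof.
have tensNr (X Y : choiceType) (u : {malg K[X]}) (v : {malg K[Y]}) :
    u \ox - v = - (u \ox v) by exact: linearN.
rewrite /prim linearN /= (comul_cinv mD) letter_ker scale0r subr0.
by rewrite opprD tensNl tensNr.
Qed.

Lemma hom_prim a : hom_in (@deg B) (vect_deg a) (prim a).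
Proof.
apply: suppN; apply: hom_in_lin (hom_cinv mA DA) _; first by lin.
have -> : vect_deg a = word_deg [:: a] by rewrite /word_deg big_seq1.
exact: hom_chi.
Qed.

(* The inverse of id for the convolution is -v plus decomposable terms on each
   letter v, so that the primitive elements [prim v] generate freely. *)
Lemma prim_letter a : exists r, chi' (prim a) = word [:: a] + r /\ supported (longer 2) r.
Proof.
pose R := redcomul D (letter a).
have eD : D (letter a) = letter a \ox unit1 K B + unit1 K B \ox letter a + R.
  by rewrite /R /redcomul -(addrA (D _)) -opprD [RHS]addrC subrK.
(* The relation S(v1) v2 = eps(v) 1 at a letter, where eps vanishes; S(1) = 1 makes the second term
   the letter itself. *)
have e0 : cinv m D (letter a) + letter a + m (tmap (cinv m D) id R) = 0.
  have := cinv_l mA DA (letter a); rewrite /cunit letter_ker scale0r /conv eD.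
  have e1 : tmap (cinv m D) id (letter a \ox unit1 K B)
            = cinv m D (letter a) \ox unit1 K B by apply: tmapE; lin.
  have e2 : tmap (cinv m D) id (unit1 K B \ox letter a)
            = cinv m D (unit1 K B) \ox letter a by apply: tmapE; lin.
  rewrite !tmapD e1 e2 !(lin_D (lin_fun m)).
  by rewrite (cinv1 m DA) (mul_unit_r mA) (mul_unit_l mA).
have chi'M t : chi' (m t) = concat (tmap chi' chi' t).
  rewrite -[RHS]chiK; apply: (congr1 chi'); symmetry.
  move: t; apply: eq_tens => [||u v]; try by lin.
  by rewrite tmapE ?chiM ?chi'K //; lin.
exists (chi' (m (tmap (cinv m D) id R))); split.
  rewrite -[word _]chiK -linearD; apply: (congr1 chi').
  apply/eqP; rewrite /prim eq_sym -subr_eq0 opprK addrC addrA.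
  exact/eqP.
rewrite chi'M tmap_comp; try by lin.
apply: (supp_lin (f := fun t => concat (tmap (chi' \o cinv m D) (chi' \o id) t))
  _ _ (supp_redcomul DA (letter_ker a))); first by lin.
(* Both factors have positive degree, the antipode keeps it, and so each contributes at least one
   letter. *)
move=> [y z] [/= yb zb]; rewrite tmapUU /=.
apply: (@supp_concat _ _ 1 1).
  apply: (@longer_deg_gt0 _ _ (deg y)); last exact: deg_gt0.
  by apply: hom_in_lin hom_chi' _; [lin | apply: hom_cinv].
apply: (@longer_deg_gt0 _ _ (deg z)); last exact: deg_gt0.
exact: hom_chi'.
Qed.

Definition primword : {linear TV -> A} :=
  lext (fun w => foldr (fun a x => m (prim a \ox x)) (unit1 K B) w).

Lemma primword1 : primword (unit1 K T) = unit1 K B.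
Proof. exact: lextU. Qed.

Lemma primword_lcons a x : primword (lcons a x) = m (prim a \ox primword x).
Proof.
move: x; apply: eq_linear => [||w]; try by lin.
by rewrite -/(word w) lconsE [LHS]lextU [primword _]lextU.
Qed.

Lemma hom_primword : homogeneous (@deg T) (@deg B) primword.
Proof.
move=> w; rewrite -/(hom_in _ _ _) -/(word w).
elim: w => [|a w IHw].
  rewrite -[word _]/(unit1 K T) primword1; apply: suppU.
  by rewrite deg_b1 /= /word_deg big_nil.
rewrite /= word_deg_cons -lconsE primword_lcons.
apply: hom_in_lin (mul_homogeneous mA) _; first by lin.
by apply: hom_in_tens => //; apply: hom_prim.
Qed.

(** With a primitive first factor p, the term p (x) y of the infinitesimal relation cancels the
    subtracted one; what is left is the recursion [deconc_lcons]. *)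
Lemma primword_comul x : D (primword x) = tmap primword primword (deconc V K x).
Proof.
move: deconc_nil deconc_lcons => dn dl.
move: (deconc V K) (dn V K) (dl V K) => dc {}dn {}dl.
move: x; apply: word_ind => [|||a x IHx]; try by lin.
  by rewrite primword1 (comul_unit DA) dn tmapE ?primword1 //; lin.
have e1 : tmap (fun y => m (prim a \ox y)) id (tmap primword primword (dc x))
          = tmap primword primword (tmap (lcons a) id (dc x)).
  by apply: tmap_square => [||||y|//]; try lin; rewrite primword_lcons.
have e2 : tmap id (fun y => m (y \ox primword x)) (D (prim a))
          = prim a \ox primword x + unit1 K B \ox primword (lcons a x).
  rewrite comul_prim tmapD !tmapE; try by lin.
  by rewrite (mul_unit_l mA) primword_lcons.
have reorder (W : zmodType) (b c d : W) : b + (c + d) - c = d + b.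
  by rewrite [c + d]addrC addrA addrK addrC.
rewrite [in LHS]primword_lcons (inf_comul_mul mD) IHx e1 e2 reorder.
rewrite dl tmapD.
by rewrite tmapE ?primword1 //; lin.
Qed.

Lemma chi'_mul x y : chi' (m (x \ox y)) = concat (chi' x \ox chi' y).
Proof. by rewrite -[x in LHS]chi'K -[y in LHS]chi'K -chiM chiK. Qed.

Let f : {linear TV -> TV} := chi' \o primword.

Let f_lcons a x : f (lcons a x) = concat (chi' (prim a) \ox f x).
Proof. by rewrite /f /= primword_lcons chi'_mul. Qed.

(** Replacing each letter by itself plus longer words alters a word only by strictly longer ones.
    This strict gain makes [id - f] locally nilpotent. *)
Lemma primword_longer w : supported (longer (size w).+1) (word w - f (word w)).
Proof.
elim: w => [|a w IHw].
  have -> : f (word [::]) = word [::].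
    by rewrite /f /= -[word _]/(unit1 K T) primword1 -chi1 chiK.
  by rewrite subrr; apply: supp0.
have fw : supported (longer (size w)) (f (word w)).
  rewrite -[f _](subKr (word w)); apply: suppD; first by apply: suppU; apply: leqnn.
  by apply: suppN; apply: supp_sub IHw => v; apply: ltnW.
have [r [er hr]] := prim_letter a.
rewrite -lconsE f_lcons er tensDl linearD /=.
have -> : concat (word [:: a] \ox f (word w)) = lcons a (f (word w)).
  by rewrite -[word [:: a]](lconsE K a [::]) concat_lcons concat1l.
(* The difference is [a] prefixed to that of [w], minus [r] times the image of [w]; both have length
   at least [(size w).+2]. *)
rewrite opprD addrA -linearB /=; apply: suppD.
  apply: supp_lin IHw; first by lin.
  by move=> v hv; rewrite -/(word v) lconsE; apply: suppU.
by apply: suppN; rewrite -addn2 addnC; apply: supp_concat.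
Qed.

Theorem coalgebra_iso_deconc :
  exists (theta : {linear TV -> A}) (theta' : {linear A -> TV}),
  [/\ cancel theta theta', cancel theta' theta,
      homogeneous (@deg T) (@deg B) theta,
      homogeneous (@deg B) (@deg T) theta' &
      theta (unit1 K T) = unit1 K B /\
      forall x, D (theta x) = tmap theta theta (deconc V K x)].
Proof.
have fh : homogeneous (@deg T) (@deg T) f.
  exact: (hom_comp (lin_fun chi') hom_chi' hom_primword).
(* [id - f] preserves degree and raises length; as letters have positive degree, length is at most
   degree and the iterates die. *)
have fnil w k : (@deg T w < k)%N -> iter k (fun u => u - f u) << w >> = 0.
  move=> wk; apply: supp_false.
  have h1 : hom_in (@deg T) (@deg T w) (iter k (fun u => u - f u) << w >>).
    elim: (k) => [|j IHj] /=; first exact: hom_inU.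
    apply: suppD => //; apply: suppN; apply: hom_in_lin fh _ => //; lin.
  have h2 : supported (longer k) (iter k (fun u => u - f u) << w >>).
    elim: (k) => [|j IHj] /=; first by move=> v _.
    apply: (supp_lin (f := fun u => u - f u)) IHj; first by lin.
    by move=> v hv v' /primword_longer; apply: leq_trans.
  move=> v hv; have := h2 _ hv; rewrite /longer leqNgt => /negP; apply.
  apply: leq_ltn_trans (size_word_deg v) _.
  by move: (h1 _ hv) => /= ->.
have [g [gh gK Kg]] := unipotent_inv fh fnil.
exists primword, (g \o chi'); split.
- exact: gK.
(* Applying the injective [chi'] turns the second composite into [f \o g], already known to be the
   identity. *)
- move=> y; apply: (can_inj chi'K) => /=.
  exact: (Kg (chi' y)).
- exact: hom_primword.
- exact: (hom_comp (lin_fun g) gh hom_chi').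
- by split; [apply: primword1 | apply: primword_comul].
Qed.

End LodayRonco.

(** * Finite topologies and preorders *)

Section Specialization.
Variables (S : finType) (T : topology S).
Implicit Types (x y z : S) (O A B C : {set S}).

(** Orientation: [x] lies in the closure of [y], so that open sets are up-sets and the left block of
    a join is below the right one. *)
Definition spec x y : bool :=
  [forall O : {set S}, (O \in opens T) ==> (x \in O) ==> (y \in O)].

Lemma specP x y : reflect
  (forall O, O \in opens T -> x \in O -> y \in O) (spec x y).
Proof.
apply: (iffP forallP) => [h O OT xO|h O].
  by move: (h O); rewrite OT xO.
by apply/implyP => OT; apply/implyP; apply: h.
Qed.

(** By finiteness each point has a least open neighbourhood [U x], the set of points above it, and
    an up-set is the union of these. *)
Lemma open_specP O : reflect
  (forall x y, x \in O -> spec x y -> y \in O) (O \in opens T).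
Proof.
have /is_topologyP[T0 T1 TU TI] := topologyP T.
apply: (iffP idP) => [OT x y xO /specP|Oup]; first exact.
pose U x := \bigcap_(P in opens T | x \in P) P.
have UT x : U x \in opens T.
  by apply: (big_ind (fun A => A \in opens T)) => // P /andP[].
have -> : O = \bigcup_(x in O) U x.
  apply/setP=> y; apply/idP/bigcupP => [yO|[x xO /bigcapP yU]].
    by exists y => //; apply/bigcapP => P /andP[].
  by apply: Oup xO _; apply/specP => P PT xP; apply: yU; rewrite PT.
by apply: (big_ind (fun A => A \in opens T)) => // P _.
Qed.

End Specialization.

Lemma homeomorphic_spec (S S' : finType) (T : topology S) (T' : topology S')
    (f : S -> S') :
  bijective f -> (forall x y, spec T' (f x) (f y) = spec T x y) ->
  homeomorphic T T'.
Proof.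
move=> f_bij fE; apply/homeomorphicP; exists f; apply/homeomorphism_preim.
split=> // O; apply/open_specP/open_specP => h x y.
  case: f_bij => g _ gK; rewrite -(gK x) -(gK y) fE => xO xy.
  by have := h _ _ _ xy; rewrite !inE; apply.
by rewrite !inE -fE; apply: h.
Qed.

Lemma homeomorphism_spec (S S' : finType) (T : topology S) (T' : topology S')
    (f : S -> S') :
  homeomorphism T T' f -> forall x y, spec T' (f x) (f y) = spec T x y.
Proof.
move=> hf x y; have [[g fK gK] fpre] := (homeomorphism_preim T T' f).1 hf.
apply/specP/specP => h O OT.
  have := h (f @: O); rewrite hf.2 => /(_ OT).
  by rewrite !mem_imset //; apply: can_inj fK.
by have := h (f @^-1: O); rewrite fpre !inE; apply.
Qed.

Section SpecSumJoin.
Variables (n n' : nat) (T : topology 'I_n) (T' : topology 'I_n').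

Lemma mem_cup_shiftl (O : {set 'I_n}) (O' : {set 'I_n'}) i :
  (lshift n' i \in cup_shift O O') = (i \in O).
Proof.
rewrite inE mem_imset; last exact: lshift_inj.
by case: imsetP => [[j _ /eqP]|]; rewrite ?eq_shift // orbF.
Qed.

Lemma mem_cup_shiftr (O : {set 'I_n}) (O' : {set 'I_n'}) i :
  (rshift n i \in cup_shift O O') = (i \in O').
Proof.
rewrite inE [X in _ || X]mem_imset; last exact: rshift_inj.
by case: imsetP => [[j _ /eqP]|]; rewrite ?eq_shift.
Qed.

Lemma cup_shift_sum O O' : O \in opens T -> O' \in opens T' ->
  cup_shift O O' \in opens (top_sum T T').
Proof. exact: imset2_f. Qed.

Lemma cup_shift_join O : O \in opens T ->
  cup_shift O setT \in opens (top_join T T').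
Proof. by move=> OT; rewrite inE; apply/orP; left; apply: imset_f. Qed.

Lemma rshift_join O' : O' \in opens T' ->
  cup_shift set0 O' \in opens (top_join T T').
Proof.
move=> OT; rewrite inE; apply/orP; right; apply/imsetP; exists O' => //.
by rewrite /cup_shift imset0 set0U.
Qed.

Let T0 : set0 \in opens T. Proof. by case/is_topologyP: (topologyP T). Qed.
Let T1 : setT \in opens T. Proof. by case/is_topologyP: (topologyP T). Qed.
Let T'0 : set0 \in opens T'. Proof. by case/is_topologyP: (topologyP T'). Qed.
Let T'1 : setT \in opens T'. Proof. by case/is_topologyP: (topologyP T'). Qed.

Lemma spec_sum_ll i j :
  spec (top_sum T T') (lshift n' i) (lshift n' j) = spec T i j.
Proof.
apply/specP/specP => h O.
  by move=> OT; have := h _ (cup_shift_sum OT T'0); rewrite !mem_cup_shiftl.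
rewrite in_sum_opens => /andP[OT _] iO.
by have := h _ OT; rewrite !inE; apply.
Qed.

Lemma spec_sum_rr i j :
  spec (top_sum T T') (rshift n i) (rshift n j) = spec T' i j.
Proof.
apply/specP/specP => h O.
  by move=> OT; have := h _ (cup_shift_sum T0 OT); rewrite !mem_cup_shiftr.
rewrite in_sum_opens => /andP[_ OT] iO.
by have := h _ OT; rewrite !inE; apply.
Qed.

Lemma spec_sum_lr i j : spec (top_sum T T') (lshift n' i) (rshift n j) = false.
Proof.
apply/specP => /(_ _ (cup_shift_sum T1 T'0)).
by rewrite mem_cup_shiftl mem_cup_shiftr !inE => /(_ isT).
Qed.

Lemma spec_sum_rl i j : spec (top_sum T T') (rshift n i) (lshift n' j) = false.
Proof.
apply/specP => /(_ _ (cup_shift_sum T0 T'1)).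
by rewrite mem_cup_shiftl mem_cup_shiftr !inE => /(_ isT).
Qed.

Lemma spec_join_ll i j :
  spec (top_join T T') (lshift n' i) (lshift n' j) = spec T i j.
Proof.
apply/specP/specP => h O.
  by move=> OT; have := h _ (cup_shift_join OT); rewrite !mem_cup_shiftl.
rewrite in_join_opens => /orP[/andP[OT _]|/andP[/eqP/setP/(_ i)]] iO.
  by have := h _ OT; rewrite !inE; apply.
by rewrite !inE in iO *; move=> _ e; rewrite e in iO.
Qed.

Lemma spec_join_rr i j :
  spec (top_join T T') (rshift n i) (rshift n j) = spec T' i j.
Proof.
apply/specP/specP => h O.
  by move=> OT; have := h _ (rshift_join OT); rewrite !mem_cup_shiftr.
rewrite in_join_opens => /orP[/andP[_ /eqP/setP/(_ j)]|/andP[_ OT] iO].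
  by rewrite !inE => ->.
by have := h _ OT; rewrite !inE; apply.
Qed.

Lemma spec_join_lr i j : spec (top_join T T') (lshift n' i) (rshift n j).
Proof.
apply/specP => O; rewrite in_join_opens.
case/orP=> [/andP[_ /eqP/setP/(_ j)]|/andP[/eqP/setP/(_ i)]].
  by rewrite !inE => ->.
by rewrite !inE => ->.
Qed.

Lemma spec_join_rl i j : spec (top_join T T') (rshift n i) (lshift n' j) = false.
Proof.
apply/specP => /(_ _ (rshift_join T'1)).
by rewrite mem_cup_shiftl mem_cup_shiftr !inE => /(_ isT).
Qed.

End SpecSumJoin.

Lemma spec_restr (S : finType) (T : topology S) (Y : {set S}) i j :
  spec (top_restr T Y) i j = spec T (enum_val i) (enum_val j).
Proof.
apply/specP/specP => h O.
  move=> OT iO; have := h ((@enum_val _ (mem Y)) @^-1: O).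
  by rewrite !inE; apply => //; apply/restr_opensP; exists O.
by case/restr_opensP => O' OT ->; rewrite !inE; apply: h.
Qed.

(** Working with subsets of one ambient space avoids the re-enumerations by ordinals that nested
    restrictions would produce. *)
Definition cl (S : finType) (T : topology S) (A : {set S}) : fspace :=
  fclass (top_restr T A).

Lemma fspace_deg_cl (S : finType) (T : topology S) (A : {set S}) :
  fspace_deg (cl T A) = #|A|.
Proof. exact: fspace_deg_fclass. Qed.

Lemma cl_eq1 (S : finType) (T : topology S) (A : {set S}) :
  cl T A = fspace1 <-> A = set0.
Proof.
rewrite -fspace_deg_eq0 fspace_deg_cl; split=> [/eqP|->]; last exact: cards0.
by rewrite cards_eq0 => /eqP.
Qed.

(** The criterion for identifying classes: an injective, order-preserving and order-reflecting
    parametrization of [A] is a homeomorphism onto it. *)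
Lemma fclass_cl (S : finType) (T' : topology S) n (T : topology 'I_n)
    (g : 'I_n -> S) (A : {set S}) :
  injective g -> (forall x, (x \in A) = [exists i, x == g i]) ->
  (forall i j, spec T' (g i) (g j) = spec T i j) ->
  fclass T = cl T' A.
Proof.
move=> g_inj gA gE; apply/fclassP.
have gi i : g i \in A by rewrite gA; apply/existsP; exists i.
pose h i : 'I_#|A| := enum_rank_in (gi i) (g i).
have hE i : enum_val (h i) = g i by rewrite enum_rankK_in.
have h_inj : injective h by move=> i j /(congr1 enum_val); rewrite !hE => /g_inj.
apply: (homeomorphic_spec (f := h)) => [|i j]; last by rewrite spec_restr !hE.
apply: inj_card_bij => //; rewrite !card_ord.
have -> : A = g @: setT.
  apply/setP=> x; rewrite gA; apply/existsP/imsetP => [[i /eqP->]|[i _ ->]].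
    by exists i.
  by exists i.
by rewrite card_imset // cardsT card_ord.
Qed.

Lemma fclass_clT n (T : topology 'I_n) : fclass T = cl T setT.
Proof.
apply: (fclass_cl (g := id)) => // x; rewrite inE; symmetry.
by apply/existsP; exists x.
Qed.

Lemma cl_image (S S' : finType) (T : topology S) (T' : topology S')
    (f : S -> S') (A : {set S}) :
  {in A &, injective f} -> {in A &, forall x y, spec T' (f x) (f y) = spec T x y} ->
  cl T A = cl T' (f @: A).
Proof.
move=> f_inj fE; apply: (fclass_cl (g := f \o enum_val)).
- by move=> i j /= /f_inj e; apply: enum_val_inj; apply: e; apply: enum_valP.
- move=> x; apply/imsetP/existsP => [[y yA ->]|[i /eqP->]].
    by exists (enum_rank_in yA y); rewrite /= enum_rankK_in.
  by exists (enum_val i) => //; apply: enum_valP.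
- by move=> i j /=; rewrite spec_restr fE //; apply: enum_valP.
Qed.

Lemma cl_restr (S : finType) (T : topology S) (Y : {set S}) Z :
  cl (top_restr T Y) Z = cl T (enum_val @: Z).
Proof.
apply: cl_image => [i j _ _|i j _ _]; first exact: enum_val_inj.
by rewrite spec_restr.
Qed.

Section JoinSum.
Variables (S : finType) (T : topology S) (A B : {set S}).
Hypothesis dAB : [disjoint A & B].

Let g (i : 'I_(#|A| + #|B|)) : S :=
  match split i with inl j => enum_val j | inr j => enum_val j end.

Let gl j : g (lshift _ j) = enum_val j.
Proof. by rewrite /g (unsplitK (inl j)). Qed.

Let gr j : g (rshift _ j) = enum_val j.
Proof. by rewrite /g (unsplitK (inr j)). Qed.

Let disj (i : 'I_#|A|) (j : 'I_#|B|) : enum_val i <> enum_val j.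
Proof.
by move=> e; have := disjointFr dAB (enum_valP i); rewrite e enum_valP.
Qed.

Let g_inj : injective g.
Proof.
move=> i j; case: (split_ordP i) => i' ->; case: (split_ordP j) => j' ->;
  rewrite ?gl ?gr.
- by move/enum_val_inj->.
- by move/disj.
- by move/esym/disj.
- by move/enum_val_inj->.
Qed.

Let gAB x : (x \in A :|: B) = [exists i, x == g i].
Proof.
rewrite inE; apply/orP/existsP => [[xA|xB]|[i /eqP->]].
- by exists (lshift _ (enum_rank_in xA x)); rewrite gl enum_rankK_in.
- by exists (rshift _ (enum_rank_in xB x)); rewrite gr enum_rankK_in.
- by case: (split_ordP i) => j ->; rewrite ?gl ?gr; [left|right]; apply: enum_valP.
Qed.

Lemma cl_join :
  (forall a b, a \in A -> b \in B -> spec T a b && ~~ spec T b a) ->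
  fspace_join (cl T A) (cl T B) = cl T (A :|: B).
Proof.
move=> hAB; rewrite fspace_joinE; apply: fclass_cl g_inj gAB _ => i j.
have lr i' j' := hAB _ _ (@enum_valP _ _ i') (@enum_valP _ _ j').
case: (split_ordP i) => i' ->; case: (split_ordP j) => j' ->; rewrite ?gl ?gr.
- by rewrite spec_join_ll spec_restr.
- by rewrite spec_join_lr; case/andP: (lr i' j').
- by rewrite spec_join_rl; apply: negbTE; case/andP: (lr j' i').
- by rewrite spec_join_rr spec_restr.
Qed.

Lemma cl_sum :
  (forall a b, a \in A -> b \in B -> ~~ spec T a b && ~~ spec T b a) ->
  fspace_sum (cl T A) (cl T B) = cl T (A :|: B).
Proof.
move=> hAB; rewrite fspace_sumE; apply: fclass_cl g_inj gAB _ => i j.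
have lr i' j' := hAB _ _ (@enum_valP _ _ i') (@enum_valP _ _ j').
case: (split_ordP i) => i' ->; case: (split_ordP j) => j' ->; rewrite ?gl ?gr.
- by rewrite spec_sum_ll spec_restr.
- by rewrite spec_sum_lr; apply: negbTE; case/andP: (lr i' j').
- by rewrite spec_sum_rl; apply: negbTE; case/andP: (lr j' i').
- by rewrite spec_sum_rr spec_restr.
Qed.

End JoinSum.

(** * Decompositions of finite spaces *)

Section Split.
Variables (S : finType) (J : topology S).
Implicit Types (A B C : {set S}) (X Y Z : fspace).

Definition below A B :=
  forall a b, a \in A -> b \in B -> spec J a b && ~~ spec J b a.

Definition apart A B :=
  forall a b, a \in A -> b \in B -> ~~ spec J a b && ~~ spec J b a.

(** Converse of [cl_join]: a homeomorphism carries the two blocks of the join to complementary parts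
    of [A], together with their order relation. *)
Lemma join_split A X Y : cl J A = fspace_join X Y ->
  exists A1 A2, [/\ A = A1 :|: A2, [disjoint A1 & A2], cl J A1 = X, cl J A2 = Y
                  & below A1 A2].
Proof.
move=> e; have /fclassP/homeomorphicP[f hf] := esym e.
have fE := homeomorphism_spec hf; have f_inj := bij_inj hf.1.
pose g i := enum_val (f i).
have gE i j : spec J (g i) (g j)
    = spec (top_join (fspace_top X) (fspace_top Y)) i j by rewrite -fE spec_restr.
have g_inj : injective g by move=> i j /enum_val_inj/f_inj.
exists [set g (lshift _ i) | i in setT], [set g (rshift _ i) | i in setT].
split.
- apply/setP=> x; rewrite inE; apply/idP/orP.
    move=> xA; case: hf.1 => f' _ f'K.
    have -> : x = g (f' (enum_rank_in xA x)) by rewrite /g f'K enum_rankK_in.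
    by case: (split_ordP (f' (enum_rank_in xA x))) => j ->; [left|right];
      apply/imsetP; exists j.
  by case=> /imsetP[i _ ->]; rewrite /g; apply: (@enum_valP _ (mem A)).
- apply/pred0P => x /=; apply/andP => -[/imsetP[i _ ->] /imsetP[j _ /g_inj]].
  by move/eqP; rewrite eq_shift.
- rewrite -[RHS]fspace_topK; symmetry;
  apply: (fclass_cl (g := g \o @lshift (fspace_deg X) (fspace_deg Y))).
  + by move=> i j /= /g_inj/lshift_inj.
  + move=> x; apply/imsetP/existsP => [[i _ ->]|[i /eqP->]]; by exists i.
  + by move=> i j; rewrite /= gE spec_join_ll.
- rewrite -[RHS]fspace_topK; symmetry;
  apply: (fclass_cl (g := g \o @rshift (fspace_deg X) (fspace_deg Y))).
  + by move=> i j /= /g_inj/rshift_inj.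
  + move=> x; apply/imsetP/existsP => [[i _ ->]|[i /eqP->]]; by exists i.
  + by move=> i j; rewrite /= gE spec_join_rr.
- by move=> _ _ /imsetP[i _ ->] /imsetP[j _ ->]; rewrite !gE spec_join_lr spec_join_rl.
Qed.

Lemma sum_split A X Y : cl J A = fspace_sum X Y ->
  exists A1 A2, [/\ A = A1 :|: A2, [disjoint A1 & A2], cl J A1 = X, cl J A2 = Y
                  & apart A1 A2].
Proof.
move=> e; have /fclassP/homeomorphicP[f hf] := esym e.
have fE := homeomorphism_spec hf; have f_inj := bij_inj hf.1.
pose g i := enum_val (f i).
have gE i j : spec J (g i) (g j)
    = spec (top_sum (fspace_top X) (fspace_top Y)) i j by rewrite -fE spec_restr.
have g_inj : injective g by move=> i j /enum_val_inj/f_inj.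
exists [set g (lshift _ i) | i in setT], [set g (rshift _ i) | i in setT].
split.
- apply/setP=> x; rewrite inE; apply/idP/orP.
    move=> xA; case: hf.1 => f' _ f'K.
    have -> : x = g (f' (enum_rank_in xA x)) by rewrite /g f'K enum_rankK_in.
    by case: (split_ordP (f' (enum_rank_in xA x))) => j ->; [left|right];
      apply/imsetP; exists j.
  by case=> /imsetP[i _ ->]; rewrite /g; apply: (@enum_valP _ (mem A)).
- apply/pred0P => x /=; apply/andP => -[/imsetP[i _ ->] /imsetP[j _ /g_inj]].
  by move/eqP; rewrite eq_shift.
- rewrite -[RHS]fspace_topK; symmetry;
  apply: (fclass_cl (g := g \o @lshift (fspace_deg X) (fspace_deg Y))).
  + by move=> i j /= /g_inj/lshift_inj.
  + move=> x; apply/imsetP/existsP => [[i _ ->]|[i /eqP->]]; by exists i.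
  + by move=> i j; rewrite /= gE spec_sum_ll.
- rewrite -[RHS]fspace_topK; symmetry;
  apply: (fclass_cl (g := g \o @rshift (fspace_deg X) (fspace_deg Y))).
  + by move=> i j /= /g_inj/rshift_inj.
  + move=> x; apply/imsetP/existsP => [[i _ ->]|[i /eqP->]]; by exists i.
  + by move=> i j; rewrite /= gE spec_sum_rr.
- by move=> _ _ /imsetP[i _ ->] /imsetP[j _ ->]; rewrite !gE spec_sum_lr spec_sum_rl.
Qed.

End Split.

Lemma fspace_cl (X : fspace) : exists n (J : topology 'I_n), X = cl J setT.
Proof.
by exists (fspace_deg X), (fspace_top X); rewrite -fclass_clT fspace_topK.
Qed.

Lemma disjoint_subl (S : finType) (A B C : {set S}) :
  [disjoint A :|: B & C] -> [disjoint A & C] /\ [disjoint B & C].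
Proof.
by move=> d; split; apply: disjointWl d; [apply: subsetUl | apply: subsetUr].
Qed.

(** Splitting the left bracketing twice yields three successive blocks of one space; reassembling
    them from the right gives the other bracketing. *)
Lemma fspace_joinA : associative fspace_join.
Proof.
move=> X Y Z; have [n [J e]] := fspace_cl (fspace_join (fspace_join X Y) Z).
have [A [C [eT dAC eA eC AC]]] := join_split (esym e).
have [A1 [A2 [eA12 d12 eX eY A12]]] := join_split eA.
rewrite e eT -{}eC -{}eX -{}eY; move: dAC AC; rewrite eA12 => /disjoint_subl[d1C d2C] AC.
have inl x : x \in A1 -> x \in A1 :|: A2 by rewrite inE => ->.
have inr x : x \in A2 -> x \in A1 :|: A2 by rewrite inE => ->; rewrite orbT.
rewrite cl_join // => [|a c aA2 cC]; last by apply: AC => //; apply: inr.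
rewrite cl_join ?setUA // => [|a b aA1].
  rewrite -setI_eq0 setIUr setU_eq0 !setI_eq0; exact/andP.
by rewrite inE => /orP[/A12|bC]; [apply | apply: AC => //; apply: inl].
Qed.

Lemma fspace_sumA : associative fspace_sum.
Proof.
move=> X Y Z; have [n [J e]] := fspace_cl (fspace_sum (fspace_sum X Y) Z).
have [A [C [eT dAC eA eC AC]]] := sum_split (esym e).
have [A1 [A2 [eA12 d12 eX eY A12]]] := sum_split eA.
rewrite e eT -{}eC -{}eX -{}eY; move: dAC AC; rewrite eA12 => /disjoint_subl[d1C d2C] AC.
have inl x : x \in A1 -> x \in A1 :|: A2 by rewrite inE => ->.
have inr x : x \in A2 -> x \in A1 :|: A2 by rewrite inE => ->; rewrite orbT.
rewrite cl_sum // => [|a c aA2 cC]; last by apply: AC => //; apply: inr.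
rewrite cl_sum ?setUA // => [|a b aA1].
  rewrite -setI_eq0 setIUr setU_eq0 !setI_eq0; exact/andP.
by rewrite inE => /orP[/A12|bC]; [apply | apply: AC => //; apply: inl].
Qed.

Lemma fspace_sumC : commutative fspace_sum.
Proof.
move=> X Y; have [n [J e]] := fspace_cl (fspace_sum X Y).
have [A [B [eT dAB <- <- AB]]] := sum_split (esym e).
rewrite cl_sum // setUC -cl_sum // 1?disjoint_sym // => b a bB aA.
by rewrite andbC; apply: AB.
Qed.

Lemma fspace_join1l : left_id fspace1 fspace_join.
Proof.
move=> X; have [n [J ->]] := fspace_cl X.
rewrite -((cl_eq1 J set0).2 erefl) cl_join ?set0U // => [|a b]; last by rewrite inE.
by rewrite -setI_eq0 set0I.
Qed.

Lemma fspace_join1r : right_id fspace1 fspace_join.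
Proof.
move=> X; have [n [J ->]] := fspace_cl X.
rewrite -((cl_eq1 J set0).2 erefl) cl_join ?setU0 // => [|a b _]; last by rewrite inE.
by rewrite -setI_eq0 setI0.
Qed.

Lemma fspace_sum1l : left_id fspace1 fspace_sum.
Proof.
move=> X; have [n [J ->]] := fspace_cl X.
rewrite -((cl_eq1 J set0).2 erefl) cl_sum ?set0U // => [|a b]; last by rewrite inE.
by rewrite -setI_eq0 set0I.
Qed.

Lemma fspace_deg_join X Y :
  fspace_deg (fspace_join X Y) = (fspace_deg X + fspace_deg Y)%N.
Proof. exact: fspace_deg_fclass. Qed.

Lemma fspace_deg_sum X Y :
  fspace_deg (fspace_sum X Y) = (fspace_deg X + fspace_deg Y)%N.
Proof. exact: fspace_deg_fclass. Qed.

(* C stands for the upper part of a decomposition; quantifying over C instead of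
   over pairs of finite spaces makes the predicate boolean. *)
Definition join_irr (X : fspace) : bool :=
  (X != fspace1) && ~~ [exists C : {set 'I_(fspace_deg X)},
    [&& C != set0, C != setT &
        fspace_join (cl (fspace_top X) (~: C)) (cl (fspace_top X) C) == X]].

Lemma join_irrP X : reflect
  (X <> fspace1 /\ forall Y Z, X = fspace_join Y Z -> Y = fspace1 \/ Z = fspace1)
  (join_irr X).
Proof.
apply: (iffP andP) => [[/eqP X1 /existsP h]|[X1 h]]; split=> //.
- move=> Y Z e; have e' : cl (fspace_top X) setT = fspace_join Y Z.
    by rewrite -fclass_clT fspace_topK.
  have [A [B [eT dAB eA eB _]]] := join_split e'.
  have eAB : A = ~: B.
    apply/setP=> x; rewrite inE; have := in_setT x; rewrite eT inE.
    have [xB _|xB] := boolP (x \in B); last by rewrite orbF.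
    by rewrite (disjointFl dAB xB).
  case: (B =P set0) => [B0|/eqP B0].
    by right; rewrite -eB B0; apply/cl_eq1.
  case: (B =P setT) => [BT|/eqP BT].
    by left; rewrite -eA eAB BT setCT; apply/cl_eq1.
  by case: h; exists B; rewrite B0 BT -eAB eA eB -e eqxx.
- exact/eqP.
- apply/existsP => -[C /and3P[/eqP C0 /eqP CT /eqP e]].
  case: (h _ _ (esym e)) => /cl_eq1 // C0'; apply: CT.
  by rewrite -[C]setCK C0' setC0.
Qed.

(** [A] is [A'] placed below the difference of [B'] and [B]. Since [A] is irreducible and [A']
    nonempty, that difference is empty. *)
Lemma join_cancel_sub n (J : topology 'I_n) (A B A' B' : {set 'I_n}) :
  A :|: B = setT -> A' :|: B' = setT -> [disjoint A & B] -> [disjoint A' & B'] ->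
  below J A B -> below J A' B' -> join_irr (cl J A) -> cl J A' <> fspace1 ->
  B \subset B' -> B = B'.
Proof.
move=> eAB eAB' dAB dAB' hAB hAB' /join_irrP[_ irr] A'1 sBB'.
have compl (C D : {set 'I_n}) x :
    C :|: D = setT -> [disjoint C & D] -> (x \in C) = (x \notin D).
  move=> CD dCD; have := in_setT x; rewrite -CD inE.
  have [xD _|xD] := boolP (x \in D); last by rewrite orbF.
  by rewrite (disjointFl dCD xD).
have eA : A = A' :|: (B' :\: B).
  apply/setP=> x; rewrite !inE (compl _ _ x eAB dAB) (compl _ _ x eAB' dAB').
  by have /implyP := subsetP sBB' x; case: (x \in B); case: (x \in B').
have e : cl J A = fspace_join (cl J A') (cl J (B' :\: B)).
  rewrite eA cl_join // => [|a b aA']; last by rewrite inE => /andP[_]; apply: hAB'.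
  by apply: disjointWr dAB'; apply: subsetDl.
case: (irr _ _ e) => // /cl_eq1/eqP; rewrite setD_eq0 => sB'B.
by apply/eqP; rewrite eqEsubset sBB'.
Qed.

Lemma join_cancel X Y X' Y' : join_irr X -> join_irr X' ->
  fspace_join X Y = fspace_join X' Y' -> X = X' /\ Y = Y'.
Proof.
move=> irr irr' e; have [n [J eJ]] := fspace_cl (fspace_join X Y).
have [A [B [eT dAB eA eB AB]]] := join_split (esym eJ).
have [A' [B' [eT' dAB' eA' eB' AB']]] := join_split (etrans (esym eJ) e).
suff eBB' : B = B'.
  split; last by rewrite -eB eBB' eB'.
  rewrite -eA -eA'; congr cl; apply/setP=> x.
  have := in_setT x; rewrite eT inE; have := in_setT x; rewrite eT' inE eBB'.
  have [xB _ _|xB] := boolP (x \in B'); last by rewrite !orbF => -> ->.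
  by rewrite (disjointFl dAB') // (disjointFl dAB) // eBB'.
have [[X1 _] [X'1 _]] := (join_irrP _ irr, join_irrP _ irr').
have [sBB'|/subsetPn[b bB bB']] := boolP (B \subset B').
  by apply: (@join_cancel_sub _ J A B A' B') => //; rewrite ?eA ?eA'.
have [sB'B|/subsetPn[b' b'B' b'B]] := boolP (B' \subset B).
  by apply/esym; apply: (@join_cancel_sub _ J A' B' A B) => //; rewrite ?eA ?eA'.
(* Incomparable upper parts are impossible: the first decomposition puts [b'] strictly below [b],
   the second [b] below [b']. *)
have b'A : b' \in A by have := in_setT b'; rewrite eT inE (negbTE b'B) orbF.
have bA' : b \in A' by have := in_setT b; rewrite eT' inE (negbTE bB') orbF.
by have := AB' _ _ bA' b'B'; have /andP[_ /negbTE->] := AB _ _ b'A bB.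
Qed.

(** * The coproduct *)

Section Upper.
Variables (S : finType) (T : topology S).
Implicit Types (A B C : {set S}).

(* The space being finite, the open subsets of A are the up-sets of A for the
   specialization preorder. *)
Definition openin A B : bool :=
  (B \subset A) && [forall x in B, forall y in A, spec T x y ==> (y \in B)].

Lemma openinP A B : reflect
  (B \subset A /\ forall x y, x \in B -> y \in A -> spec T x y -> y \in B)
  (openin A B).
Proof.
apply: (iffP andP) => -[sBA h]; split=> //.
  move=> x y xB yA; move/forall_inP: h => /(_ _ xB)/forall_inP/(_ _ yA)/implyP.
  exact.
apply/forall_inP => x xB; apply/forall_inP => y yA; apply/implyP; exact: h.
Qed.

Lemma openin_refl A : openin A A.
Proof. by apply/openinP; split. Qed.

Lemma openin0 A : openin A set0.
Proof. by apply/openinP; split=> [|x y]; rewrite ?sub0set ?inE. Qed.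

(** This is coassociativity at the level of sets: both sums run over flags of two up-sets of [A]. On
    the left the larger one is the union of [B] and [C], on the right it is [B]. *)
Lemma sum_openin_chain A (W : zmodType)
    (F : {set S} -> {set S} -> {set S} -> W) :
  \sum_(B | openin A B) \sum_(C | openin (A :\: B) C) F (A :\: B :\: C) C B
  = \sum_(B | openin A B) \sum_(C | openin B C) F (A :\: B) (B :\: C) C.
Proof.
rewrite pair_big_dep.
rewrite [RHS]pair_big_dep.
rewrite (reindex_onto (fun p : {set _} * {set _} => (p.2, p.1 :\: p.2))
  (fun p : {set _} * {set _} => (p.1 :|: p.2, p.1))); last first.
  move=> [B C] /= /andP[_ /andP[sC _]]; congr (_, _).
  apply/setP=> x; rewrite !inE; have /implyP := subsetP sC x.
  by rewrite inE; case: (x \in B); case: (x \in C).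
have sub B C : C :|: B :\: C = B -> C \subset B.
  by move=> <-; apply: subsetUl.
apply: eq_big => [[B C]|[B C] /andP[_ /eqP[/sub sCB]]] /=; last first.
  rewrite setDDl; congr (F (_ :\: _) _ _).
  by apply/setP=> x; rewrite !inE; have /implyP := subsetP sCB x; case: (x \in C).
rewrite xpair_eqE eqxx andbT; apply/andP/andP.
  case=> /andP[/openinP[sCA hC] /openinP[sB hB]] /eqP e; have sCB := sub _ _ e.
  split; apply/openinP; split=> //.
  - rewrite -e subUset sCA; apply: subset_trans sB _; exact: subsetDl.
  - move=> x y xB yA xy; have [yC|yC] := boolP (y \in C); first exact: (subsetP sCB).
    have [xC|xC] := boolP (x \in C); first by rewrite (hC x y) in yC.
    by have := hB x y; rewrite !inE xC xB yC yA => /(_ isT isT xy).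
  - move=> x y xC yB; apply: hC => //.
    have : y \in C :|: B :\: C by rewrite e.
    by rewrite inE => /orP[/(subsetP sCA) //|/(subsetP sB)]; rewrite inE => /andP[].
case=> /openinP[sBA hB] /openinP[sCB hC].
have e : C :|: B :\: C = B.
  by apply/setP=> x; rewrite !inE; have /implyP := subsetP sCB x; case: (x \in C).
rewrite e eqxx; split=> //; apply/andP; split; apply/openinP; split.
- exact: subset_trans sCB sBA.
- move=> x y xC yA xy; apply: (hC x) => //; apply: (hB x) => //.
  exact: (subsetP sCB).
- exact: setSD.
- move=> x y; rewrite !inE => /andP[_ xB] /andP[yC yA] xy; rewrite yC /=.
  exact: (hB x).
Qed.

Variable K : fieldType.

(** The sum over open sets of a subspace, indexed by subsets of the ambient space through
    [enum_val], so that iterated coproducts stay inside one set. *)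
Lemma coprod_cl A : coprod K << (cl T A : finsp) >>
  = \sum_(B : {set S} | openin A B) << (cl T (A :\: B) : finsp, cl T B : finsp) >>.
Proof.
rewrite /cl coprodE /top_coprod.
pose im (O : {set 'I_#|A|}) : {set S} := (@enum_val _ (mem A)) @: O.
pose pre (B : {set S}) : {set 'I_#|A|} := (@enum_val _ (mem A)) @^-1: B.
have imA O : im O \subset A.
  by apply/subsetP => _ /imsetP[i _ ->]; apply: (@enum_valP _ (mem A)).
have imK B : B \subset A -> im (pre B) = B.
  move=> sBA; apply/setP=> x; apply/imsetP/idP => [[i]|xB].
    by rewrite inE => iB ->.
  have xA := subsetP sBA _ xB; exists (enum_rank_in xA x).
    by rewrite inE enum_rankK_in.
  by rewrite enum_rankK_in.
have mem_im O i : (enum_val i \in im O) = (i \in O).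
  by rewrite mem_imset //; apply: enum_val_inj.
have preK O : pre (im O) = O by apply/setP=> i; rewrite inE mem_im.
rewrite [RHS](reindex_onto im pre) /= => [|B /andP[/imK]]; last by [].
apply: eq_big => [O|O OT].
  rewrite preK eqxx andbT; apply/(open_specP (top_restr T A))/openinP => [h|[_ h] i j iO].
    split=> // x y /imsetP[i iO ->] yA.
    rewrite -(enum_rankK_in yA yA) mem_im -spec_restr; exact: h.
  rewrite spec_restr -!mem_im; apply: h; rewrite ?mem_im //.
  exact: (@enum_valP _ (mem A)).
have eC : A :\: im O = im (~: O).
  apply/setP=> x; rewrite inE; apply/andP/imsetP => [[xO xA]|[i iO ->]].
    exists (enum_rank_in xA x); last by rewrite enum_rankK_in.
    by rewrite inE -mem_im enum_rankK_in.
  split; last exact: (@enum_valP _ (mem A)).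
  by rewrite mem_im; rewrite inE in iO.
rewrite -/(cl _ _) -/(cl _ (im O)) eC; congr (<< (_, _) >>).
  exact: cl_restr.
exact: cl_restr.
Qed.

End Upper.

Section Coalgebra.
Variable K : fieldType.
Local Notation F := {malg K[finsp]}.
Local Notation FF := {malg K[(finsp * finsp)%type]}.

Lemma tassocUU (X Y Z : choiceType) (x : X) (y : Y) (z : Z) :
  tassoc << ((x, y), z) >> = << (x, (y, z)) >> :> {malg K[(X * (Y * Z))%type]}.
Proof. exact: lextU. Qed.

Lemma lcontrUU (B : vectp) (Y : choiceType) (x : B) (y : Y) :
  lcontr (@counit K B) << (x, y) >> = counit (<< x >> : {malg K[B]}) *: << y >>.
Proof. exact: lextU. Qed.

Lemma rcontrUU (B : vectp) (Y : choiceType) (x : Y) (y : B) :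
  rcontr (@counit K B) << (x, y) >> = counit (<< y >> : {malg K[B]}) *: << x >>.
Proof. exact: lextU. Qed.

Lemma counit_cl (S : finType) (T : topology S) A :
  counit (<< (cl T A : finsp) >> : F) = (A == set0)%:R.
Proof.
rewrite counitU; have -> // : ((cl T A : finsp) == b1) = (A == set0).
by apply/eqP/eqP => /cl_eq1.
Qed.

Lemma hom_coprod : homogeneous fspace_deg (tdeg fspace_deg fspace_deg) (coprod K).
Proof.
move=> X; rewrite -/(supported _ _); have [n [J ->]] := fspace_cl X.
rewrite coprod_cl; apply: supp_sum => B /andP[sB _]; apply: suppU.
by rewrite /tdeg /= !fspace_deg_cl addnC -[in RHS](cardsID B) (setIidPr sB).
Qed.

Lemma coprod_coassoc x :
  tassoc (tmap (coprod K) id (coprod K x)) = tmap id (coprod K) (coprod K x).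
Proof.
move: x; apply: eq_linear => [||X]; try by lin.
have [n [J ->]] := fspace_cl X; move: setT => A.
rewrite coprod_cl !tmap_sum tassoc_sum.
transitivity (\sum_(B | openin J A B) \sum_(C | openin J (A :\: B) C)
  << (cl J (A :\: B :\: C) : finsp, (cl J C : finsp, cl J B : finsp)) >>
  : {malg K[(finsp * (finsp * finsp))%type]}).
  apply: eq_bigr => B _; rewrite tmapUU coprod_cl.
  rewrite tens_suml tassoc_sum; apply: eq_bigr => C _.
  by rewrite tensUU tassocUU.
transitivity (\sum_(B | openin J A B) \sum_(C | openin J B C)
  << (cl J (A :\: B) : finsp, (cl J (B :\: C) : finsp, cl J C : finsp)) >>
  : {malg K[(finsp * (finsp * finsp))%type]}); last first.
  apply: eq_bigr => B _; rewrite tmapUU coprod_cl.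
  rewrite tens_sumr; by apply: eq_bigr => C _; rewrite tensUU.
exact: (sum_openin_chain J A (fun A1 A2 A3 =>
  << (cl J A1 : finsp, (cl J A2 : finsp, cl J A3 : finsp)) >>)).
Qed.

Lemma coprod_is_coalgebra : is_coalgebra (coprod K).
Proof.
split; first exact: hom_coprod.
- have [n [J e]] := fspace_cl fspace1.
  rewrite /unit1 /= e coprod_cl; have -> : setT = set0 :> {set 'I_n}.
    by apply/(cl_eq1 J); rewrite -e.
  rewrite (big_pred1 set0) ?set0D ?tensUU // => B.
  apply/openinP/eqP => [[]|->]; first by rewrite subset0 => /eqP.
  by split=> [|x y]; rewrite ?sub0set ?inE.
- exact: coprod_coassoc.
- apply: eq_linear => [||X]; try by lin.
  have [n [J ->]] := fspace_cl X; move: setT => A.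
  rewrite coprod_cl lcontr_sum (bigD1 A) ?openin_refl //=.
  rewrite big1 ?addr0 => [|B /andP[/andP[sBA _] BA]].
    by rewrite [LHS](@lcontrUU finsp) counit_cl setDv eqxx scale1r.
  rewrite [LHS](@lcontrUU finsp) counit_cl setD_eq0.
  suff -> : (A \subset B) = false by rewrite scale0r.
  by apply: contraNF BA => sAB; rewrite eqEsubset sBA.
- apply: eq_linear => [||X]; try by lin.
  have [n [J ->]] := fspace_cl X; move: setT => A.
  rewrite coprod_cl rcontr_sum (bigD1 set0) ?openin0 //=.
  rewrite big1 ?addr0 => [|B /andP[_ /negbTE B0]].
    by rewrite [LHS](@rcontrUU finsp) counit_cl setD0 eqxx scale1r.
  by rewrite [LHS](@rcontrUU finsp) counit_cl B0 scale0r.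
Qed.

End Coalgebra.

Section UnionSums.
Variables (S : finType) (J : topology S) (A B : {set S}) (W : zmodType).
Variable F : {set S} -> {set S} -> W.
Hypothesis dAB : [disjoint A & B].

Let inA x : x \in A -> (x \in B) = false.
Proof. exact: disjointFr. Qed.

(** No relation joins the two blocks, so an up-set of their union is an independent choice of one in
    each. *)
Lemma sum_openin_apart : apart J A B ->
  \sum_(C | openin J (A :|: B) C) F ((A :|: B) :\: C) C
  = \sum_(C | openin J A C) \sum_(D | openin J B D)
      F ((A :\: C) :|: (B :\: D)) (C :|: D).
Proof.
move=> hAB; rewrite pair_big_dep.
rewrite (reindex_onto (fun p : {set _} * {set _} => p.1 :|: p.2)
  (fun C => (C :&: A, C :&: B))) /=; last first.
  by move=> C /andP[sC _]; rewrite -setIUr; apply/setIidPl.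
have rel x y : x \in A -> y \in B -> (spec J x y = false) * (spec J y x = false).
  by move=> xA yB; have /andP[/negbTE-> /negbTE->] := hAB _ _ xA yB.
apply: eq_big => [[C D]|[C D]] /=; last first.
  move=> /andP[_]; rewrite xpair_eqE => /andP[/eqP eC /eqP eD].
  congr (F _ _); apply/setP=> x; rewrite !inE.
  have := in_set0 x; move/setP/(_ x): eC; move/setP/(_ x): eD; rewrite !inE.
  have := @inA x; case: (x \in A); case: (x \in B); case: (x \in C);
    case: (x \in D) => //= h; by have := h isT.
rewrite xpair_eqE; apply/idP/idP.
  case/and3P=> /openinP[sCD hCD] /eqP eC /eqP eD.
  apply/andP; split; apply/openinP; split.
  - by rewrite -eC subsetIr.
  - move=> x y xC yA xy; rewrite -eC !inE yA andbT.
    by have := hCD x y; rewrite !inE xC yA => /(_ isT isT xy).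
  - by rewrite -eD subsetIr.
  - move=> x y xD yB xy; rewrite -eD !inE yB andbT.
    by have := hCD x y; rewrite !inE xD yB !orbT => /(_ isT isT xy).
case/andP=> /openinP[sC hC] /openinP[sD hD]; apply/and3P; split.
- apply/openinP; split; first exact: setUSS.
  move=> x y; rewrite !inE => /orP[xC|xD] /orP[yA|yB] xy.
  + by rewrite (hC x y).
  + by have := rel _ _ (subsetP sC _ xC) yB; rewrite xy => -[].
  + by have := rel _ _ yA (subsetP sD _ xD); rewrite xy => -[].
  + by rewrite (hD x y) ?orbT.
- apply/eqP/setP=> x; rewrite !inE; have := @inA x.
  have /implyP := subsetP sC x; have /implyP := subsetP sD x.
  by case: (x \in A); case: (x \in B); case: (x \in C);
    case: (x \in D) => //= _ _ h; have := h isT.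
- apply/eqP/setP=> x; rewrite !inE; have := @inA x.
  have /implyP := subsetP sC x; have /implyP := subsetP sD x.
  by case: (x \in A); case: (x \in B); case: (x \in C);
    case: (x \in D) => //= _ _ h; have := h isT.
Qed.

Lemma sum_openin_below : below J A B ->
  \sum_(C | openin J (A :|: B) C) F ((A :|: B) :\: C) C
  = \sum_(C | openin J B C) F (A :|: (B :\: C)) C
    + \sum_(C | openin J A C) F (A :\: C) (C :|: B) - F A B.
Proof.
(* Up-sets containing [B] correspond to up-sets of [A], the others are proper up-sets of [B]. The
   set [B] itself is counted in both sums on the right, hence the subtracted term. *)
move=> hAB; rewrite (bigID (fun C : {set S} => B \subset C)) /= addrC.
have rel x y : x \in A -> y \in B -> (spec J x y = true) * (spec J y x = false).
  by move=> xA yB; have /andP[-> /negbTE->] := hAB _ _ xA yB.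
have -> : \sum_(C | openin J B C) F (A :|: (B :\: C)) C
   = F A B + \sum_(C | openin J B C && (C != B)) F (A :|: (B :\: C)) C.
  by rewrite (bigD1 B) ?openin_refl //= setDv setU0.
rewrite -[F A B + _ + _]addrA [RHS]addrC addKr; congr (_ + _).
  have sCB C : openin J (A :|: B) C -> ~~ (B \subset C) -> C \subset B.
    move=> /openinP[sC hC] /subsetPn[b bB bC]; apply/subsetP => x xC.
    have := subsetP sC _ xC; rewrite inE => /orP[xA|//].
    by have := hC x b xC; rewrite inE bB orbT (rel _ _ xA bB) (negbTE bC) => /(_ isT isT).
  apply: eq_big => [C|C /andP[oC BC]]; last first.
    congr F; rewrite setDUl; congr (_ :|: _); apply/setDidPl.
    exact: disjointWr (sCB _ oC BC) dAB.
  apply/andP/andP => [[oC BC]|[/openinP[sC hC] CB]].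
    have sC := sCB _ oC BC; split; last first.
      by apply: contraNneq BC => ->.
    have [_ hC] := openinP _ _ _ oC; apply/openinP; split=> // x y xC yB.
    by apply: hC => //; rewrite inE yB orbT.
  split; last by apply: contraNN CB => sBC; rewrite eqEsubset sC.
  apply/openinP; split=> [|x y xC].
    by apply: subset_trans sC _; apply: subsetUr.
  rewrite inE => /orP[yA|yB] xy; last exact: (hC x).
  by have := rel _ _ yA (subsetP sC _ xC); rewrite xy => -[].
rewrite (reindex_onto (fun C => C :|: B) (fun C => C :&: A)) /=; last first.
  move=> C /andP[/openinP[sC _] sBC]; apply/setP=> x; rewrite !inE.
  have /implyP := subsetP sC x; have /implyP := subsetP sBC x; rewrite inE.
  by case: (x \in A); case: (x \in B); case: (x \in C).
apply: eq_big => [C|C]; last first.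
  case/andP => _ /eqP eC; congr F; apply/setP=> x.
  move/setP/(_ x): eC; rewrite !inE; have := @inA x.
  by case: (x \in A); case: (x \in B); case: (x \in C) => //= h; have := h isT.
apply/andP/openinP => [[/andP[/openinP[_ hC] _] /eqP eC]|[sC hC]].
  split=> [|x y xC yA xy]; first by rewrite -eC subsetIr.
  by rewrite -eC inE yA andbT; apply: (hC x) => //; rewrite inE ?xC ?yA.
rewrite subsetUr andbT; split.
  apply/openinP; split=> [|x y]; first exact: setSU.
  rewrite !inE => /orP[xC|xB] /orP[yA|yB] xy; rewrite ?yB ?orbT //.
    by rewrite (hC x y).
  by have := rel _ _ yA xB; rewrite xy => -[].
apply/eqP/setP=> x; rewrite !inE; have := @inA x; have /implyP := subsetP sC x.
by case: (x \in A); case: (x \in B); case: (x \in C) => //= _ h; have := h isT.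
Qed.

End UnionSums.

(** * The sum and join products *)

Section Products.
Variable K : fieldType.
Local Notation F := {malg K[finsp]}.
Local Notation FF := {malg K[(finsp * finsp)%type]}.

Lemma sum_prodUU (X Y : fspace) :
  sum_prod K << (X : finsp, Y : finsp) >> = << (fspace_sum X Y : finsp) >>.
Proof. exact: lextU. Qed.

Lemma join_prodUU (X Y : fspace) :
  join_prod K << (X : finsp, Y : finsp) >> = << (fspace_join X Y : finsp) >>.
Proof. exact: lextU. Qed.

Lemma sum_prodE (X Y : fspace) :
  sum_prod K (<< (X : finsp) >> \ox << (Y : finsp) >>) = << (fspace_sum X Y : finsp) >>.
Proof. by rewrite tensUU sum_prodUU. Qed.

Lemma join_prodE (X Y : fspace) :
  join_prod K (<< (X : finsp) >> \ox << (Y : finsp) >>) = << (fspace_join X Y : finsp) >>.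
Proof. by rewrite tensUU join_prodUU. Qed.

Lemma basis_algebra (B : vectp) (f : B -> B -> B)
    (m : {linear {malg K[(B * B)%type]} -> {malg K[B]}}) :
  (forall x y, m << (x, y) >> = << f x y >>) ->
  (forall x y, deg (f x y) = (deg x + deg y)%N) ->
  associative f -> left_id b1 f -> right_id b1 f -> is_algebra m.
Proof.
move=> mE fdeg fA f1 f1r.
have mE' x y : m (<< x >> \ox << y >>) = << f x y >> by rewrite tensUU mE.
split.
- by move=> [x y]; rewrite -/(supported _ _) mE; apply: suppU; apply: fdeg.
- move=> x y z; move: x; apply: eq_linear => [||x]; try by lin.
  move: y z; apply: eq_bilinear => [z|y|z|y|y z]; try by lin.
  apply: etrans (congr1 (fun u => m (u \ox _)) (mE' x y)) _.
  apply: etrans _ (congr1 (fun u => m (_ \ox u)) (esym (mE' y z))).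
  by apply: etrans (mE' _ _) _; apply: etrans _ (esym (mE' _ _)); rewrite fA.
- by apply: eq_linear => [||x]; try lin; apply: etrans (mE' _ _) _; rewrite f1.
- by apply: eq_linear => [||x]; try lin; apply: etrans (mE' _ _) _; rewrite f1r.
Qed.

Lemma sum_prod_is_algebra : is_algebra (sum_prod K).
Proof.
apply: (@basis_algebra finsp fspace_sum).
- exact: sum_prodUU.
- exact: fspace_deg_sum.
- exact: fspace_sumA.
- exact: fspace_sum1l.
- by move=> X; rewrite fspace_sumC fspace_sum1l.
Qed.

Lemma join_prod_is_algebra : is_algebra (join_prod K).
Proof.
apply: (@basis_algebra finsp fspace_join).
- exact: join_prodUU.
- exact: fspace_deg_join.
- exact: fspace_joinA.
- exact: fspace_join1l.
- exact: fspace_join1r.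
Qed.

Lemma sum_prod_commutative : is_commutative (sum_prod K).
Proof.
move=> x y; move: x y; apply: eq_bilinear => [y|x|y|x|X Y]; try by lin.
apply: etrans (sum_prodE X Y) _; apply: etrans _ (esym (sum_prodE Y X)).
by rewrite fspace_sumC.
Qed.

Lemma mul2_sum (m : {linear FF -> F}) I J (r : seq I) (s : seq J) (P : pred I)
    (Q : pred J) (f : I -> FF) (g : J -> FF) :
  mul2 m (\sum_(i <- r | P i) f i) (\sum_(j <- s | Q j) g j)
  = \sum_(i <- r | P i) \sum_(j <- s | Q j) mul2 m (f i) (g j).
Proof.
rewrite (lin_sum (lin_mul2l m _)); apply: eq_bigr => i _.
by rewrite (lin_sum (lin_mul2r m _)).
Qed.

(** Here the variable sits inside a map argument of [tmap], a position [lin] does not handle; the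
    infinitesimal relation requires it. *)
Lemma lin_tmapl (X Y X' : choiceType) (U : lmodType K)
    (f : U -> {malg K[X]} -> {malg K[X']}) (t : {malg K[(X * Y)%type]}) :
  (forall x, islin (fun u => f u x)) -> islin (fun u => tmap (f u) id t).
Proof.
by move=> fl; rewrite /tmap /lext; apply: lin_big => p;
  apply: lin_scale; apply: lin_tensl.
Qed.

Lemma lin_tmapr (X Y Y' : choiceType) (U : lmodType K)
    (f : U -> {malg K[Y]} -> {malg K[Y']}) (t : {malg K[(X * Y)%type]}) :
  (forall x, islin (fun u => f u x)) -> islin (fun u => tmap id (f u) t).
Proof.
by move=> fl; rewrite /tmap /lext; apply: lin_big => p;
  apply: lin_scale; apply: lin_tensr.
Qed.

Lemma openin_sub (S : finType) (J : topology S) A B : openin J A B -> B \subset A.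
Proof. by case/openinP. Qed.

(** The factors become two incomparable blocks of one space, where [sum_openin_apart] factors the
    sum over up-sets. *)
Lemma coprod_sum x y :
  coprod K (sum_prod K (x \ox y)) = mul2 (sum_prod K) (coprod K x) (coprod K y).
Proof.
move: x y; apply: eq_bilinear => [y|x|y|x|X Y]; try by [lin | rewrite /mul2; lin].
have [n [J e]] := fspace_cl (fspace_sum X Y).
have [A [B [_ dAB <- <- AB]]] := sum_split (esym e).
apply: etrans (congr1 (coprod K) (sum_prodE _ _)) _.
apply: etrans _ (esym (congr2 (mul2 (sum_prod K)) (coprod_cl J K A) (coprod_cl J K B))).
rewrite (cl_sum dAB AB).
rewrite coprod_cl.
apply: etrans (sum_openin_apart
  (fun C D => << (cl J C : finsp, cl J D : finsp) >>) dAB AB) _.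
rewrite mul2_sum; apply: eq_bigr => C /openin_sub sC; apply: eq_bigr => D /openin_sub sD.
rewrite -!tensUU mul2E.
apply: etrans _ (esym (congr2 (@tens K _ _) (sum_prodE _ _) (sum_prodE _ _))).
rewrite [fspace_sum (cl J C) _]cl_sum; last first.
- by move=> a b aC bD; apply: AB; [apply: (subsetP sC) | apply: (subsetP sD)].
- by apply: disjointW sC sD dAB.
rewrite cl_sum; last first.
- by move=> a b; rewrite !inE => /andP[_ aA] /andP[_ bB]; apply: AB.
- by apply: disjointW dAB; apply: subsetDl.
by rewrite tensUU.
Qed.


Lemma coprod_join x y :
  coprod K (join_prod K (x \ox y))
  = tmap (fun y1 => join_prod K (x \ox y1)) id (coprod K y)
    + tmap id (fun x2 => join_prod K (x2 \ox y)) (coprod K x) - x \ox y.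
Proof.
move: x y; apply: eq_bilinear => [y|x|y|x|X Y]; try by lin.
- apply: lin_add; last by lin.
  by apply: lin_add; [apply: lin_tmapl => y1; lin | lin].
- apply: lin_add; last by lin.
  by apply: lin_add; [lin | apply: lin_tmapr => x1; lin].
have [n [J e]] := fspace_cl (fspace_join X Y).
have [A [B [_ dAB <- <- AB]]] := join_split (esym e).
apply: etrans (congr1 (coprod K) (join_prodE _ _)) _.
rewrite (cl_join dAB AB).
apply: etrans (coprod_cl J K (A :|: B)) _.
apply: etrans (sum_openin_below
  (fun C D => << (cl J C : finsp, cl J D : finsp) >>) dAB AB) _.
apply: (congr2 (fun s t => s - t)); last by rewrite tensUU.
apply: (congr2 (fun s t => s + t)).
  apply: etrans _ (esym (congr1 (tmap _ _) (coprod_cl J K B))).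
  apply: etrans _ (esym (tmap_sum _ _ _ _ _)).
  apply: eq_bigr => C /openin_sub sC.
  apply: etrans _ (esym (tmapUU _ _ _ _)).
  apply: etrans _ (congr1 (fun u => u \ox _) (esym (join_prodE _ _))).
  rewrite tensUU cl_join; first by [].
    by apply: disjointWr dAB; apply: subsetDl.
  by move=> a b aA; rewrite inE => /andP[_]; apply: AB.
apply: etrans _ (esym (congr1 (tmap _ _) (coprod_cl J K A))).
apply: etrans _ (esym (tmap_sum _ _ _ _ _)).
apply: eq_bigr => C /openin_sub sC.
apply: etrans _ (esym (tmapUU _ _ _ _)).
apply: etrans _ (congr1 (fun u => _ \ox u) (esym (join_prodE _ _))).
rewrite tensUU cl_join; first by [].
  exact: disjointWl sC dAB.
by move=> a b /(subsetP sC); apply: AB.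
Qed.

End Products.

(** * Free generation of the join algebra by irreducible spaces *)

Definition irr_fspace : choiceType := {X : fspace | join_irr X}.

Lemma irr_deg_gt0 (X : irr_fspace) : (0 < fspace_deg (val X))%N.
Proof.
have /join_irrP[X1 _] := valP X.
by rewrite lt0n; apply/eqP => /fspace_deg_eq0.
Qed.

Definition irr_vect : vect := Vect irr_deg_gt0.

Section JoinWords.
Implicit Types (w : seq irr_fspace) (X : fspace).

Definition join_word w : fspace :=
  foldr (fun a X => fspace_join (val a) X) fspace1 w.

Lemma join_word_cat u v :
  join_word (u ++ v) = fspace_join (join_word u) (join_word v).
Proof.
elim: u => [|a u IHu] /=; first by rewrite fspace_join1l.
by rewrite IHu fspace_joinA.
Qed.

Lemma deg_join_word w : fspace_deg (join_word w) = @word_deg irr_vect w.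
Proof.
elim: w => [|a w IHw] /=.
  by rewrite [word_deg _](word_deg_eq0 _).2 //; apply/fspace_deg_eq0.
by rewrite fspace_deg_join IHw [in RHS]word_deg_cons.
Qed.

(** Uniqueness of the decomposition: [join_cancel] removes the first factors one after another. *)
Lemma join_word_inj : injective join_word.
Proof.
have nil w : join_word w = fspace1 -> w = [::].
  by move/fspace_deg_eq0; rewrite deg_join_word => /word_deg_eq0.
elim=> [|a u IHu] [|b v] //; first by move/esym/nil->.
  by move/nil.
by move=> /(join_cancel (valP a) (valP b))[/val_inj-> /IHu->].
Qed.

(** Strong induction on the number of points, a reducible space being cut at its witness [C]. The
    boolean equality allows [xchoose] to extract a word. *)
Lemma join_word_surj X : exists w, join_word w == X.
Proof.
have [n] := ubnP (fspace_deg X); elim: n X => // n IHn X Xn.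
have [->|X1] := X =P fspace1; first by exists [::].
have [Xirr|] := boolP (join_irr X).
  by exists [:: Sub X Xirr]; rewrite /= fspace_join1r.
rewrite negb_and negbK; case/orP => [/eqP//|]; rewrite negbK.
case/existsP=> C /and3P[C0 CT /eqP eX].
have cC : (#|~: C| + #|C| = fspace_deg X)%N by rewrite addnC cardsC card_ord.
have sub Y b : (fspace_deg Y + b = fspace_deg X)%N -> (0 < b)%N -> (fspace_deg Y < n)%N.
  by move=> e b0; apply: leq_trans (_ : fspace_deg X <= n)%N => //;
  rewrite -e -addn1 leq_add2l.
have [|u /eqP eu] := IHn (cl (fspace_top X) (~: C)).
  apply: (sub _ #|C|); first by rewrite fspace_deg_cl.
  by rewrite card_gt0.
have [|v /eqP ev] := IHn (cl (fspace_top X) C).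
  apply: (sub _ #|~: C|); first by rewrite fspace_deg_cl addnC.
  by rewrite card_gt0; apply: contraNneq CT => e; rewrite -[C]setCK e setC0.
by exists (u ++ v); rewrite join_word_cat eu ev eX.
Qed.

Definition irr_word X : seq irr_fspace := xchoose (join_word_surj X).

Lemma irr_wordK : cancel irr_word join_word.
Proof. by move=> X; exact/eqP/(xchooseP (join_word_surj X)). Qed.

Lemma join_wordK : cancel join_word irr_word.
Proof. by move=> w; apply: join_word_inj; rewrite irr_wordK. Qed.

End JoinWords.

Section FreeAlgebra.
Variable K : fieldType.
Local Notation T := (tensorp irr_vect).
Local Notation TV := {malg K[T]}.
Local Notation F := {malg K[finsp]}.

Definition of_word : {linear TV -> F} :=
  lext (fun w : T => << (join_word w : finsp) >>).

Definition to_word : {linear F -> TV} :=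
  lext (fun X : finsp => << (irr_word X : T) >>).

Lemma of_wordU (w : T) : of_word << w >> = << (join_word w : finsp) >>.
Proof. exact: lextU. Qed.

Lemma to_wordU (X : finsp) : to_word << X >> = << (irr_word X : T) >>.
Proof. exact: lextU. Qed.

Lemma of_wordK : cancel of_word to_word.
Proof.
apply: eq_linear => [||w]; try by lin.
by rewrite of_wordU to_wordU join_wordK.
Qed.

Lemma to_wordK : cancel to_word of_word.
Proof.
apply: eq_linear => [||X]; try by lin.
by rewrite to_wordU of_wordU irr_wordK.
Qed.

Lemma hom_of_word : homogeneous (@deg T) (@deg finsp) of_word.
Proof.
move=> w; rewrite -/(supported _ _) of_wordU; apply: suppU.
exact: deg_join_word.
Qed.

Lemma hom_to_word : homogeneous (@deg finsp) (@deg T) to_word.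
Proof.
move=> X; rewrite -/(supported _ _) to_wordU; apply: suppU.
by rewrite /= -deg_join_word irr_wordK.
Qed.

Lemma of_word1 : of_word (unit1 K T) = unit1 K finsp.
Proof. exact: of_wordU. Qed.

Lemma of_word_concat x y :
  of_word (concat irr_vect K (x \ox y)) = join_prod K (of_word x \ox of_word y).
Proof.
move: x y; apply: eq_bilinear => [y|x|y|x|u v]; try by lin.
apply: etrans (congr1 of_word (concatE K u v)) _; rewrite /word !of_wordU.
by apply: etrans _ (esym (join_prodE K _ _)); rewrite join_word_cat.
Qed.

Lemma sum_prod_is_bialgebra : is_bialgebra (sum_prod K) (coprod K).
Proof.
split; [exact: sum_prod_is_algebra | exact: coprod_is_coalgebra | |].
  exact: coprod_sum.
exact: algebra_counit_mul (sum_prod_is_algebra K).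
Qed.

Lemma join_prod_is_infinitesimal : is_infinitesimal (join_prod K) (coprod K).
Proof.
split; [exact: join_prod_is_algebra | exact: coprod_is_coalgebra |].
exact: coprod_join.
Qed.

End FreeAlgebra.

Lemma hopf_iso_of_coalgebra_iso (K : fieldType) (B C : vectp)
    (m : {linear {malg K[(B * B)%type]} -> {malg K[B]}})
    (D : {linear {malg K[B]} -> {malg K[(B * B)%type]}})
    (D' : {linear {malg K[C]} -> {malg K[(C * C)%type]}})
    (phi : {linear {malg K[B]} -> {malg K[C]}})
    (psi : {linear {malg K[C]} -> {malg K[B]}}) :
  cancel phi psi -> is_coalgebra_iso D D' phi ->
  is_hopf_iso m D (conj_mul phi psi m) D' phi.
Proof. by move=> phiK phiD; split=> // x y; apply: conj_mulE. Qed.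

Theorem theorem19 (K : fieldType) :
  is_commutative_hopf (sum_prod K) (coprod K) /\
  is_infinitesimal (join_prod K) (coprod K) /\
  (is_binfty_enveloping (sum_prod K) (coprod K) /\
   is_commutative_hopf (sum_prod K) (coprod K) /\ is_cofree (coprod K)) /\
  ((exists star prec succ :
      {linear {malg K[(finsp * finsp)%type]} -> {malg K[finsp]}},
      is_shuffle_bialgebra star prec succ (coprod K)) /\
   (exists d dprec dsucc :
      {linear {malg K[finsp]} -> {malg K[(finsp * finsp)%type]}},
      is_unshuffle_bialgebra (join_prod K) d dprec dsucc)).
Proof.
have sumD := sum_prod_is_bialgebra K.
have hopf : is_commutative_hopf (sum_prod K) (coprod K).
  by split; [exact: bialgebra_hopf sumD | exact: sum_prod_commutative].
have joinD := join_prod_is_infinitesimal K.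
have [theta [psi [thetaK psiK hom_theta hom_psi [theta1 thetaD]]]] :=
  coalgebra_iso_deconc joinD (@of_wordK K) (@to_wordK K) (@hom_of_word K)
    (@hom_to_word K) (of_word1 K) (@of_word_concat K).
have psi1 : psi (unit1 K finsp) = unit1 K (tensorp irr_vect).
  by rewrite -theta1 thetaK.
have psiD x : deconc irr_vect K (psi x) = tmap psi psi (coprod K x).
  rewrite -{2}[x]psiK thetaD.
  apply: etrans _ (esym (tmap_comp _ _ _ (lin_fun psi) (lin_fun psi))).
  by apply: etrans (esym (tmap_id _)) _; apply: eq_tmap => y /=; rewrite thetaK.
have iso : is_coalgebra_iso (coprod K) (deconc irr_vect K) psi.
  split=> //; first by exists theta.
  exact: homogeneous_counit (lin_fun psi) hom_psi psi1.
split; first exact: hopf; split; first exact: joinD; split.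
  split; last by split; [exact: hopf | exists irr_vect, psi].
  (* The product on T(V) is the sum conjugated by [psi]. As [psi] carries [coprod] to
     deconcatenation, the result is a B-infinity structure. *)
  exists irr_vect, (conj_mul psi theta (sum_prod K)); split; last first.
    by exists psi; apply: hopf_iso_of_coalgebra_iso.
  apply: bialgebra_hopf.
  exact: (transport_bialgebra thetaK hom_psi hom_theta psi1 (conj_mulE psiK _) psiD sumD).
split.
  (* The coproduct is prescribed, so transport runs along [theta]; the commutative product is the
     image of the shuffle rather than the sum. *)
  exists (conj_mul theta psi (shuffle irr_vect K)),
    (conj_mul theta psi (shprec irr_vect K)),
    (conj_mul theta psi (shsucc irr_vect K)).
  apply: (transport_shuffle_bialgebra psiK hom_theta hom_psi theta1
    (conj_mulE thetaK _) (conj_mulE thetaK _) (conj_mulE thetaK _) thetaD).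
  exact: shuffle_is_shuffle_bialgebra.
(* Now the product is prescribed, and [of_word] carries concatenation to the join; the cocommutative
   coproduct is the image of unshuffling. *)
exists (conj_comul (of_word K) (to_word K) (unshuffle irr_vect K)),
  (conj_comul (of_word K) (to_word K) (unprec irr_vect K)),
  (conj_comul (of_word K) (to_word K) (unsucc irr_vect K)).
apply: (transport_unshuffle_bialgebra (@to_wordK K) (@hom_of_word K)
  (@hom_to_word K) (of_word1 K) (@of_word_concat K)
  (conj_comulE (@of_wordK K) _) (conj_comulE (@of_wordK K) _)
  (conj_comulE (@of_wordK K) _)).
exact: unshuffle_is_unshuffle_bialgebra.
Qed.
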